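(* Let $K$ be a number field, and let $(V,\psi)$, $D$, $(V_{\mathrm{DR}},\psi_{\mathrm{DR}})$ and the family of $l$-adic representations $\rho_l\colon G_K\to \mathrm{GIso}_{(V_l,\psi_l)}(\mathbb{Q}_l)$ satisfy the standing assumptions listed in the context, of weight $n$. Assume that hypotheses (T) and ($\widetilde{\mathrm T}$) of the context hold, with group schemes $\mathcal{G}_{L}^{\mathrm{alg}}$ and $\widetilde{\mathcal{G}_{L}^{\mathrm{alg}}}$ over $\mathbb{Q}$, and put $\widetilde{\mathcal{G}_{K,1}^{\mathrm{alg}}}:=\ker\big(N\colon\widetilde{\mathcal{G}_K^{\mathrm{alg}}}\to\mathbb{G}_m\big)$. Then the natural map $$\widetilde i_{CC}\colon\pi_0(\widetilde{\mathcal{G}_{K,1}^{\mathrm{alg}}})\longrightarrow\pi_0(\widetilde{\mathcal{G}_{K}^{\mathrm{alg}}})$$ induced by inclusion is an isomorphism.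
   Context: Standing setting. $K$ is a number field, $G_K=\mathrm{Gal}(\overline K/K)$. $(V,\psi)$ is a rational polarized pure Hodge structure of weight $n$, $\psi\colon V\times V\to\mathbb{Q}(-n)$. $\mathrm{GIso}_{(V,\psi)}$ is the group of $g\in\mathrm{GL}_V$ with $\psi(gv,gw)=\chi(g)\psi(v,w)$ for some $\chi(g)\in\mathbb{G}_m$ and all $v,w$; $\mathrm{Iso}_{(V,\psi)}=\ker\chi$. For each prime $l$, $V_l=V\otimes\mathbb{Q}_l$, $\psi_l=\psi\otimes\mathbb{Q}_l$ (with the analogous groups), and $\rho_l$ is a continuous representation of $G_K$ on $V_l$ for which $\psi_l\colon V_l\times V_l\to\mathbb{Q}_l(-n)$ is $G_K$-equivariant. Assumptions: (D1) $D\subseteq\mathrm{End}_{\mathbb{Q}}(V)$ is a ring whose action on $V\otimes\mathbb{C}$ preserves the Hodge decomposition. (D2) $D$ has a structure of discrete $G_K$-module, giving $\rho_e\colon G_K\to\mathrm{Aut}_{\mathbb{Q}}(D)$. De Rham data: a $K$-vector space $V_{\mathrm{DR}}$ with a nondegenerate bilinear pairing $\psi_{\mathrm{DR}}\colon V_{\mathrm{DR}}\times V_{\mathrm{DR}}\to K(-n)$, a decreasing filtration $F^iV_{\mathrm{DR}}$ with graded pieces $G^iV_{\mathrm{DR}}=F^iV_{\mathrm{DR}}/F^{i+1}V_{\mathrm{DR}}$, and for each embedding $\sigma\colon K\to\mathbb{C}$ an isomorphism $V\otimes_{\mathbb{Q}}\mathbb{C}\simeq V_{\mathrm{DR}}\otimes_{K,\sigma}\mathbb{C}$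 compatible with the forms and with the Hodge filtrations. (DR1) There is a canonical embedding $D\subseteq\mathrm{End}_{\overline K}(V_{\mathrm{DR}}\otimes_K\overline K)$ compatible with these comparison isomorphisms. (DR2) The action of $D$ preserves the decomposition $V\otimes\mathbb{C}=\bigoplus_{i=0}^n G^iV_{\mathrm{DR}}\otimes_{K,\sigma}\mathbb{C}$. (R1) $(\rho_l)_l$ is strictly compatible in the sense of Serre and $\rho_l$ is of Hodge--Tate type at every prime of $\mathcal{O}_K$ over $l$. (R2) For each $l$ and each prime $v$ outside a finite set containing all primes over $l$, the eigenvalues of an (arithmetic) Frobenius at $v$ have complex absolute value $q_v^{-n/2}$. (R3) For each prime $\lambda\mid l$ there is a Hodge--Tate decomposition $V_l\otimes_{\mathbb{Q}_l}\mathbb{C}_l=\bigoplus_{i=0}^n G^iV_{\mathrm{DR}}\otimes_K\mathbb{C}_l(i-n)$, $\mathbb{C}_l=\widehat{\overline K}_\lambda$. (R4) $\rho_l(\sigma)(\beta v)=\sigma(\beta)\rho_l(\sigma)(v)$ for $\beta\in D$, $v\in V_l$, $\sigma\in G_K$, and the action of $D$ on $V_l\otimes\mathbb{C}_l$ is compatible with (R3). For a finite extension $L/K$, $G_{l,L}^{\mathrm{alg}}$ is the Zariski closure of $\rho_l(G_L)$ in $\mathrm{GIso}_{(V_l,\psi_l)}$. Put $W:=V\oplus\mathbb{Q}(1)$, $W_l:=V_l\oplus\mathbb{Q}_l(1)$, $\widetilde\rho_l\colon G_K\to\mathrm{GL}(W_l)$, $\widetilde\rho_l(g)=(\rho_l(g),\chi_c(g))$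 ($\chi_c$ the $l$-adic cyclotomic character), and let $\widetilde{G_{l,L}^{\mathrm{alg}}}$ be the Zariski closure of $\widetilde\rho_l(G_L)$ in $\mathrm{GL}_{W_l}$. (T) For every finite extension $L/K$ there are a natural-in-$L$ reductive group scheme $\mathcal{G}_L^{\mathrm{alg}}\subset\mathrm{GIso}_{(V,\psi)}$ over $\mathbb{Q}$ and, for every $l$, a natural-in-$L$ monomorphism $\mathrm{t}_{l,L}\colon G_{l,L}^{\mathrm{alg}}\hookrightarrow(\mathcal{G}_L^{\mathrm{alg}})_{\mathbb{Q}_l}$ such that the embedding $G_{l,L}^{\mathrm{alg}}\subset\mathrm{GIso}_{(V_l,\psi_l)}$ is the composite of $\mathrm{t}_{l,L}$ and $(\mathcal{G}_L^{\mathrm{alg}})_{\mathbb{Q}_l}\subset\mathrm{GIso}_{(V_l,\psi_l)}$. ($\widetilde{\mathrm T}$) For every finite extension $L/K$ there is a natural-in-$L$ reductive group scheme $\widetilde{\mathcal{G}_L^{\mathrm{alg}}}\subset\mathcal{G}_L^{\mathrm{alg}}\times\mathbb{G}_m\subset\mathrm{GL}_W$ over $\mathbb{Q}$ such that the two projections give epimorphisms $\pi\colon\widetilde{\mathcal{G}_L^{\mathrm{alg}}}\to\mathcal{G}_L^{\mathrm{alg}}$ and $N\colon\widetilde{\mathcal{G}_L^{\mathrm{alg}}}\to\mathbb{G}_m$, and, for every $l$, a natural monomorphism $\widetilde{\mathrm t}_{l,L}\colon\widetilde{G_{l,L}^{\mathrm{alg}}}\hookrightarrow(\widetilde{\mathcal{G}_L^{\mathrm{alg}}})_{\mathbb{Q}_l}$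 such that the embedding $\widetilde{G_{l,L}^{\mathrm{alg}}}\subset\mathrm{GL}_{W_l}$ is the composite of $\widetilde{\mathrm t}_{l,L}$ and $(\widetilde{\mathcal{G}_L^{\mathrm{alg}}})_{\mathbb{Q}_l}\subset\mathrm{GL}_{W_l}$. *)

(* Defs.v *)
From HB Require Import structures.
From mathcomp Require Import all_boot all_order all_algebra all_field.
From mathcomp Require Import boolp classical_sets functions cardinality reals.
From mathcomp Require Import complex.
From mathcomp Require Import mpoly.
From mathcomp Require trigo.

Set Implicit Arguments.
Unset Strict Implicit.
Unset Printing Implicit Defensive.

Import Order.TTheory GRing.Theory Num.Theory.
Local Open Scope ring_scope.
Local Open Scope classical_set_scope.

(* Conventions.  A finite-dimensional space with a chosen basis is a space of
   column vectors 'cV_m; extension of scalars along f is map_mx f, and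
   endomorphisms act by left multiplication.  A bilinear form is given by its
   Gram matrix B : (v, w) |-> v^T B w.  The number field K is embedded in algC
   by iota, and algC serves as the algebraic closure of K and of Q. *)

Definition gram (F : pzRingType) m (B : 'M[F]_m) (v w : 'cV[F]_m) : F :=
  (v^T *m B *m w) 0 0.

(* U (x)_f F' as a subspace of 'cV[F']_m. *)
Definition base_space (F F' : fieldType) (f : F -> F') m
    (U : {vspace 'cV[F]_m}) : {vspace 'cV[F']_m} :=
  <<[seq map_mx f v | v <- vbasis U]>>%VS.

Definition mx_img (F : fieldType) m (A : 'M[F]_m)
    (U : {vspace 'cV[F]_m}) : {vspace 'cV[F]_m} :=
  (linfun (mulmx A) @: U)%VS.

Definition mx_stable (F : fieldType) m (A : 'M[F]_m)
    (U : {vspace 'cV[F]_m}) : Prop :=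
  forall x, x \in U -> A *m x \in U.

(* A closed subscheme of GL_N over k, given by equations in the matrix
   entries; the inverse of the determinant is not needed in the equations. *)
Definition closed_sub (k : fieldType) (N : nat) := set {mpoly k[N * N]}.

Section Schemes.
Variables (k : fieldType) (N : nat).

Definition mx_eval (A : comUnitRingType) (f : k -> A) (M : 'M[A]_N)
    (p : {mpoly k[N * N]}) : A := mmap f (fun i => mxvec M 0 i) p.

(* X(A), for the k-algebra structure f on A. *)
Definition pts (X : closed_sub k N) (A : comUnitRingType) (f : k -> A) :
    set 'M[A]_N :=
  [set M | M \in unitmx /\ forall p, X p -> mx_eval f M p = 0].

Definition subscheme (X Y : closed_sub k N) : Prop :=
  forall (A : comUnitRingType) (f : {rmorphism k -> A}), pts X f `<=` pts Y f.

Definition is_group_scheme (X : closed_sub k N) : Prop :=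
  forall (A : comUnitRingType) (f : {rmorphism k -> A}),
    [/\ pts X f 1%:M,
        forall M M', pts X f M -> pts X f M' -> pts X f (M *m M') &
        forall M, pts X f M -> pts X f (invmx M)].

Definition zariski_closure (S : set 'M[k]_N) : closed_sub k N :=
  [set p | forall M, S M -> mx_eval idfun M p = 0].

Definition zariski_closed (Z : set 'M[k]_N) : Prop :=
  exists S : set {mpoly k[N * N]},
    Z = [set M | forall p, S p -> mx_eval idfun M p = 0].

Definition zariski_connected (B : set 'M[k]_N) : Prop :=
  forall Z1 Z2, zariski_closed Z1 -> zariski_closed Z2 ->
    B `<=` Z1 `|` Z2 -> B `&` (Z1 `&` Z2) = set0 ->
    B `<=` Z1 \/ B `<=` Z2.

(* The Zariski-connected component of the identity. *)
Definition id_component (B : set 'M[k]_N) : set 'M[k]_N :=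
  [set M | exists T, [/\ T `<=` B, zariski_connected T, T 1%:M & T M]].

End Schemes.

Definition base_scheme (k k' : fieldType) (f : {rmorphism k -> k'}) N
    (X : closed_sub k N) : closed_sub k' N :=
  [set map_mpoly f p | p in X].

Definition qpts N (X : closed_sub rat N) : set 'M[algC]_N :=
  pts X (ratr : rat -> algC).

(* Reductive, not necessarily connected: the unipotent radical over the
   algebraic closure is trivial.  Smoothness is automatic in characteristic 0,
   and closed subgroups over algC may be tested on algC-points. *)
Definition reductive N (X : closed_sub rat N) : Prop :=
  is_group_scheme X /\
  forall U : closed_sub algC N,
    let Up := pts U (idfun : algC -> algC) in
    is_group_scheme U -> Up `<=` qpts X -> zariski_connected Up ->
    (forall g u, qpts X g -> Up u -> Up (g *m u *m invmx g)) ->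
    (forall u, Up u -> exists e : nat, (u - 1%:M) ^+ e = 0) ->
    Up = [set 1%:M].

(* The finite etale Q-group scheme pi_0(X) is given by its group of points over
   the algebraic closure, i.e. the group of connected components of X over
   algC, with its Galois action.  A component is a coset of the identity
   component; products are products of cosets. *)
Definition mulset (F : pzRingType) N (B C : set 'M[F]_N) : set 'M[F]_N :=
  [set z | exists x y, [/\ B x, C y & z = x *m y]].

Definition pi0 N (X : closed_sub rat N) : set (set 'M[algC]_N) :=
  [set C | exists2 x, qpts X x & C = mulset [set x] (id_component (qpts X))].

Definition pi0_gal N (tau : {rmorphism algC -> algC}) (C : set 'M[algC]_N) :
    set 'M[algC]_N := [set map_mx tau x | x in C].

(* For X <= Y, the component of X containing x goes to that of Y. *)
Definition pi0_incl N (Y : closed_sub rat N) (C : set 'M[algC]_N) :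
    set 'M[algC]_N := mulset C (id_component (qpts Y)).

Definition pi0_incl_is_iso N (X Y : closed_sub rat N) : Prop :=
  [/\ set_bij (pi0 X) (pi0 Y) (pi0_incl Y),
      forall C C', pi0 X C -> pi0 X C' ->
        pi0_incl Y (mulset C C') = mulset (pi0_incl Y C) (pi0_incl Y C') &
      forall (tau : {rmorphism algC -> algC}) C, bijective tau -> pi0 X C ->
        pi0_incl Y (pi0_gal tau C) = pi0_gal tau (pi0_incl Y C)].

Definition GIso (k : fieldType) m (psi : 'M[k]_m) (A : comUnitRingType)
    (f : k -> A) : set 'M[A]_m :=
  [set g | g \in unitmx /\ exists2 c : A, c \is a GRing.unit &
     forall v w, gram (map_mx f psi) (g *m v) (g *m w) =
                 c * gram (map_mx f psi) v w].

Definition sub_GIso (k : fieldType) m (psi : 'M[k]_m) (X : closed_sub k m) :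
    Prop :=
  forall (A : comUnitRingType) (f : {rmorphism k -> A}),
    pts X f `<=` GIso psi f.

Definition on_W (A : pzRingType) m (g : 'M[A]_m) (c : A) : 'M[A]_(m + 1) :=
  block_mx g 0 0 c%:M.

Definition pr_V (A : pzRingType) m (M : 'M[A]_(m + 1)) : 'M[A]_m := ulsubmx M.
Definition pr_Gm (A : pzRingType) m (M : 'M[A]_(m + 1)) : A :=
  drsubmx M ord0 ord0.

(* Xt <= X x G_m *)
Definition sub_times_Gm (k : fieldType) m (X : closed_sub k m)
    (Xt : closed_sub k (m + 1)) : Prop :=
  forall (A : comUnitRingType) (f : {rmorphism k -> A}) M, pts Xt f M ->
    [/\ pts X f (pr_V M), pr_Gm M \is a GRing.unit &
        M = on_W (pr_V M) (pr_Gm M)].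

(* Epimorphisms of algebraic groups (quotient maps) over Q are the morphisms
   that are surjective on points over the algebraic closure. *)
Definition projections_epi m (X : closed_sub rat m)
    (Xt : closed_sub rat (m + 1)) : Prop :=
  [/\ forall g, qpts X g -> exists2 M, qpts Xt M & pr_V M = g &
      forall c : algC, c != 0 -> exists2 M, qpts Xt M & pr_Gm M = c].

(* ker (N : Xt -> G_m), cut out by the equation pr_Gm M = 1. *)
Definition ker_N (k : fieldType) m (Xt : closed_sub k (m + 1)) :
    closed_sub k (m + 1) :=
  Xt `|` [set 'X_(mxvec_index (rshift m ord0) (rshift m ord0)) - 1].

(* A polarized rational Hodge structure of weight n on Q^m; H p is V^{p,n-p},
   and only 0 <= p <= n occur since the graded pieces of the de Rham filtration
   are assumed to live in that range.  Q(-n) is identified with Q by its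
   generator (2 pi i)^-n. *)
Definition weil_operator (R : realType) m n
    (H : 'I_n.+1 -> {vspace 'cV[R[i]]_m}) (W : 'M[R[i]]_m) : Prop :=
  forall (p : 'I_n.+1) x, x \in H p ->
    W *m x = ('i : R[i]) ^ (p%:Z - (n - p)%N%:Z) *: x.

Definition polarized_hodge (R : realType) m n (psi : 'M[rat]_m)
    (H : 'I_n.+1 -> {vspace 'cV[R[i]]_m}) : Prop :=
  let psiC : 'M[R[i]]_m := map_mx ratr psi in
  [/\ (\sum_(p < n.+1) H p)%VS = fullv /\ directv (\sum_(p < n.+1) H p),
      forall p x, x \in H p -> map_mx (fun z => z^*%R) x \in H (rev_ord p),
      forall p q x y, x \in H p -> y \in H q -> (p + q != n)%N ->
        gram psiC x y = 0 &
      forall W, weil_operator H W -> forall x y : 'cV[R]_m,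
        let xC := map_mx (fun r : R => r%:C)%C x in
        let yC := map_mx (fun r : R => r%:C)%C y in
        gram psiC xC (W *m yC) = gram psiC yC (W *m xC) /\
        (x != 0 -> 0 < gram psiC xC (W *m xC))].

Definition is_subring_mx (F : pzRingType) m (D : set 'M[F]_m) : Prop :=
  [/\ D 1%:M, forall a b, D a -> D b -> D (a - b) &
      forall a b, D a -> D b -> D (a *m b)].

(* In the comparison of Q(-n) (x) C with K(-n) (x) C the generator (2 pi i)^-n
   of the former goes to (2 pi i)^-n times that of the latter. *)
Definition de_rham_comparison (R : realType) (K : fieldExtType rat) m n
    (psi : 'M[rat]_m) (H : 'I_n.+1 -> {vspace 'cV[R[i]]_m})
    (psiDR : 'M[K]_m) (F : nat -> {vspace 'cV[K]_m})
    (comp : {rmorphism K -> R[i]} -> 'M[R[i]]_m) : Prop :=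
  [/\ psiDR \in unitmx,
      forall i, (F i.+1 <= F i)%VS &
      forall sigma : {rmorphism K -> R[i]},
        [/\ comp sigma \in unitmx,
            forall v w, gram (map_mx sigma psiDR) (comp sigma *m v)
                                                  (comp sigma *m w) =
              (2 * ((trigo.pi : R)%:C)%C * 'i) ^- n *
                gram (map_mx ratr psi) v w &
            forall i, mx_img (comp sigma) (\sum_(p < n.+1 | (i <= p)%N) H p)%VS
                      = base_space sigma (F i)]].

Section Galois.
Variables (K : fieldExtType rat) (iota : {rmorphism K -> algC}).

Definition is_finite_ext (L : set algC) : Prop :=
  [/\ forall a, L (iota a),
      forall x y, L x -> L y -> L (x - y),
      forall x y, L x -> L y -> L (x * y),
      forall x, L x -> L x^-1 &
      exists s : seq algC, forall x, L x ->
        exists c : 'I_(size s) -> K, x = \sum_j iota (c j) * s`_j].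

Definition base_ext : set algC := range iota.

(* The absolute Galois group; its topology is that of pointwise convergence. *)
Definition GK : set (algC -> algC) :=
  [set g | [/\ zmod_morphism g, monoid_morphism g, bijective g &
               forall a, g (iota a) = iota a]].

Definition Gal (L : set algC) : set (algC -> algC) :=
  GK `&` [set g | forall x, L x -> g x = x].

Definition OK : set K := [set a | iota a \in Aint].
Definition Zbar : set algC := [set x | x \in Aint].

Definition nonzero_prime_ideal (F : fieldType) (O P : set F) : Prop :=
  [/\ P `<=` O /\ (exists2 x, P x & x != 0),
      forall x y, P x -> P y -> P (x + y),
      forall a x, O a -> P x -> P (a * x),
      ~ P 1 &
      forall x y, O x -> O y -> P (x * y) -> P x \/ P y].

Definition is_prime_of_K (v : set K) : Prop := nonzero_prime_ideal OK v.

Definition lies_over (vbar : set algC) (v : set K) : Prop :=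
  nonzero_prime_ideal Zbar vbar /\ v = [set a | vbar (iota a)].

(* #|O_K / v| = q *)
Definition residue_card (v : set K) (q : nat) : Prop :=
  exists s : seq K,
    [/\ uniq s, size s = q, forall a, a \in s -> OK a &
        forall x, OK x -> exists! a, a \in s /\ v (x - a)].

Definition decomposition (vbar : set algC) : set (algC -> algC) :=
  GK `&` [set g | forall x, vbar (g x) <-> vbar x].

Definition inertia (vbar : set algC) : set (algC -> algC) :=
  decomposition vbar `&` [set g | forall x, Zbar x -> vbar (g x - x)].

Definition frobenius (v : set K) (q : nat) : set (algC -> algC) :=
  [set g | exists vbar, [/\ lies_over vbar v, residue_card v q,
     decomposition vbar g & forall x, Zbar x -> vbar (g x - x ^+ q)]].

Definition unramified (F : fieldType) m (rho : (algC -> algC) -> 'M[F]_m)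
    (v : set K) : Prop :=
  forall vbar g, lies_over vbar v -> inertia vbar g -> rho g = 1%:M.

End Galois.

Definition primeN := {l : nat | prime l}.

Definition nonarch_abs (R : realType) (F : fieldType) (a : F -> R) : Prop :=
  [/\ forall x, 0 <= a x, forall x, (a x == 0) = (x == 0),
      forall x y, a (x * y) = a x * a y &
      forall x y, a (x + y) <= Num.max (a x) (a y)].

Definition abs_complete (R : realType) (F : fieldType) (a : F -> R) : Prop :=
  forall u : nat -> F,
    (forall e, 0 < e -> exists M : nat, forall i j,
       (M <= i)%N -> (M <= j)%N -> a (u i - u j) < e) ->
    exists x, forall e, 0 < e -> exists M : nat, forall i,
       (M <= i)%N -> a (u i - x) < e.

(* Q_l, characterized (up to unique isomorphism) as the completion of Q for the
   l-adic absolute value. *)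
Record padic_field (R : realType) (l : primeN) := PadicField {
  Ql_sort :> fieldType;
  Ql_abs : Ql_sort -> R;
  Ql_Q : {rmorphism rat -> Ql_sort};
  Ql_nonarch : nonarch_abs Ql_abs;
  Ql_abs_l : Ql_abs (val l)%:R = (val l)%:R^-1;
  Ql_dense : forall x e, 0 < e -> exists q, Ql_abs (x - Ql_Q q) < e;
  Ql_complete : abs_complete Ql_abs }.

Record prime_over (K : fieldExtType rat) (iota : {rmorphism K -> algC})
    (l : primeN) := PrimeOver {
  po_prime : set K;
  po_is_prime : is_prime_of_K iota po_prime;
  po_over : po_prime (val l)%:R }.

(* C_l, the completion of algC for an absolute value above lambda. *)
Record Cl_field (R : realType) (K : fieldExtType rat)
    (iota : {rmorphism K -> algC}) (l : primeN) (Ql : padic_field R l)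
    (lambda : prime_over iota l) := ClField {
  Cl_sort :> fieldType;
  Cl_abs : Cl_sort -> R;
  Cl_Kbar : {rmorphism algC -> Cl_sort};
  Cl_Ql : {rmorphism Ql -> Cl_sort};
  Cl_nonarch : nonarch_abs Cl_abs;
  Cl_abs_Ql : forall x, Cl_abs (Cl_Ql x) = Ql_abs x;
  Cl_lambda : forall a,
    po_prime lambda a <-> OK iota a /\ Cl_abs (Cl_Kbar (iota a)) < 1;
  Cl_dense : forall x e, 0 < e -> exists y, Cl_abs (x - Cl_Kbar y) < e;
  Cl_complete : abs_complete Cl_abs }.

Section Representations.
Variables (R : realType) (K : fieldExtType rat) (iota : {rmorphism K -> algC}).

Definition is_cyclotomic (l : primeN) (Ql : padic_field R l)
    (chi : (algC -> algC) -> Ql) : Prop :=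
  forall g, GK iota g -> Ql_abs (chi g) <= 1 /\
    forall (k a : nat) (zeta : algC),
      Ql_abs (chi g - a%:R) <= (val l)%:R ^- k ->
      zeta ^+ (val l ^ k)%N = 1 -> g zeta = zeta ^+ a.

Definition continuous_rep (l : primeN) (Ql : padic_field R l) m
    (rho : (algC -> algC) -> 'M[Ql]_m) : Prop :=
  [/\ rho idfun = 1%:M,
      forall g h, GK iota g -> GK iota h -> rho (g \o h) = rho g *m rho h &
      forall h e, GK iota h -> 0 < e -> exists s : seq algC,
        forall g, GK iota g -> {in s, g =1 h} ->
          forall i j, Ql_abs (rho g i j - rho h i j) < e].

(* The discrete G_K-module D, with G_K acting by ring automorphisms. *)
Definition discrete_action m (D : set 'M[rat]_m)
    (rhoe : (algC -> algC) -> 'M[rat]_m -> 'M[rat]_m) : Prop :=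
  [/\ forall g b, GK iota g -> D b -> D (rhoe g b),
      forall b, D b -> rhoe idfun b = b,
      forall g h b, GK iota g -> GK iota h -> D b ->
        rhoe (g \o h) b = rhoe g (rhoe h b),
      forall g, GK iota g -> rhoe g 1%:M = 1%:M /\
        forall b c, D b -> D c ->
          rhoe g (b + c) = rhoe g b + rhoe g c /\
          rhoe g (b *m c) = rhoe g b *m rhoe g c &
      forall b, D b -> exists s : seq algC, forall g, GK iota g ->
        {in s, forall x, g x = x} -> rhoe g b = b].

(* The embedding delta of D in End (V_DR (x) Kbar) is compatible with the comparison at
   sigma through an extension of sigma to algC. *)
Definition de_rham_action m n (H : 'I_n.+1 -> {vspace 'cV[R[i]]_m})
    (comp : {rmorphism K -> R[i]} -> 'M[R[i]]_m) (D : set 'M[rat]_m)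
    (delta : 'M[rat]_m -> 'M[algC]_m) : Prop :=
  [/\ delta 1%:M = 1%:M,
      forall b c, D b -> D c -> delta (b + c) = delta b + delta c /\
                                delta (b *m c) = delta b *m delta c,
      forall b c, D b -> D c -> delta b = delta c -> b = c &
      forall sigma : {rmorphism K -> R[i]},
      exists2 sbar : {rmorphism algC -> R[i]}, sbar \o iota =1 sigma &
        forall b, D b ->
          comp sigma *m map_mx ratr b = map_mx sbar (delta b) *m comp sigma /\
          forall p, mx_stable (map_mx sbar (delta b))
                              (mx_img (comp sigma) (H p))].

(* Serre's notion; arithmetic Frobenius elements are used. *)
Definition strictly_compatible m (Ql : forall l, padic_field R l)
    (rho : forall l, (algC -> algC) -> 'M[Ql l]_m) : Prop :=
  exists2 S : set (set K), finite_set S &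
  exists P : set K -> {poly rat}, forall l v,
    is_prime_of_K iota v -> ~ S v -> ~ v (val l)%:R ->
    unramified iota (rho l) v /\
    forall q g, frobenius iota v q g ->
      char_poly (rho l g) = map_poly (Ql_Q (Ql l)) (P v).

(* The complex absolute values are those of the images of the
   eigenvalues, which are algebraic numbers, under all embeddings into the
   complex numbers. *)
Definition frobenius_weights m (n : nat) (Ql : forall l, padic_field R l)
    (rho : forall l, (algC -> algC) -> 'M[Ql l]_m) : Prop :=
  forall l : primeN, exists2 S : set (set K), finite_set S &
    (forall v, is_prime_of_K iota v -> v (val l)%:R -> S v) /\
    forall v q g, is_prime_of_K iota v -> ~ S v -> frobenius iota v q g ->
      exists2 p : {poly rat},
        char_poly (rho l g) = map_poly (Ql_Q (Ql l)) p &
        forall z : R[i], root (map_poly ratr p) z ->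
          `|z| = (sqrtC (q%:R : R[i])) ^- n.

Section Local.
Variables (l : primeN) (Ql : padic_field R l) (lambda : prime_over iota l).
Variable (C : Cl_field Ql lambda).

(* Elements of the decomposition group, with their continuous extension to
   C_l. *)
Definition local_galois (g : algC -> algC) (gC : {rmorphism C -> C}) : Prop :=
  [/\ GK iota g, forall x, Cl_abs (gC x) = Cl_abs x &
      forall x, gC (Cl_Kbar C x) = Cl_Kbar C (g x)].

Variables (m : nat) (chi : (algC -> algC) -> Ql)
  (rho : (algC -> algC) -> 'M[Ql]_m).

(* The semilinear action on V_l (x) C_l. *)
Definition local_act (g : algC -> algC) (gC : C -> C) (x : 'cV[C]_m) :
    'cV[C]_m := map_mx (Cl_Ql C) (rho g) *m map_mx gC x.

Definition hodge_tate_type : Prop :=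
  exists2 P : 'M[C]_m, P \in unitmx & exists w : 'I_m -> int,
    forall g gC, local_galois g gC -> forall j,
      local_act g gC (col j P) = Cl_Ql C (chi g) ^ (w j) *: col j P.

Definition fil_Cl (F : nat -> {vspace 'cV[K]_m}) (i : nat) :
    {vspace 'cV[C]_m} := base_space (Cl_Kbar C \o iota) (F i).

(* V_l (x) C_l = \bigoplus_(0 <= i <= n) G^i (x) C_l(i - n), where a map out of
   G^i = F^i / F^(i+1) is a map phi i on F^i with kernel F^(i+1). *)
Definition hodge_tate_decomp (n : nat) (F : nat -> {vspace 'cV[K]_m})
    (phi : 'I_n.+1 -> 'M[C]_m) : Prop :=
  [/\ forall (i : 'I_n.+1) x, x \in fil_Cl F i ->
        (phi i *m x == 0) = (x \in fil_Cl F i.+1),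
      (\sum_(i < n.+1) mx_img (phi i) (fil_Cl F i))%VS = fullv,
      directv (\sum_(i < n.+1) mx_img (phi i) (fil_Cl F i)) &
      forall g gC, local_galois g gC ->
        forall (i : 'I_n.+1) x, x \in fil_Cl F i ->
        local_act g gC (phi i *m x) =
        Cl_Ql C (chi g) ^ (i%:Z - n%:Z) *: (phi i *m map_mx gC x)].

Definition decomp_compat (n : nat) (F : nat -> {vspace 'cV[K]_m})
    (D : set 'M[rat]_m) (delta : 'M[rat]_m -> 'M[algC]_m)
    (phi : 'I_n.+1 -> 'M[C]_m) : Prop :=
  forall b, D b ->
  forall (i : 'I_n.+1) x, x \in fil_Cl F i ->
    map_mx (Cl_Ql C \o Ql_Q Ql) b *m (phi i *m x) =
    phi i *m (map_mx (Cl_Kbar C) (delta b) *m x).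

End Local.

Definition Gl_alg (l : primeN) (Ql : padic_field R l) m
    (rho : (algC -> algC) -> 'M[Ql]_m) (L : set algC) : closed_sub Ql m :=
  zariski_closure [set rho g | g in Gal iota L].

Definition rho_tilde (l : primeN) (Ql : padic_field R l) m
    (rho : (algC -> algC) -> 'M[Ql]_m) (chi : (algC -> algC) -> Ql)
    (g : algC -> algC) : 'M[Ql]_(m + 1) := on_W (rho g) (chi g).

(* A monomorphism whose composite with a closed immersion is a given closed
   immersion amounts to an inclusion of subschemes; naturality in L is with
   respect to the inclusions for L <= L'. *)
Definition hyp_T m (psi : 'M[rat]_m) (Ql : forall l, padic_field R l)
    (rho : forall l, (algC -> algC) -> 'M[Ql l]_m)
    (G : set algC -> closed_sub rat m) : Prop :=
  (forall L, is_finite_ext iota L ->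
     [/\ reductive (G L), sub_GIso psi (G L) &
         forall l, subscheme (Gl_alg (rho l) L)
                             (base_scheme (Ql_Q (Ql l)) (G L))]) /\
  (forall L L', is_finite_ext iota L -> is_finite_ext iota L' -> L `<=` L' ->
     subscheme (G L') (G L)).

Definition hyp_Tt m (Ql : forall l, padic_field R l)
    (rho : forall l, (algC -> algC) -> 'M[Ql l]_m)
    (chi : forall l, (algC -> algC) -> Ql l)
    (G : set algC -> closed_sub rat m)
    (Gt : set algC -> closed_sub rat (m + 1)) : Prop :=
  (forall L, is_finite_ext iota L ->
     [/\ reductive (Gt L), sub_times_Gm (G L) (Gt L),
         projections_epi (G L) (Gt L) &
         forall l, subscheme (Gl_alg (rho_tilde (rho l) (chi l)) L)
                             (base_scheme (Ql_Q (Ql l)) (Gt L))]) /\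
  (forall L L', is_finite_ext iota L -> is_finite_ext iota L' -> L `<=` L' ->
     subscheme (Gt L') (Gt L)).

End Representations.

(* Main.v *)
Require Import Defs.
From HB Require Import structures.
From mathcomp Require Import all_boot all_order all_algebra all_field.
From mathcomp Require Import boolp classical_sets functions cardinality reals.
From mathcomp Require Import complex.
From mathcomp Require Import mpoly.
From mathcomp Require Import ring.

(* With k = algC, let Gt be the group in the statement, N : Gt -> G_m, A its
   identity component and C the identity component of A /\ ker N.  Since N is
   already onto on A, only the equality C = A /\ ker N matters.  If it fails,
   A / C is a connected commutative group, finite over A / (A /\ ker N) = G_m;
   concretely, determinants built from the translates of an equation of C span
   a finite-dimensional space of functions on which A acts through commuting
   matrices, and two of its eigencharacters have a ratio f that is trivial on C
   but not on A /\ ker N.  Characters of A that are constant on the fibres of N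
   are multiplicatively dependent on N, so f^u = N^v on A for some u, v with a
   prime p dividing u and not v.  As Gt is covered by finitely many cosets x A
   with N x = 1, the relation N(y)^v = F(y)^u holds on all of Gt, piecewise, for
   polynomial F up to powers of det, with coefficients in some number field
   Q(alpha) containing the p-th roots of unity.  It specializes to the
   Q_l-points for each of the infinitely many primes l at which the minimal
   polynomial of alpha has a root in Q_l.  Since (rho_l, chi_l) maps Gal(Kbar/K)
   to Gt(Q_l), every value of chi_l is then a p-th power in Q_l although
   l = 1 mod p, so that the Galois group of K(mu_l) over K consists of p-th power
   residues mod l.  Having this for more primes l than there are embeddings of K
   into Kbar is impossible, by irreducibility of the cyclotomic polynomials. *)

Set Implicit Arguments.
Unset Strict Implicit.
Unset Printing Implicit Defensive.

Import Order.TTheory GRing.Theory Num.Theory.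
Local Open Scope ring_scope.
Local Open Scope classical_set_scope.

(** * Noetherian rings *)

(** Group theory alone cannot suffice: scalar matrices t paired with t^p form a connected group
    whose kernel under the second projection is mu_p. Such a covering is excluded only because [Gt]
    contains Galois points over Q_l for every l. One l is not enough either, since K may contain a
    subfield of Q(mu_l); hence the pigeonhole over embeddings of K.

    The primes l are taken split because the character f lives only over a number field, and p-th
    roots of unity are adjoined to that field so that p-th powers form a proper subgroup modulo l.

    The quotient A / C is never constructed; its characters are obtained as functions on A. Both
    passages between fields of points, from a pair of values (N, f) to a point of A and from a
    Q_l-point of [Gt] to a point over algC, come from one theorem on extending places, which yields
    a point where a prescribed function does not vanish. *)

Definition is_ideal (R : comNzRingType) (I : set R) : Prop :=
  [/\ I 0, forall x y, I x -> I y -> I (x + y) & forall a x, I x -> I (a * x)].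

Definition noetherian (R : comNzRingType) : Prop :=
  forall I : nat -> set R, (forall n, is_ideal (I n)) ->
    (forall n, I n `<=` I n.+1) ->
    exists m, forall n, (m <= n)%N -> I n `<=` I m.

Lemma ideal_opp (R : comNzRingType) (I : set R) x : is_ideal I -> I x -> I (- x).
Proof. by case=> _ _ IM Ix; rewrite -mulN1r; apply: IM. Qed.

Lemma chain_le (T : Type) (I : nat -> set T) :
  (forall n, I n `<=` I n.+1) -> forall m n, (m <= n)%N -> I m `<=` I n.
Proof.
move=> Ichain m n /subnK <-; elim: (n - m)%N => [//|d IHd] x /IHd.
exact: Ichain.
Qed.

Lemma field_noetherian (F : fieldType) : noetherian F.
Proof.
move=> I Iid Ichain.
have [[m [x [Imx x0]]]|noI] := pselect (exists m x, I m x /\ x != 0).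
  exists m => n _ y _; have [_ _ IM] := Iid m.
  by rewrite -(mulfVK x0 y); apply: IM.
exists 0%N => n _ x Inx; have [->|x0] := eqVneq x 0; first by case: (Iid 0%N).
by case: noI; exists n, x.
Qed.

Lemma noetherian_surj (R S : comNzRingType) (f : {rmorphism R -> S}) :
  (forall y, exists x, f x = y) -> noetherian R -> noetherian S.
Proof.
move=> fsurj noethR I Iid Ichain.
have [||m Hm] := noethR (fun n => f @^-1` (I n)).
- move=> n; have [I0 ID IM] := Iid n; split=> [|x y|a x]; rewrite /preimage /=.
  + by rewrite rmorph0.
  + by rewrite rmorphD; apply: ID.
  + by rewrite rmorphM; apply: IM.
- by move=> n x; apply: Ichain.
by exists m => n mn y; have [x <-] := fsurj y; apply: Hm.
Qed.

(** * Hilbert's basis theorem *)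

Section HilbertBasis.
Variable R : comNzRingType.

Let top_coefs (I : set {poly R}) n : set R :=
  [set a | exists p, [/\ I p, (size p <= n.+1)%N & p`_n = a]].

Let top_coefs_ideal I n : is_ideal I -> is_ideal (top_coefs I n).
Proof.
case=> I0 ID IM; split=> [|x y [p [Ip sp <-]] [q [Iq sq <-]]|a x [p [Ip sp <-]]].
- by exists 0; rewrite size_poly0 coef0.
- exists (p + q); rewrite coefD; split=> //; first exact: ID.
  by rewrite (leq_trans (size_polyD _ _)) // geq_max sp.
- exists (a%:P * p); rewrite coefCM; split=> //; first exact: IM.
  by rewrite mul_polyC (leq_trans (size_scale_leq _ _)).
Qed.

Let top_coefsS I n : is_ideal I -> top_coefs I n `<=` top_coefs I n.+1.
Proof.
case=> _ _ IM a [p [Ip sp <-]]; exists ('X * p); split; first exact: IM.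
- by rewrite (leq_trans (size_polyMleq _ _)) // size_polyX.
- by rewrite coefXM.
Qed.

(** Subtracting from an element of [J] an element of [I] with the same top coefficient lowers its
    size. *)
Let top_coefs_inj I J : is_ideal I -> is_ideal J -> I `<=` J ->
  (forall n, top_coefs J n `<=` top_coefs I n) -> J `<=` I.
Proof.
move=> Iid Jid IJ HL p; have [n] := ubnP (size p).
elim: n p => // n IHn p szp Jp.
have [->|p0] := eqVneq p 0; first by case: Iid.
have [|q [Iq sq qp]] := HL (size p).-1 p`_(size p).-1.
  by exists p; rewrite prednK ?size_poly_gt0.
rewrite -[p](subrK q); have [_ ID _] := Iid; apply: ID => //.
apply: IHn; last first.
  by have [_ JD _] := Jid; apply: JD => //; apply: ideal_opp => //; apply: IJ.
have sp0 : (0 < size p)%N by rewrite size_poly_gt0.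
rewrite -ltnS; apply: leq_trans szp; rewrite ltnS -[X in (_ < X)%N](prednK sp0) ltnS.
apply/leq_sizeP => j; rewrite leq_eqVlt => /predU1P[<-|ltj].
  by rewrite coefB qp subrr.
have szj : (size p <= j)%N by rewrite -(prednK sp0).
rewrite coefB !nth_default ?subrr //.
by rewrite (leq_trans sq) // prednK.
Qed.

(** The diagonal chain of top coefficients stabilizes at some [n0] and controls all degrees from
    [n0] on; each of the finitely many smaller degrees has its own stable index. *)
Lemma poly_noetherian : noetherian R -> noetherian {poly R}.
Proof.
move=> noethR I Iid Ichain.
have LI n m : is_ideal (top_coefs (I m) n) by apply: top_coefs_ideal.
have LM n m m' : (m <= m')%N -> top_coefs (I m) n `<=` top_coefs (I m') n.
  move=> mm' a [p [Ip sp <-]]; exists p; split=> //.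
  exact: (chain_le Ichain mm').
have LN n n' m : (n <= n')%N -> top_coefs (I m) n `<=` top_coefs (I m) n'.
  by move=> nn'; apply: chain_le nn' => i; apply: top_coefsS.
have [//||n0 Hn0] := noethR (fun n => top_coefs (I n) n).
  by move=> n a /(LN _ n.+1 _ (leqnSn n)); apply: LM.
have stab n : exists m, forall m', (m <= m')%N ->
    top_coefs (I m') n `<=` top_coefs (I m) n.
  have [//||m Hm] := noethR (fun m => top_coefs (I m) n); last by exists m.
  by move=> m; apply: LM.
have [ms Hms] := choice stab.
pose M := maxn n0 (\max_(i < n0) ms i); exists M => k Mk.
have chainMk : I M `<=` I k by apply: chain_le.
apply: top_coefs_inj => // n a La.
have [ltn|len] := ltnP n n0.
  have msM : (ms n <= M)%N.
    by rewrite leq_max (leq_bigmax (Ordinal ltn)) orbT.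
  by apply: (LM _ _ _ msM); apply: Hms La; apply: leq_trans Mk.
have n0M : (n0 <= M)%N by rewrite leq_maxl.
apply: (LM _ _ _ n0M); apply: (LN _ _ _ len).
apply: (Hn0 (maxn n k)); first by rewrite (leq_trans len) // leq_maxl.
by apply: (LM _ _ _ (leq_maxr n k)); apply: (LN _ _ _ (leq_maxl n k)).
Qed.

End HilbertBasis.

(** * Multivariate polynomials as polynomials in the last variable *)

Section MpolyLast.
Variable R : comNzRingType.

Local Notation widen := (widen_ord (leqnSn _)).

Definition mpoly_of_poly n (Q : {poly {mpoly R[n]}}) : {mpoly R[n.+1]} :=
  (map_poly (@mwiden n R) Q).['X_ord_max].

Lemma mpoly_of_poly_is_zmod n : zmod_morphism (@mpoly_of_poly n).
Proof. by move=> p q; rewrite /mpoly_of_poly rmorphB hornerD hornerN. Qed.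

Lemma mpoly_of_poly_is_monoid n : monoid_morphism (@mpoly_of_poly n).
Proof.
by split=> [|p q]; rewrite /mpoly_of_poly ?rmorph1 ?hornerC // rmorphM hornerM.
Qed.

HB.instance Definition _ n := GRing.isZmodMorphism.Build _ _ (@mpoly_of_poly n)
  (@mpoly_of_poly_is_zmod n).
HB.instance Definition _ n := GRing.isMonoidMorphism.Build _ _ (@mpoly_of_poly n)
  (@mpoly_of_poly_is_monoid n).

Lemma mpoly_of_polyX n : mpoly_of_poly 'X = 'X_ord_max :> {mpoly R[n.+1]}.
Proof. by rewrite /mpoly_of_poly map_polyX hornerX. Qed.

Lemma mpoly_of_polyC n (c : {mpoly R[n]}) : mpoly_of_poly c%:P = mwiden c.
Proof. by rewrite /mpoly_of_poly map_polyC hornerC. Qed.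

Lemma mpoly_rmorph_surj (S : comNzRingType) n (f : {rmorphism S -> {mpoly R[n]}}) :
  (forall c, exists s, f s = c%:MP) -> (forall i, exists s, f s = 'X_i) ->
  forall p, exists s, f s = p.
Proof.
move=> fC fX; have /choice[xs Hxs] := fX.
elim/mpolyind=> [|c m p _ _ [s <-]]; first by exists 0; rewrite rmorph0.
have [t Ht] := fC c.
exists (t * \prod_i xs i ^+ m i + s).
rewrite rmorphD rmorphM Ht mul_mpolyC mpolyXE_id rmorph_prod.
by congr (_ *: _ + _); apply: eq_bigr => i _; rewrite rmorphXn Hxs.
Qed.

Lemma mpoly_of_poly_surj n (p : {mpoly R[n.+1]}) : exists Q, mpoly_of_poly Q = p.
Proof.
apply: (mpoly_rmorph_surj (f := @mpoly_of_poly n)) => [c|i] /=.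
  exists (c%:MP)%:P.
  by rewrite mpoly_of_polyC mwidenC.
have [j ->|->] := unliftP ord_max i; last first.
  by exists 'X; rewrite mpoly_of_polyX.
exists ('X_j)%:P; rewrite mpoly_of_polyC mwidenX mnmwiden1.
by congr 'X_[U_(_)]; apply: val_inj => /=; rewrite /bump leqNgt ltn_ord.
Qed.

Lemma mmap_mpoly_of_poly (S : comNzRingType) (h : {rmorphism R -> S}) n
    (y : 'I_n.+1 -> S) (Q : {poly {mpoly R[n]}}) :
  mmap h y (mpoly_of_poly Q) =
  (map_poly (mmap h (y \o widen)) Q).[y ord_max].
Proof.
have mw q : mmap h y (mwiden q) = mmap h (y \o widen) q.
  elim/mpolyind: q => [|c m p _ _ IHp]; first by rewrite !rmorph0.
  rewrite mwidenD mwidenZ mwidenX !rmorphD /= IHp !mmapZ !mmapX /mmap1.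
  rewrite big_ord_recr /= mnmwiden_ordmax expr0 mulr1.
  by congr (_ * _ + _); apply: eq_bigr => i _; rewrite mnmwiden_widen.
elim/poly_ind: Q => [|Q c IHQ]; first by rewrite !rmorph0 horner0.
rewrite !rmorphD !rmorphM /= map_polyX map_polyC hornerMXaddC -IHQ.
by rewrite mpoly_of_polyX mpoly_of_polyC mmapX mmap1U mw.
Qed.

End MpolyLast.

(** * Extension of places *)

Lemma mpoly_noetherian (R : comNzRingType) n :
  noetherian R -> noetherian {mpoly R[n]}.
Proof.
move=> noethR; elim: n => [|n IHn].
  apply: (noetherian_surj (f := @mpolyC 0 R)) noethR => p.
  by exists (p@_0%MM); apply/esym/nvar0_mpolyC.
apply: (noetherian_surj (f := @mpoly_of_poly R n)); last exact: poly_noetherian.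
exact: mpoly_of_poly_surj.
Qed.

Definition is_prime_ideal (R : comNzRingType) (P : set R) : Prop :=
  [/\ is_ideal P, ~ P 1 & forall x y, P (x * y) -> P x \/ P y].

Section ExtendPlace.
Import Pdiv.Ring Pdiv.ComRing.
Variables (A : comNzRingType) (P : set {poly A}).
Hypothesis Pprime : is_prime_ideal P.

Let P0 : P 0. Proof. by case: Pprime => -[]. Qed.
Let PD x y : P x -> P y -> P (x + y).
Proof. by case: Pprime => -[_ + _] _ _; apply. Qed.
Let PM a x : P x -> P (a * x).
Proof. by case: Pprime => -[_ _ +] _ _; apply. Qed.
Let PN x : P x -> P (- x).
Proof. by case: Pprime => I _ _; apply: ideal_opp. Qed.
Let PB x y : P x -> P y -> P (x - y).
Proof. by move=> Px Py; apply: PD => //; apply: PN. Qed.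
Let Pint x y : ~ P x -> ~ P y -> ~ P (x * y).
Proof. by case: Pprime => _ _ H nx ny /H[]. Qed.
Let PZ a x : P x -> P (a *: x).
Proof. by rewrite -mul_polyC; apply: PM. Qed.

Let p (a : A) := P a%:P.
Let coefs_in (Q : {poly A}) := forall i, p Q`_i.

Let pD a b : p a -> p b -> p (a + b).
Proof. by rewrite /p polyCD; apply: PD. Qed.
Let pB a b : p a -> p b -> p (a - b).
Proof. by rewrite /p polyCB; apply: PB. Qed.
Let pM a b : p b -> p (a * b).
Proof. by rewrite /p polyCM; apply: PM. Qed.
Let pX a n : ~ p a -> ~ p (a ^+ n).
Proof.
move=> na; elim: n => [|n IHn]; first by rewrite /p expr0; case: Pprime.
by rewrite exprS /p polyCM; apply: Pint.
Qed.
Let psum (I : Type) (r : seq I) (F : I -> A) :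
  (forall i, p (F i)) -> p (\sum_(i <- r) F i).
Proof.
move=> pF; elim: r => [|i r IHr]; first by rewrite big_nil.
by rewrite big_cons; apply: pD.
Qed.

Let coefs_inP Q : coefs_in Q -> P Q.
Proof.
move=> QP; rewrite -[Q]coefK poly_def.
elim/big_ind: _ => // i _; rewrite -mul_polyC mulrC; apply: PM; exact: QP.
Qed.

(** A normal form modulo p[X], which lies in [P]: leading terms with coefficient in p are dropped
    until none is left. *)
Let strip (Q : {poly A}) : exists Q', [/\ coefs_in (Q - Q'),
  (size Q' <= size Q)%N & Q' = 0 \/ ~ p (lead_coef Q')].
Proof.
have [n] := ubnP (size Q); elim: n Q => // n IHn Q szQ.
have [lcp|] := pselect (p (lead_coef Q)); last first.
  by exists Q; rewrite subrr; split; [move=> i; rewrite coef0| |right].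
have [->|Q0] := eqVneq Q 0.
  by exists 0; rewrite subrr; split; [move=> i; rewrite coef0| |left].
pose Q1 := Q - lead_coef Q *: 'X^((size Q).-1).
have sQ0 : (0 < size Q)%N by rewrite size_poly_gt0.
have szQ1 : (size Q1 < size Q)%N.
  rewrite -[X in (_ < X)%N](prednK sQ0) ltnS; apply/leq_sizeP => j.
  rewrite coefB coefZ coefXn leq_eqVlt => /predU1P[<-|ltj].
    by rewrite eqxx mulr1 subrr.
  by rewrite (gtn_eqF ltj) mulr0 subr0 nth_default // -(prednK sQ0).
have [|Q' [QQ' szQ' leadQ']] := IHn Q1; first exact: leq_trans szQ1 szQ.
exists Q'; split=> //; last by rewrite (leq_trans szQ') // ltnW.
move=> i; have := QQ' i; rewrite /Q1 !coefB coefZ coefXn => pi.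
rewrite -[Q`_i](subrK (lead_coef Q * (i == (size Q).-1)%:R)) addrAC.
by apply: pD => //; rewrite mulrC; apply: pM.
Qed.

Let min_size (S : set {poly A}) : S !=set0 ->
  exists2 f, S f & forall g, S g -> (size f <= size g)%N.
Proof.
move=> [f0 Sf0].
have /ex_minnP[n /asboolP[f [Sf <-]] Hmin] :
    exists n, `[< exists f, S f /\ size f = n >].
  by exists (size f0); apply/asboolP; exists f0.
by exists f => // g Sg; apply: Hmin; apply/asboolP; exists g.
Qed.

(* Atiyah-Macdonald, Proposition 5.23, for one generator. *)
Lemma extend_place_poly (V : {poly A}) : ~ P V -> exists2 u, ~ P u%:P &
  forall (k : closedFieldType) (h : {rmorphism A -> k}),
    (forall a, P a%:P -> h a = 0) -> h u != 0 ->
  exists y, (forall Q, P Q -> (map_poly h Q).[y] = 0) /\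
            (map_poly h V).[y] != 0.
Proof.
move=> nPV.
have map0 (k : closedFieldType) (h : {rmorphism A -> k}) :
    (forall a, P a%:P -> h a = 0) -> forall Q, coefs_in Q -> map_poly h Q = 0.
  by move=> hp Q Qin; apply/polyP => i; rewrite coef_map coef0; apply: hp; apply: Qin.
(* Transcendental case: [P] is p[X], so any point where the image of [V] does not vanish will do,
   and the leading coefficient of [V] modulo p guarantees that this image is nonzero. *)
have [Ptriv|] := pselect (forall Q, P Q -> coefs_in Q).
  have [V' [VV' _ leadV']] := strip V.
  have nplead : ~ p (lead_coef V').
    case: leadV' => // V'0; case: nPV; apply: coefs_inP.
    by rewrite -[V]subr0 -V'0.
  exists (lead_coef V') => // k h hp hu.
  have mapV : map_poly h V = map_poly h V'.
    by apply/eqP; rewrite -subr_eq0 -rmorphB /=; apply/eqP/map0.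
  have V0 : map_poly h V' != 0.
    by rewrite -lead_coef_eq0 lead_coef_map_eq.
  have /closed_nonrootP[y ny] := V0.
  exists y; rewrite mapV; split=> // Q /Ptriv Qin.
  by rewrite map0 // horner0.
move=> /existsNP[Q0 /not_implyP[PQ0 nQ0]].
(* Algebraic case: [f] plays the role of a minimal polynomial of the generator over A/p. *)
have [|f [Pf leadf] fmin] := @min_size [set Q | P Q /\ ~ p (lead_coef Q)].
  have [Q' [QQ' _ leadQ']] := strip Q0.
  exists Q'; split.
    by rewrite -[Q'](subKr Q0); apply: PB => //; apply: coefs_inP.
  case: leadQ' => // Q'0; case: nQ0; move: QQ'; by rewrite Q'0 subr0.
have lowP r : P r -> (size r < size f)%N -> coefs_in r.
  move=> Pr szr; have [r' [rr' szr' [r'0|leadr']]] := strip r.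
    by move: rr'; rewrite r'0 subr0.
  have /fmin : P r' /\ ~ p (lead_coef r').
    by split=> //; rewrite -[r'](subKr r); apply: PB => //; apply: coefs_inP.
  by rewrite leqNgt (leq_ltn_trans szr').
have f0 : f != 0.
  by apply: contra_notN leadf => /eqP->; rewrite /p lead_coef0.
pose J := [set G | exists T, P (G - T * V)].
have JP G H : J G -> P (G - H) -> J H.
  move=> [T GT] GH; exists T; have -> : H - T * V = (G - T * V) - (G - H) by ring.
  exact: PB.
have JM a G : J G -> J (a * G).
  by move=> [T GT]; exists (a * T); rewrite -mulrA -mulrBr; apply: PM.
pose S := [set G | [/\ J G, ~ P G & ~ p (lead_coef G)]].
have Sstrip r : J r -> ~ P r -> exists2 r', S r' & (size r' <= size r)%N.
  move=> Jr nPr; have [r' [rr' szr' leadr']] := strip r.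
  have Prr' := coefs_inP rr'.
  exists r' => //; split; first exact: JP Jr Prr'.
    by move=> Pr'; apply: nPr; rewrite -[r](subrK r'); apply: PD.
  case: leadr' => // r'0; case: nPr; move: Prr'; by rewrite r'0 subr0.
have [|g [Jg nPg leadg] gmin] := @min_size S.
  have [|//|r' Sr' _] := Sstrip V; last by exists r'.
  by exists 1; rewrite mul1r subrr.
have g0 : g != 0 by apply: contra_notN nPg => /eqP->.
have szgf : (size g < size f)%N.
  have rE := rdivp_eq f g; set r := rmodp g f in rE.
  have [||r' Sr' szr'] := Sstrip r.
  - apply: (JP (lead_coef f ^+ rscalp g f *: g)).
      by rewrite -mul_polyC; apply: JM.
    by rewrite rE addrK; apply: PM.
  - move=> Pr; have : P (lead_coef f ^+ rscalp g f *: g).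
      by rewrite rE; apply: PD => //; apply: PM.
    by rewrite -mul_polyC; apply: Pint => //; apply: pX.
  by rewrite (leq_ltn_trans (gmin _ Sr')) // (leq_ltn_trans szr') // ltn_rmodpN0.
(* If [g] were not constant, the remainder of [f] by [g] would lie in [P], hence also the quotient
   [q], by primality. As [q] is shorter than [f], its coefficients lie in p, which contradicts the
   leading coefficient of [f]. *)
have szg1 : size g = 1%N.
  apply/eqP; rewrite eqn_leq size_poly_gt0 g0 andbT leqNgt; apply/negP => szg.
  have rE := rdivp_eq g f; set r := rmodp f g in rE; set q := rdivp f g in rE.
  set c := lead_coef g ^+ _ in rE.
  have szr : (size r < size g)%N by rewrite ltn_rmodpN0.
  have Pr : P r.
    apply: contrapT => nPr; have [|//|r' Sr' szr'] := Sstrip r.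
      apply: (JP (- (q * g))); first by rewrite -mulNr; apply: JM.
      have -> : - (q * g) - r = - (c *: f) by rewrite rE opprD.
      by apply: PN; apply: PZ.
    have := gmin _ Sr'; rewrite leqNgt; apply/negP/negPn.
    by rewrite (leq_ltn_trans szr').
  have Pq : P q.
    have : P (q * g).
      by rewrite -[q * g](addrK r) -rE; apply: PB => //; apply: PZ.
    by case: Pprime => _ _ H /H[].
  have qin : coefs_in q.
    have [q' [qq' szq' [q'0|leadq']]] := strip q.
      by move: qq'; rewrite q'0 subr0.
    have Pq' : P q' by rewrite -[q'](subKr q); apply: PB => //; apply: coefs_inP.
    have szfq' := fmin _ (conj Pq' leadq').
    have q'0 : q' != 0.
      by apply: contra_notN leadq' => /eqP->; rewrite /p lead_coef0.
    pose i := (size q' + size g).-2.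
    have iE : (q' * g)`_i = lead_coef q' * lead_coef g by rewrite mul_lead_coef.
    have szi : (size f <= i)%N.
      rewrite (leq_trans szfq') // /i.
      by move: szg; case: (size g) => [|[|s]] // _; rewrite !addnS leq_addr.
    have : p (q' * g)`_i.
      have -> : q' * g = c *: f - r - (q - q') * g by rewrite rE; ring.
      have fi0 : f`_i = 0 by rewrite nth_default.
      have ri0 : r`_i = 0.
        by rewrite nth_default // (leq_trans _ szi) // ltnW // (ltn_trans szr).
      rewrite coefB coefB coefZ fi0 ri0 mulr0 subrr; apply: pB; first exact: P0.
      by rewrite coefM; apply: psum => j; rewrite mulrC; apply: pM.
    by rewrite iE /p polyCM => /(Pint leadq' leadg).
  have : p (c * lead_coef f).
    have -> : c * lead_coef f = (q * g + r)`_(size f).-1 by rewrite -rE coefZ.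
    rewrite coefD [r`__]nth_default; last first.
      by rewrite -ltnS prednK ?size_poly_gt0 // (ltn_trans szr).
    by rewrite addr0 coefM; apply: psum => j; rewrite mulrC; apply: pM.
  by rewrite /p polyCM; apply: Pint => //; apply: pX.
have [c gE] : exists c, g = c%:P.
  by exists g`_0; apply: size1_polyC; rewrite szg1.
have npc : ~ p c by move: nPg; rewrite gE.
have [T PT] := Jg.
(* The first factor keeps the degree of [f] under [h], so that a root [y] exists and pseudo-division
   by [f] shows that [y] kills [P]; the second makes V(y) nonzero, as c = T V modulo [P]. *)
exists (lead_coef f * c) => [|k h hp].
  by rewrite polyCM; apply: Pint.
rewrite rmorphM mulf_eq0 negb_or => /andP[hf hc].
have szhf : size (map_poly h f) = size f by rewrite size_map_poly_id0.
have szf1 : size (map_poly h f) != 1%N.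
  rewrite szhf; apply/eqP => szf; apply: leadf; rewrite /p.
  by rewrite lead_coefE szf /= -size1_polyC // szf.
have /closed_rootP[y /rootP rooty] := szf1.
have kill Q : P Q -> (map_poly h Q).[y] = 0.
  move=> PQ; have rE := rdivp_eq f Q; set r := rmodp Q f in rE.
  have Pr : P r.
    rewrite -[r](addKr (rdivp Q f * f)) -rE addrC.
    by apply: PB; [apply: PZ|apply: PM].
  have rin : coefs_in r by apply: lowP => //; rewrite ltn_rmodpN0.
  have := congr1 (fun Q => (map_poly h Q).[y]) rE.
  rewrite rmorphD rmorphM /= (map0 _ h hp r rin) addr0 hornerM rooty mulr0.
  rewrite map_polyZ hornerZ => /eqP; rewrite rmorphXn mulf_eq0 expf_eq0.
  by rewrite (negPf hf) andbF => /eqP.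
exists y; split=> //; apply: contraNneq hc => V0.
have := kill _ PT; rewrite gE rmorphB rmorphM /= hornerD hornerN hornerM V0.
by rewrite mulr0 subr0 map_polyC hornerC => ->.
Qed.

End ExtendPlace.

Lemma prime_preimage (R S : comNzRingType) (f : {rmorphism R -> S}) P :
  is_prime_ideal P -> is_prime_ideal (f @^-1` P).
Proof.
case=> -[P0 PD PM] P1 Pint; split; rewrite /preimage /=.
- split=> [|x y|a x] /=; rewrite ?rmorph0 ?rmorphD ?rmorphM //; [exact: PD|exact: PM].
- by rewrite rmorph1.
- by move=> x y; rewrite rmorphM; apply: Pint.
Qed.

Lemma prime_kernel (R : comNzRingType) (S : idomainType) (f : {rmorphism R -> S}) :
  is_prime_ideal [set x | f x = 0].
Proof.
split=> /=; first split=> [|x y|a x] /=.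
- by rewrite rmorph0.
- by rewrite rmorphD => -> ->; rewrite addr0.
- by rewrite rmorphM => ->; rewrite mulr0.
- by rewrite rmorph1; apply/eqP/oner_neq0.
- by move=> x y; rewrite rmorphM => /eqP; rewrite mulf_eq0 => /orP[]/eqP; [left|right].
Qed.

Definition extend_point (T : Type) n (y : 'I_n -> T) (z : T) (i : 'I_n.+1) : T :=
  if unlift ord_max i is Some j then y j else z.

Lemma extend_point_max (T : Type) n (y : 'I_n -> T) z :
  extend_point y z ord_max = z.
Proof. by rewrite /extend_point unlift_none. Qed.

Lemma extend_point_widen (T : Type) n (y : 'I_n -> T) z :
  extend_point y z \o widen_ord (leqnSn n) = y.
Proof.
apply/funext => i /=; rewrite /extend_point.
have -> : widen_ord (leqnSn n) i = lift ord_max i.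
  by apply: val_inj; rewrite /= /bump leqNgt ltn_ord.
by rewrite liftK.
Qed.

(** One variable at a time: the element [u1] that must not vanish for the last variable to extend
    becomes the [V] of the remaining ones. *)
Lemma extend_place (A : comNzRingType) n (P : set {mpoly A[n]}) V :
  is_prime_ideal P -> ~ P V -> exists2 u, ~ P u%:MP &
  forall (k : closedFieldType) (h : {rmorphism A -> k}),
    (forall a, P a%:MP -> h a = 0) -> h u != 0 ->
  exists y, (forall Q, P Q -> mmap h y Q = 0) /\ mmap h y V != 0.
Proof.
elim: n P V => [|n IHn] P V Pprime nPV.
  exists (V@_0%MM); first by rewrite -nvar0_mpolyC.
  move=> k h hp hu; exists (fun _ => 0); split=> [Q|].
    by rewrite (nvar0_mpolyC Q) mmapC; apply: hp.
  by rewrite (nvar0_mpolyC V) mmapC.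
have [W WV] := mpoly_of_poly_surj V.
have primeQ := prime_preimage (@mpoly_of_poly A n) Pprime.
have [|u1 nPu1 Hu1] := extend_place_poly primeQ (V := W).
  by rewrite /preimage /= WV.
have primeR := prime_preimage (@polyC {mpoly A[n]}) primeQ.
have [//|u nPu Hu] := IHn _ u1 primeR.
have mC (a : A) : mpoly_of_poly (a%:MP)%:P = a%:MP_[n.+1].
  by rewrite mpoly_of_polyC mwidenC.
exists u; first by move: nPu; rewrite /preimage /= mC.
move=> k h hp hu.
have hp' a : P (mpoly_of_poly (a%:MP)%:P) -> h a = 0 by rewrite mC; apply: hp.
have [y' [y'P y'u1]] := Hu k h hp' hu.
have [y [yP yW]] := Hu1 k (mmap h y') y'P y'u1.
exists (extend_point y' y).
rewrite -WV mmap_mpoly_of_poly extend_point_max extend_point_widen; split=> // Q.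
have [Q' <-] := mpoly_of_poly_surj Q => PQ'.
by rewrite mmap_mpoly_of_poly extend_point_max extend_point_widen; apply: yP.
Qed.

Lemma noetherian_max (R : comNzRingType) (F : set (set R)) :
  noetherian R -> (forall I, F I -> is_ideal I) -> F !=set0 ->
  exists2 I, F I & forall J, F J -> I `<=` J -> J `<=` I.
Proof.
move=> noethR Fid [I0 FI0]; apply: contrapT => nomax.
have /choice[next Hnext] : forall I : {I | F I}, exists J : {J | F J},
    sval I `<=` sval J /\ ~ sval J `<=` sval I.
  move=> [I FI]; apply: contrapT => noJ; apply: nomax; exists I => // J FJ IJ.
  by apply: contrapT => nJI; apply: noJ; exists (exist _ J FJ).
pose I n := sval (iter n next (exist _ I0 FI0)).
have [n|n|m Hm] := noethR I.
- exact/Fid/svalP.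
- by case: (Hnext (iter n next (exist _ I0 FI0))).
by case: (Hnext (iter m next (exist _ I0 FI0))) => _; apply; apply: Hm (leqnSn m).
Qed.

(** An ideal maximal among those that contain [I] and miss the multiplicative set [S] is prime. *)
Lemma prime_avoiding (R : comNzRingType) (I S : set R) :
  noetherian R -> is_ideal I -> S 1 -> (forall x y, S x -> S y -> S (x * y)) ->
  (forall x, I x -> ~ S x) ->
  exists P, [/\ is_prime_ideal P, I `<=` P & forall x, P x -> ~ S x].
Proof.
move=> noethR Iid S1 SM IS.
pose F := [set J : set R | [/\ is_ideal J, I `<=` J & forall x, J x -> ~ S x]].
have [||P [Pid IP PS] Pmax] := noetherian_max (F := F) noethR.
- by move=> J [].
- by exists I; split.
have [P0 PD PM] := Pid.
exists P; split=> //; split=> //; first by move/PS.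
have meetS x : ~ P x -> exists s p a, [/\ S s, P p & s = p + a * x].
  move=> nPx; apply: contrapT => nomeet; apply: nPx.
  pose J := [set z | exists p a, P p /\ z = p + a * x].
  have PJ : P `<=` J by move=> p Pp; exists p, 0; rewrite mul0r addr0.
  apply: (Pmax J); last by exists 0, 1; rewrite mul1r add0r.
    split; last by move=> z [p [a [Pp ->]]] Ss; apply: nomeet; exists (p + a * x), p, a.
      split; first exact: PJ.
        move=> _ _ [p [a [Pp ->]]] [q [b [Pq ->]]]; exists (p + q), (a + b).
        by rewrite mulrDl addrACA; split=> //; apply: PD.
      move=> c _ [p [a [Pp ->]]]; exists (c * p), (c * a).
      by rewrite mulrDr mulrA; split=> //; apply: PM.
    by move=> z /IP/PJ.
  exact: PJ.
move=> x y Pxy; apply: contrapT => /not_orP[/meetS[s [p [a [Ss Pp sE]]]]].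
move=> /meetS[t [q [b [St Pq tE]]]].
apply: (PS (s * t)); last exact: SM.
have -> : s * t = (q + b * y) * p + (a * x) * q + (a * b) * (x * y).
  by rewrite sE tE; ring.
by apply: (PD); [apply: (PD)|]; apply: (PM).
Qed.

(** * Regular functions on GL_N *)

Definition generic_mx (R : comNzRingType) N : 'M[{mpoly R[N * N]}]_N :=
  \matrix_(i, j) 'X_(mxvec_index i j).

Lemma mmap_det_generic (R S : comNzRingType) (f : {rmorphism R -> S}) N (M : 'M[S]_N) :
  mmap f (fun i => mxvec M 0 i) (\det (generic_mx R N)) = \det M.
Proof.
rewrite -det_map_mx; congr (\det _).
by apply/matrixP => i j; rewrite !mxE /= mmapX mmap1U mxvecE.
Qed.

Lemma mx_eval_det (k : fieldType) N (A : comUnitRingType) (f : {rmorphism k -> A})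
    (M : 'M[A]_N) : mx_eval f M (\det (generic_mx k N)) = \det M.
Proof. exact: mmap_det_generic. Qed.

HB.instance Definition _ (k : fieldType) N (A : comUnitRingType)
    (f : {rmorphism k -> A}) (M : 'M[A]_N) :=
  GRing.RMorphism.copy (mx_eval f M) (mmap f (fun i => mxvec M 0 i)).

Section Regular.
Variables (k : fieldType) (N : nat).
Implicit Types (M : 'M[k]_N) (p q : {mpoly k[N * N]}) (F : 'M[k]_N -> k).

Notation ev := (mx_eval (idfun : k -> k)).

(* Regular functions on GL_N, as functions on all matrices whose values at the
   non-invertible ones are irrelevant. *)
Definition regular F : Prop := exists p D, forall M, M \in unitmx ->
  ev M p = F M * \det M ^+ D.

Lemma regular_ext F F' : (forall M, M \in unitmx -> F M = F' M) ->
  regular F -> regular F'.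
Proof.
by move=> FF' [p [D H]]; exists p, D => M uM; rewrite H // FF'.
Qed.

Lemma regular_cst c : regular (fun=> c).
Proof.
by exists c%:MP, 0%N => M _; rewrite /mx_eval mmapC mulr1.
Qed.

Lemma regular_coord i j : regular (fun M => M i j).
Proof.
by exists 'X_(mxvec_index i j), 0%N => M _; rewrite /mx_eval mmapX mmap1U mxvecE mulr1.
Qed.

Lemma regular_add F F' : regular F -> regular F' -> regular (fun M => F M + F' M).
Proof.
move=> [p [D Hp]] [q [E Hq]].
exists (p * \det (generic_mx k N) ^+ E + q * \det (generic_mx k N) ^+ D), (D + E)%N => M uM.
rewrite rmorphD !rmorphM !rmorphXn /= !mx_eval_det Hp // Hq //.
by rewrite mulrDl exprD; ring.
Qed.

Lemma regular_mul F F' : regular F -> regular F' -> regular (fun M => F M * F' M).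
Proof.
move=> [p [D Hp]] [q [E Hq]]; exists (p * q), (D + E)%N => M uM.
by rewrite rmorphM /= Hp // Hq // exprD mulrACA.
Qed.

Lemma regular_opp F : regular F -> regular (fun M => - F M).
Proof.
move=> rF; apply: regular_ext (regular_mul (regular_cst (-1)) rF) => M _.
by rewrite mulN1r.
Qed.

Lemma regular_sub F F' : regular F -> regular F' -> regular (fun M => F M - F' M).
Proof. by move=> rF rF'; apply: regular_add => //; apply: regular_opp. Qed.

Lemma regular_exp F n : regular F -> regular (fun M => F M ^+ n).
Proof.
move=> rF; elim: n => [|n IHn]; first by apply: regular_ext (regular_cst 1).
by apply: regular_ext (regular_mul rF IHn) => M _; rewrite exprS.
Qed.

Lemma regular_sum (I : Type) (r : seq I) (P : pred I) (F : I -> 'M[k]_N -> k) :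
  (forall i, regular (F i)) -> regular (fun M => \sum_(i <- r | P i) F i M).
Proof.
move=> rF; elim: r => [|i r IHr].
  by apply: regular_ext (regular_cst 0) => M _; rewrite big_nil.
case: (boolP (P i)) => Pi.
  by apply: regular_ext (regular_add (rF i) IHr) => M _; rewrite big_cons Pi.
by apply: regular_ext IHr => M _; rewrite big_cons (negPf Pi).
Qed.

Lemma regular_prod (I : Type) (r : seq I) (P : pred I) (F : I -> 'M[k]_N -> k) :
  (forall i, regular (F i)) -> regular (fun M => \prod_(i <- r | P i) F i M).
Proof.
move=> rF; elim: r => [|i r IHr].
  by apply: regular_ext (regular_cst 1) => M _; rewrite big_nil.
case: (boolP (P i)) => Pi.
  by apply: regular_ext (regular_mul (rF i) IHr) => M _; rewrite big_cons Pi.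
by apply: regular_ext IHr => M _; rewrite big_cons (negPf Pi).
Qed.

Definition regular_mx m n (f : 'M[k]_N -> 'M[k]_(m, n)) : Prop :=
  forall i j, regular (fun M => f M i j).

Lemma regular_mx_id : regular_mx id.
Proof. exact: regular_coord. Qed.

Lemma regular_mx_cst m n (A : 'M[k]_(m, n)) : regular_mx (fun=> A).
Proof. by move=> i j; apply: regular_cst. Qed.

Lemma regular_mulmx m n r (f : 'M[k]_N -> 'M[k]_(m, n)) (g : 'M[k]_N -> 'M[k]_(n, r)) :
  regular_mx f -> regular_mx g -> regular_mx (fun M => f M *m g M).
Proof.
move=> rf rg i j; apply: regular_ext (regular_sum _ (fun=> true)
  (fun l => regular_mul (rf i l) (rg l j))) => M _.
by rewrite mxE.
Qed.

Lemma regular_det n (f : 'M[k]_N -> 'M[k]_n) :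
  regular_mx f -> regular (fun M => \det (f M)).
Proof.
move=> rf; rewrite /determinant; apply: regular_sum => s.
by apply: regular_mul; [apply: regular_cst|apply: regular_prod].
Qed.

Lemma regular_invmx : regular_mx (fun M => invmx M).
Proof.
move=> i j.
have [p [D Hp]] : regular (fun M => (\adj M) i j).
  have rc : regular (fun M => cofactor M j i).
    apply: regular_mul; first exact: regular_cst.
    by apply: regular_det => i' j'; apply: regular_ext (regular_coord _ _) => M _; rewrite !mxE.
  by apply: regular_ext rc => M _; rewrite mxE.
exists p, D.+1 => M uM; rewrite Hp // /invmx uM [in RHS]mxE exprS mulrACA mulVf ?mul1r //.
by rewrite -unitfE -unitmxE.
Qed.

Lemma regular_comp_poly (f : 'M[k]_N -> 'M[k]_N) p :
  regular_mx f -> regular (fun M => ev (f M) p).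
Proof.
move=> rf; apply: regular_ext (regular_sum (msupp p) (fun=> true)
   (F := fun m M => p@_m * \prod_i (mxvec (f M) 0 i) ^+ m i) _) => [M _|m].
  by rewrite /mx_eval /mmap.
apply: regular_mul; first exact: regular_cst.
apply: regular_prod => i; apply: regular_exp.
have [i' j'] := mxvec_indexP i.
by apply: regular_ext (rf i' j') => M _; rewrite mxvecE.
Qed.

Lemma regular_comp F (f : 'M[k]_N -> 'M[k]_N) : regular F -> regular_mx f ->
  regular_mx (fun M => invmx (f M)) -> (forall M, M \in unitmx -> f M \in unitmx) ->
  regular (fun M => F (f M)).
Proof.
move=> [p [D Hp]] rf rfV uf.
apply: regular_ext (regular_mul (regular_comp_poly p rf)
   (regular_exp D (regular_det rfV))) => M /uf uM.
rewrite Hp // det_inv exprVn mulfK // expf_neq0 //.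
by rewrite -unitfE -unitmxE.
Qed.

Lemma regular_mx_ext m n (f g : 'M[k]_N -> 'M[k]_(m, n)) :
  (forall M, M \in unitmx -> f M = g M) -> regular_mx f -> regular_mx g.
Proof.
by move=> fg rf i j; apply: regular_ext (rf i j) => M uM; rewrite fg.
Qed.

Lemma regular_invmx_comp F : regular F -> regular (fun M => F (invmx M)).
Proof.
move=> rF; apply: regular_comp rF regular_invmx _ _ => [|M].
  by apply: regular_mx_ext regular_mx_id => M _; rewrite invmxK.
by rewrite unitmx_inv.
Qed.

(* Closed in GL_N, not in the space of all matrices. *)
Definition uclosed (T : set 'M[k]_N) : Prop := exists S : set {mpoly k[N * N]},
  T = [set M | M \in unitmx /\ forall p, S p -> ev M p = 0].

Lemma uclosed_regular (S : set ('M[k]_N -> k)) : (forall F, S F -> regular F) ->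
  uclosed [set M | M \in unitmx /\ forall F, S F -> F M = 0].
Proof.
move=> rS.
exists [set p | exists F D, S F /\ forall M, M \in unitmx ->
  ev M p = F M * \det M ^+ D].
apply/seteqP; split=> M /= [uM HM]; split=> //.
  by move=> p [F [D [SF ->]]] //; rewrite HM ?mul0r.
move=> F SF; have [p [D Hp]] := rS _ SF.
have /eqP := HM p (ex_intro _ F (ex_intro _ D (conj SF Hp))).
rewrite Hp // mulf_eq0 expf_eq0 => /orP[/eqP//|/andP[_ /eqP d0]].
by move: uM; rewrite unitmxE d0 unitr0.
Qed.

Lemma uclosed_zero F : regular F -> uclosed [set M | M \in unitmx /\ F M = 0].
Proof.
move=> rF.
have -> : [set M | M \in unitmx /\ F M = 0] =
  [set M | M \in unitmx /\ forall F', [set F] F' -> F' M = 0].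
  by apply/seteqP; split=> M /= [uM HM]; split=> //; [move=> _ ->|apply: HM].
by apply: uclosed_regular => _ ->.
Qed.

End Regular.

(** * Zariski topology on GL_N *)

Section Topology.
Variables (k : fieldType) (N : nat).
Implicit Types (M x y : 'M[k]_N) (p q : {mpoly k[N * N]}) (B T : set 'M[k]_N).

Notation ev := (mx_eval (idfun : k -> k)).
Notation units := [set M : 'M[k]_N | M \in unitmx].

Lemma uclosedI T T' : uclosed T -> uclosed T' -> uclosed (T `&` T').
Proof.
move=> [S ->] [S' ->]; exists (S `|` S'); apply/seteqP; split=> M /=.
  by move=> [[uM HM] [_ HM']]; split=> // p [/HM|/HM'].
by move=> [uM HM]; split; split=> // p Sp; apply: HM; [left|right].
Qed.

Lemma uclosedU T T' : uclosed T -> uclosed T' -> uclosed (T `|` T').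
Proof.
move=> [S ->] [S' ->]; exists [set r | exists p q, [/\ S p, S' q & r = p * q]].
apply/seteqP; split=> M /=.
  move=> [] [uM HM]; split=> // _ [p [q [Sp Sq ->]]]; rewrite rmorphM /=.
    by rewrite (HM p Sp) mul0r.
  by rewrite (HM q Sq) mulr0.
move=> [uM HM]; apply: contrapT => /not_orP[nS nS'].
have [p Sp np] : exists2 p, S p & ev M p != 0.
  apply: contrapT => nop; apply: nS; split=> // p Sp.
  by apply/eqP/negPn/negP => np; apply: nop; exists p.
have [q Sq nq] : exists2 q, S' q & ev M q != 0.
  apply: contrapT => noq; apply: nS'; split=> // q Sq.
  by apply/eqP/negPn/negP => nq; apply: noq; exists q.
have /eqP := HM (p * q) (ex_intro _ p (ex_intro _ q (And3 Sp Sq erefl))).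
by rewrite rmorphM mulf_eq0 (negPf np) (negPf nq).
Qed.

Lemma uclosed_preim (f : 'M[k]_N -> 'M[k]_N) T : regular_mx f ->
  (forall M, M \in unitmx -> f M \in unitmx) ->
  uclosed T -> uclosed [set M | M \in unitmx /\ T (f M)].
Proof.
move=> rf uf [S ->].
have := @uclosed_regular _ _ [set F | exists2 p, S p & F = fun M => ev (f M) p] _.
move=> /(_ _)[|S' S'E]; first by move=> _ [p Sp ->]; apply: regular_comp_poly.
exists S'; rewrite -S'E; apply/seteqP; split=> M /= [uM HM]; split=> //.
  by move=> _ [p Sp ->]; apply: HM.2.
by split=> [|p Sp]; [apply: uf|apply: (HM (fun M => ev (f M) p)); exists p].
Qed.

(** On subsets of GL_N, closed sets of GL_N and of the whole matrix space have the same traces, so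
    either kind may test connectedness. *)
Lemma connected_uclosed B : B `<=` units -> zariski_connected B ->
  forall T1 T2, uclosed T1 -> uclosed T2 -> B `<=` T1 `|` T2 ->
  B `&` (T1 `&` T2) = set0 -> B `<=` T1 \/ B `<=` T2.
Proof.
move=> Bu Bconn T1 T2 [S1 T1E] [S2 T2E] BT BT0.
pose Z S := [set M | forall p, S p -> ev M p = 0].
have TZ T S : T = [set M | M \in unitmx /\ Z S M] ->
    forall M, B M -> T M <-> Z S M.
  by move=> -> M /Bu uM; split=> [[]|].
have T1Z := TZ _ _ T1E; have T2Z := TZ _ _ T2E.
have [||||B1|B2] := Bconn (Z S1) (Z S2).
- by exists S1.
- by exists S2.
- by move=> M BM; case: (BT M BM) => [/(T1Z _ BM)|/(T2Z _ BM)]; [left|right].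
- apply/seteqP; split=> // M [BM [/(T1Z _ BM) TM1 /(T2Z _ BM) TM2]].
  by rewrite -BT0; split.
- by left=> M BM; apply/(T1Z _ BM)/B1.
- by right=> M BM; apply/(T2Z _ BM)/B2.
Qed.

Lemma uclosed_connected B : B `<=` units ->
  (forall T1 T2, uclosed T1 -> uclosed T2 -> B `<=` T1 `|` T2 ->
   B `&` (T1 `&` T2) = set0 -> B `<=` T1 \/ B `<=` T2) -> zariski_connected B.
Proof.
move=> Bu Bconn Z1 Z2 [S1 ->] [S2 ->] BZ BZ0.
pose T S := [set M | M \in unitmx /\ forall p, S p -> ev M p = 0].
have [||||B1|B2] := Bconn (T S1) (T S2).
- by exists S1.
- by exists S2.
- by move=> M BM; have uM := Bu _ BM; case: (BZ M BM); [left|right].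
- by apply/seteqP; split=> // M [BM [[_ H1] [_ H2]]]; rewrite -BZ0.
- by left=> M /B1[].
- by right=> M /B2[].
Qed.

Lemma connected_image B (f : 'M[k]_N -> 'M[k]_N) : B `<=` units ->
  regular_mx f -> (forall M, M \in unitmx -> f M \in unitmx) ->
  zariski_connected B -> zariski_connected [set f M | M in B].
Proof.
move=> Bu rf uf Bconn; apply: uclosed_connected => [_ [M /Bu uM <-]|T1 T2 c1 c2 BT BT0].
  exact: uf.
have [||||B1|B2] := connected_uclosed Bu Bconn (T1 := [set M | M \in unitmx /\ T1 (f M)])
  (T2 := [set M | M \in unitmx /\ T2 (f M)]).
- exact: uclosed_preim.
- exact: uclosed_preim.
- move=> M BM; have uM := Bu _ BM.
  by case: (BT (f M)) => [|TfM|TfM]; [exists M|left|right].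
- apply/seteqP; split=> // M [BM [[_ H1] [_ H2]]].
  have : ([set f M | M in B] `&` (T1 `&` T2)) (f M) by split=> //; exists M.
  by rewrite BT0.
- by left=> _ [M BM <-]; have [] := B1 M BM.
- by right=> _ [M BM <-]; have [] := B2 M BM.
Qed.

(** The fibre through [x] and the union of the other fibres are closed and disjoint. This is the
    rigidity used below for eigenvalues and roots of unity that vary regularly over a connected
    group. *)
Lemma connected_cst B F (s : seq k) : B `<=` units -> zariski_connected B ->
  regular F -> (forall x, B x -> F x \in s) -> forall x y, B x -> B y -> F x = F y.
Proof.
move=> Bu Bconn rF Fs x y Bx By.
pose F' M := \prod_(c <- s | c != F x) (F M - c).
have rF' : regular F'.
  by apply: regular_prod => c; apply: regular_sub => //; apply: regular_cst.
have rG : regular (fun M => F M - F x).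
  by apply: regular_sub => //; apply: regular_cst.
have [||Bx1|By1] := connected_uclosed Bu Bconn (uclosed_zero rG) (uclosed_zero rF').
- move=> M BM; have uM : M \in unitmx by apply: Bu.
  have [FM|nFM] := eqVneq (F M) (F x).
    by left; split=> //; rewrite FM subrr.
  right; split=> //; apply/eqP; rewrite prodf_seq_eq0; apply/hasP.
  by exists (F M); [apply: Fs|rewrite nFM subrr eqxx].
- apply/seteqP; split=> // M [BM [[_ /eqP FM] [_ /eqP F'M]]].
  move: F'M; rewrite prodf_seq_eq0 => /hasP[c _ /andP[cFx]].
  by rewrite subr_eq0 in FM; rewrite (eqP FM) subr_eq0 eq_sym (negPf cFx).
- by have [_ /eqP] := Bx1 y By; rewrite subr_eq0 => /eqP.
- have [_ /eqP] := By1 x Bx; rewrite prodf_seq_eq0 => /hasP[c _ /andP[cFx]].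
  by rewrite subr_eq0 eq_sym (negPf cFx).
Qed.

(** Vanishing ideals turn this descending condition into the ascending one for polynomial ideals. *)
Lemma uclosed_min (F : set (set 'M[k]_N)) : (forall T, F T -> uclosed T) ->
  F !=set0 -> exists2 T, F T & forall T', F T' -> T' `<=` T -> T `<=` T'.
Proof.
move=> Fc [T0 FT0].
pose I T : set {mpoly k[N * N]} := [set p | forall M, T M -> ev M p = 0].
have IK T : uclosed T -> T = [set M | M \in unitmx /\ forall p, I T p -> ev M p = 0].
  move=> [S TE]; apply/seteqP; split=> M /=.
    by move=> TM; split=> [|p]; [move: TM; rewrite TE => -[]|apply].
  move=> [uM HM]; rewrite TE; split=> // p Sp; apply: HM => M'.
  by rewrite TE => -[_]; apply.
have noethR : noetherian {mpoly k[N * N]}.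
  exact/mpoly_noetherian/field_noetherian.
have [||_ [T FT <-] Tmax] := noetherian_max (F := [set I T | T in F]) noethR.
- move=> _ [T _ <-]; split=> [M _|p q Hp Hq M TM|a p Hp M TM].
  + by rewrite rmorph0.
  + by rewrite rmorphD /= Hp // Hq // addr0.
  + by rewrite rmorphM /= Hp // mulr0.
- by exists (I T0), T0.
exists T => // T' FT' T'T M TM.
have IT'T : I T' `<=` I T.
  by apply: Tmax; [exists T'|move=> p Hp M' /T'T; apply: Hp].
rewrite (IK T' (Fc _ FT')); split=> [|p /IT'T]; last exact.
by move: TM; rewrite (IK T (Fc _ FT)) => -[].
Qed.

Lemma idc_sub B : id_component B `<=` B.
Proof. by move=> M [T [TB _ _]]; apply: TB. Qed.

Lemma idc_max B T : T `<=` B -> zariski_connected T -> T 1%:M ->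
  T `<=` id_component B.
Proof. by move=> TB Tc T1 M TM; exists T. Qed.

Lemma idc_mono B B' : B `<=` B' -> id_component B `<=` id_component B'.
Proof. by move=> BB' M [T [TB Tc T1 TM]]; exists T; split=> // x /TB/BB'. Qed.

Lemma idc1 B : B 1%:M -> id_component B 1%:M.
Proof.
move=> B1; exists [set 1%:M]; split=> //; first by move=> _ ->.
move=> Z1 Z2 _ _ H _; case: (H 1%:M erefl) => ?; [left|right]; by move=> _ ->.
Qed.

Lemma idc_connected B : zariski_connected (id_component B).
Proof.
wlog suff gen : / forall Z1 Z2, zariski_closed Z1 -> zariski_closed Z2 ->
    id_component B `<=` Z1 `|` Z2 -> id_component B `&` (Z1 `&` Z2) = set0 ->
    Z1 1%:M -> id_component B `<=` Z1.
  move=> Z1 Z2 c1 c2 BZ BZ0.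
  have [[M CM]|noC] := pselect (id_component B !=set0); last first.
    by left=> M CM; case: noC; exists M.
  have C1 : id_component B 1%:M.
    by apply: idc1; case: CM => T [TB _ T1 _]; apply: TB.
  case: (BZ _ C1) => [Z11|Z21]; [left; exact: (gen Z1 Z2)|right].
  by apply: (gen Z2 Z1) => //; [rewrite setUC|rewrite (setIC Z2)].
move=> Z1 Z2 c1 c2 BZ BZ0 Z11 M [T [TB Tc T1 TM]].
have TC : T `<=` id_component B by apply: idc_max.
have [|||T2] := Tc Z1 Z2 c1 c2 _ _.
- by move=> x /TC/BZ.
- by apply/seteqP; split=> // x [/TC Cx Zx]; rewrite -BZ0.
- exact.
have : (id_component B `&` (Z1 `&` Z2)) 1%:M.
  by split; [apply: TC|split=> //; apply: T2].
by rewrite BZ0.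
Qed.

Definition mx_group B : Prop := [/\ B `<=` units, B 1%:M,
  forall x y, B x -> B y -> B (x *m y) & forall x, B x -> B (invmx x)].

Lemma invmxM x y : x \in unitmx -> y \in unitmx ->
  invmx (x *m y) = invmx y *m invmx x.
Proof.
move=> ux uy; have uxy : x *m y \in unitmx by rewrite unitmx_mul ux.
have H : (invmx y *m invmx x) *m (x *m y) = 1%:M.
  by rewrite mulmxA mulmxKV // mulVmx.
by rewrite -[LHS]mul1mx -H mulmxK.
Qed.

Lemma regular_mx_mul x y : regular_mx (fun M => x *m M *m y).
Proof.
do 2?apply: regular_mulmx; [exact: regular_mx_cst|exact: regular_mx_id|
  exact: regular_mx_cst].
Qed.

(** For x in the component, its translate by the inverse of x is connected and contains 1, hence
    lies in the component again. *)
Lemma idc_group B : mx_group B -> mx_group (id_component B).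
Proof.
move=> [Bu B1 BM BV]; have CB := @idc_sub B.
have C1 := idc1 B1.
have CVM x y : id_component B x -> id_component B y -> id_component B (invmx x *m y).
  move=> Cx Cy; have Bx := CB _ Cx; have ux := Bu _ Bx.
  have : [set invmx x *m M *m 1%:M | M in id_component B] `<=` id_component B.
    apply: idc_max.
    - by move=> _ [M CM <-]; rewrite mulmx1; apply: BM; [apply: BV|apply: CB].
    - apply: connected_image => [M /CB/Bu//||M uM|].
      + exact: regular_mx_mul.
      + by rewrite mulmx1 unitmx_mul unitmx_inv ux.
      + exact: idc_connected.
    - by exists x => //; rewrite mulmx1 mulVmx.
  by apply; exists y; rewrite // mulmx1.
have CV x : id_component B x -> id_component B (invmx x).
  by move=> Cx; rewrite -[invmx x]mulmx1; apply: CVM.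
split=> // [x /CB/Bu//|x y Cx Cy].
by rewrite -[x]invmxK; apply: CVM => //; apply: CV.
Qed.

Lemma idc_conj B a x : mx_group B -> B a -> id_component B x ->
  id_component B (a *m x *m invmx a).
Proof.
move=> [Bu B1 BM BV] Ba Cx; have ua := Bu _ Ba.
have : [set a *m M *m invmx a | M in id_component B] `<=` id_component B.
  apply: idc_max.
  - move=> _ [M /idc_sub CM <-]; apply: (BM); [exact: BM|exact: BV].
  - apply: connected_image => [M /idc_sub/Bu//||M uM|].
    + exact: regular_mx_mul.
    + by rewrite !unitmx_mul ua uM unitmx_inv.
    + exact: idc_connected.
  - by exists 1%:M; [apply: idc1|rewrite mulmx1 mulmxV].
by apply; exists x.
Qed.

(** A minimal open and closed subset containing 1 exists by the descending chain condition. A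
    separation of it would produce a smaller one, so it is connected. *)
Lemma idc_clopen B : uclosed B -> B 1%:M ->
  uclosed (id_component B) /\ uclosed (B `\` id_component B).
Proof.
move=> cB B1.
have Bu : B `<=` units by case: cB => S -> M [].
pose F := [set K | [/\ uclosed K, uclosed (B `\` K), K `<=` B & K 1%:M]].
have [||K [cK cK' KB K1] Kmin] := @uclosed_min F.
- by move=> T [].
- exists B; split=> //; rewrite setDv; exists [set 1].
  apply/seteqP; split=> // M [_ /(_ 1 erefl)/eqP].
  by rewrite rmorph1 oner_eq0.
suff -> : id_component B = K by [].
have C1 := idc1 B1.
apply/seteqP; split.
  have [||//|CK'] := connected_uclosed (fun M CM => Bu _ (idc_sub CM)) (@idc_connected B) cK cK'.
  - by move=> M /idc_sub BM; have [KM|nKM] := pselect (K M); [left|right].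
  - by apply/seteqP; split=> // M [_ [KM [_ /(_ KM)]]].
  - by case: (CK' _ C1) => _ /(_ K1).
apply: idc_max => //.
have gen T1 T2 : uclosed T1 -> uclosed T2 -> K `<=` T1 `|` T2 ->
    K `&` (T1 `&` T2) = set0 -> T1 1%:M -> K `<=` T1.
  move=> c1 c2 KT KT0 T11.
  have : K `<=` K `&` T1 => [|+ M KM]; last by move=> /(_ M KM)[].
  apply: Kmin => [|M []//]; split; [exact: uclosedI| |by move=> M [/KB]|by []].
  suff -> : B `\` (K `&` T1) = (B `\` K) `|` (K `&` T2).
    by apply: uclosedU => //; apply: uclosedI.
  apply/seteqP; split=> M /=.
    move=> [BM nKT]; have [KM|nKM] := pselect (K M); last by left.
    by right; split=> //; case: (KT M KM) => // T1M; case: nKT.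
  move=> [[BM nKM]|[KM T2M]]; first by split=> // -[].
  split; first exact: KB.
  by move=> [_ T1M]; have : (K `&` (T1 `&` T2)) M by []; rewrite KT0.
apply: uclosed_connected => [M /KB/Bu//|T1 T2 c1 c2 KT KT0].
case: (KT _ K1) => [T11|T21]; [left; exact: (gen T1 T2)|right].
by apply: (gen T2 T1) => //; [rewrite setUC|rewrite (setIC T2)].
Qed.

(** The complements of finite unions of cosets are closed; a minimal one is empty, since removing
    the coset of one of its points would shrink it. *)
Lemma idc_finite_index B : uclosed B -> mx_group B -> exists s : seq 'M[k]_N,
  (forall x, x \in s -> B x) /\
  forall y, B y -> exists2 x, x \in s & id_component B (invmx x *m y).
Proof.
move=> cB [Bu B1 BM BV]; have [_ cBC] := idc_clopen cB B1.
pose T (s : seq 'M[k]_N) := [set y | B y /\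
  forall x, x \in s -> ~ id_component B (invmx x *m y)].
pose F := [set Z | exists2 s : seq 'M[k]_N, (forall x, x \in s -> B x) & Z = T s].
have TS x s : T (x :: s) `<=` T s.
  by move=> y [By Hy]; split=> // z zs; apply: Hy; rewrite inE zs orbT.
have [||_ [s Bs ->] smin] := @uclosed_min F.
- move=> _ [s Bs ->]; elim: s Bs => [|x s IHs] Bs.
    suff -> : T [::] = B by [].
    by apply/seteqP; split=> y; [case|split].
  have ux : x \in unitmx by apply/Bu/Bs/mem_head.
  suff -> : T (x :: s) = T s `&`
      [set M | M \in unitmx /\ (B `\` id_component B) (invmx x *m M *m 1%:M)].
    apply: uclosedI; first by apply: IHs => z zs; apply: Bs; rewrite inE zs orbT.
    apply: uclosed_preim => //; first exact: regular_mx_mul.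
    by move=> M uM; rewrite mulmx1 unitmx_mul unitmx_inv ux.
  apply/seteqP; split=> y.
    move=> Ty; split; first exact: TS Ty.
    case: Ty => By Hy; rewrite /= mulmx1; split; first exact: Bu.
    split; last by apply: Hy; rewrite mem_head.
    by apply: BM => //; apply/BV/Bs/mem_head.
  move=> [[By Hy] [_ [_]]]; rewrite mulmx1 => nC; split=> // z.
  by rewrite inE => /predU1P[->//|]; apply: Hy.
- by exists (T [::]), [::].
exists s; split=> // y By; apply: contrapT => noy.
have Ty : T s y by split=> // x xs Cxy; apply: noy; exists x.
have FTy : F (T (y :: s)).
  by exists (y :: s) => // x; rewrite inE => /predU1P[->//|]; apply: Bs.
have [_ /(_ y (mem_head _ _))] := smin (T (y :: s)) FTy (@TS y s) y Ty.
by rewrite mulVmx; [apply; apply: idc1|apply: Bu].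
Qed.

Definition mxpow x e := iter e (mulmx x) 1%:M.

Lemma mxpowS x e : mxpow x e.+1 = x *m mxpow x e.
Proof. by []. Qed.

Lemma mxpowD x d e : mxpow x (d + e) = mxpow x d *m mxpow x e.
Proof.
elim: d => [|d IHd]; first by rewrite mul1mx.
by rewrite addSn !mxpowS IHd mulmxA.
Qed.

Lemma mx_group_pow B x e : mx_group B -> B x -> B (mxpow x e).
Proof. by move=> [_ B1 BM _] Bx; elim: e => //= e; apply: BM. Qed.

Lemma idc_exponent B : uclosed B -> mx_group B ->
  exists2 e, (0 < e)%N & forall y, B y -> id_component B (mxpow y e).
Proof.
move=> cB gB; have [s [Bs Hs]] := idc_finite_index cB gB.
have gC := idc_group gB; have [Cu C1 CM CV] := gC.
(* Each [y] has its own [d] with 0 < d <= [size s], found by pigeonhole on the cosets of its powers;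
   the factorial is a common multiple. *)
exists (size s)`!; first exact: fact_gt0.
move=> y By.
have /choice[f Hf] : forall i : 'I_(size s).+1, exists j : 'I_(size s),
    id_component B (invmx (nth 1%:M s j) *m mxpow y i).
  move=> i; have [x xs Cx] := Hs _ (mx_group_pow i gB By).
  by exists (Ordinal (etrans (index_mem x s) xs)); rewrite /= nth_index.
have [i [j [ij fij]]] : exists i j : 'I_(size s).+1, (i < j)%N /\ f i = f j.
  have /injectivePn[i [j ij fij]] : ~~ injectiveb f.
    by apply/injectiveP => /leq_card; rewrite !card_ord ltnn.
  case: (ltngtP i j) => [ltij|ltji|/val_inj eij]; [by exists i, j|by exists j, i|].
  by rewrite eij eqxx in ij.
pose d := (j - i)%N.
have Cd : id_component B (mxpow y d).
  have Bx : B (nth 1%:M s (f i)) by apply/Bs/mem_nth.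
  have [Bu _ _ _] := gB.
  have uy e : mxpow y e \in unitmx by apply: Bu; apply: mx_group_pow.
  have := CM _ _ (CV _ (Hf i)) (Hf j); rewrite -fij.
  have -> : mxpow y j = mxpow y i *m mxpow y d by rewrite -mxpowD /d subnKC // ltnW.
  set x := nth _ _ _; have ux : x \in unitmx by apply: Bu.
  have uVx : invmx x \in unitmx by rewrite unitmx_inv.
  rewrite !mulmxA invmxM // invmxK mulmxK //.
  by rewrite mulVmx // mul1mx.
have [d_gt0 d_le] : (0 < d)%N /\ (d <= size s)%N.
  by rewrite subn_gt0 ij (leq_trans (leq_subr _ _)) // -ltnS.
have /dvdnP[c ->] : (d %| (size s)`!)%N by rewrite dvdn_fact // d_gt0.
elim: c => [|c IHc]; first by rewrite mul0n.
by rewrite mulSn mxpowD; apply: CM.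
Qed.

End Topology.

(** * Characters separating components *)

Lemma det_bordered (k : fieldType) w (M : 'M[k]_w) (c : 'cV_w) (r : 'rV_w) (d : 'M_1) :
  M \in unitmx -> \det (block_mx M c r d) = \det M * (d - r *m invmx M *m c) 0 0.
Proof.
move=> uM.
have -> : block_mx M c r d =
    block_mx M 0 r 1%:M *m block_mx 1%:M (invmx M *m c) 0 (d - r *m invmx M *m c).
  rewrite mulmx_block ?(mulmx1, mul0mx, mul1mx, mulmx0, addr0) mulKVmx //.
  by rewrite mulmxA addrC subrK.
by rewrite det_mulmx det_lblock det_ublock !det1 mulr1 mul1r det_mx11.
Qed.

(** The kernel [K] has finite rank, so an invertible minor of largest size exists. Bordering it by
    the row of [x] and the column of [y] gives a singular matrix, and the vanishing of its Schur
    complement is the formula. *)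
Lemma max_minor (k : fieldType) (T : Type) (A X : set T) (K : T -> T -> k)
    (I : finType) (s r : I -> T -> k) :
  (forall a x, A a -> X x -> K a x = \sum_i s i a * r i x) ->
  exists w (a b : 'I_w -> T), let Kab := \matrix_(i, j) K (a i) (b j) in
  [/\ forall i, A (a i), forall j, X (b j), Kab \in unitmx &
      forall x y, A x -> X y -> K x y =
        ((\row_j K x (b j)) *m invmx Kab *m (\col_i K (a i) y)) 0 0].
Proof.
move=> KE.
pose P w := `[< exists a b : 'I_w -> T, [/\ forall i, A (a i), forall j, X (b j) &
  (\matrix_(i, j) K (a i) (b j)) \in unitmx] >].
have Pmax w : P w -> (w <= #|I|)%N.
  move=> /asboolP[a [b [Aa Xb]]].
  rewrite -row_free_unit /row_free => /eqP {1}<-.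
  have -> : \matrix_(i, j) K (a i) (b j) =
      (\matrix_(i, l) s (@enum_val I predT l) (a i)) *m
      (\matrix_(l, j) r (@enum_val I predT l) (b j)).
    apply/matrixP => i j; rewrite !mxE KE // (reindex (@enum_val I predT)) /=.
      by apply: eq_bigr => l _; rewrite !mxE.
    exact/onW_bij/enum_val_bij.
  by rewrite (leq_trans (mxrankM_maxl _ _)) // rank_leq_col.
have P0 : exists w, P w.
  exists 0%N; apply/asboolP.
  have z : 'I_0 -> T by case.
  by exists z, z; split=> [[]|[]|] //; rewrite unitmxE det_mx00 unitr1.
have [w /asboolP[a [b [Aa Xb uK]]] wmax] := ex_maxnP P0 Pmax.
exists w, a, b; split=> // x y Ax Xy.
set M := \matrix_(i, j) _ in uK *.
pose a' (i : 'I_(w + 1)) := if fintype.split i is inl j then a j else x.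
pose b' (i : 'I_(w + 1)) := if fintype.split i is inl j then b j else y.
have M'E : \matrix_(i, j) K (a' i) (b' j) =
    block_mx M (\col_i K (a i) y) (\row_j K x (b j)) (K x y)%:M.
  apply/matrixP => i j; rewrite !mxE /a' /b'.
  by case: fintype.split => i'; rewrite !mxE; case: fintype.split => j'; rewrite !mxE // !ord1.
have nP : ~~ P (w + 1)%N.
  by apply/negP => /wmax; rewrite addn1 ltnn.
apply/eqP; rewrite -subr_eq0; apply: contraNT nP => nz; apply/asboolP.
exists a', b'; split=> [i|j|].
- by rewrite /a'; case: fintype.split.
- by rewrite /b'; case: fintype.split.
rewrite M'E unitmxE det_bordered // unitfE mulf_neq0 //.
  by rewrite -unitfE -unitmxE.
by rewrite !mxE eqxx mulr1n; move: nz; rewrite mxE.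
Qed.

(** By row expansion these determinants are the entries of [v] times the adjugate of [M]. *)
Lemma det_replace_row (k : fieldType) w (M : 'M[k]_w) (v : 'rV[k]_w) :
  M \in unitmx -> v != 0 ->
  exists i0, \det (\matrix_(i, j) if i == i0 then v 0 j else M i j) != 0.
Proof.
move=> uM v0; apply: contrapT => /forallNP H.
case/eqP: v0; have vadj : v *m \adj M = 0.
  apply/rowP => i0; have /negP/negPn/eqP := H i0.
  rewrite (expand_det_row _ i0) !mxE => {2}<-.
  apply: eq_bigr => j _; rewrite !mxE eqxx; congr (_ * _).
  rewrite /cofactor; congr (_ * \det _).
  by apply/matrixP => i l; rewrite !mxE eq_sym (negPf (neq_lift _ _)).
have := congr1 (mulmx^~ M) vadj; rewrite mul0mx -mulmxA mul_adj_mx mul_mx_scalar.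
move/eqP; rewrite scaler_eq0 => /orP[/eqP d0|/eqP //].
by move: uM; rewrite unitmxE d0 unitr0.
Qed.

(** Unless every element of [S] is scalar on [W], the space [W] is cut down to an eigenspace of a
    non-scalar one; commutation keeps this stable. *)
Lemma common_eigenvector_in (k : closedFieldType) r (S : set 'M[k]_r) (W : 'M[k]_r) :
  (forall X Y, S X -> S Y -> X *m Y = Y *m X) -> W != 0 ->
  (forall X, S X -> (W *m X <= W)%MS) ->
  exists v : 'rV_r, [/\ v != 0, (v <= W)%MS & forall X, S X -> exists c, v *m X = c *: v].
Proof.
move=> Scomm; have [d] := ubnP (\rank W); elim: d W => // d IHd W rW W0 Wst.
have [scal|] := pselect (forall X, S X -> exists c, W *m X = c *: W).
  exists (nz_row W); split=> [||X /scal[c WX]]; rewrite ?nz_row_eq0 ?nz_row_sub //.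
  exists c; have /submxP[u ->] := nz_row_sub W.
  by rewrite -mulmxA WX scalemxAr.
move=> /existsNP[X /not_implyP[SX /forallNP nscal]].
pose V := row_base W; pose X' := V *m X *m pinvmx V.
have VX : X' *m V = V *m X.
  rewrite mulmxKpV // (submx_trans (_ : _ <= W)%MS) ?eq_row_base //.
  by rewrite (eqmxMr X (eq_row_base W)) Wst.
have rW0 : (0 < \rank W)%N by rewrite lt0n mxrank_eq0.
have /closed_rootP[c] : size (char_poly X') != 1%N.
  by rewrite size_char_poly eqSS -lt0n.
rewrite -eigenvalue_root_char => /eigenvalueP[u uX u0].
pose W' := (W :&: eigenspace X c)%MS.
have uV0 : u *m V != 0.
  apply: contraNneq u0 => uV; rewrite -[u]mulmx1 -(mulmxVp (row_base_free W)).
  by rewrite mulmxA uV mul0mx.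
have uVW' : (u *m V <= W')%MS.
  rewrite sub_capmx (submx_trans (submxMl _ _)) ?eq_row_base //.
  by apply/eigenspaceP; rewrite -mulmxA -VX mulmxA uX scalemxAl.
have [|||v [v0 vW' Hv]] := IHd W'.
- rewrite -ltnS (leq_trans _ rW) // ltnS; apply: rank_ltmx.
  rewrite ltmxE capmxSl /=; apply: contraPN SX => sWW' _.
  apply: (nscal c); apply/eigenspaceP.
  by rewrite (submx_trans sWW') ?capmxSr.
- by apply: contraNneq uV0 => W'0; move: uVW'; rewrite W'0 submx0.
- move=> Y SY; rewrite sub_capmx.
  rewrite (submx_trans _ (Wst Y SY)) ?submxMr ?capmxSl //=.
  rewrite (submx_trans (submxMr _ (capmxSr _ _))) //.
  by apply: comm_mx_stable_eigenspace; apply: Scomm.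
by exists v; split=> //; apply: submx_trans vW' (capmxSl _ _).
Qed.

Section SeparatedFunctions.
Variables (k : fieldType) (N : nat).
Implicit Types (F : 'M[k]_N -> k).

(* M |-> F (a M) lies in a finite-dimensional space independent of a. *)
Definition translation_finite F : Prop :=
  exists (I : finType) (s r : I -> 'M[k]_N -> k),
    forall a x, F (a *m x) = \sum_i s i a * r i x.

Lemma translation_finite_ext F F' : F =1 F' ->
  translation_finite F -> translation_finite F'.
Proof. by move=> FF' [I [s [r H]]]; exists I, s, r => a x; rewrite -FF' H. Qed.

Lemma translation_finite_cst c : translation_finite (fun=> c).
Proof.
exists unit, (fun _ _ => c), (fun _ _ => 1) => a x.
by rewrite (big_pred1 tt) ?mulr1 // => -[].
Qed.

Lemma translation_finite_coord i j : translation_finite (fun M => M i j).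
Proof. by exists 'I_N, (fun l a => a i l), (fun l x => x l j) => a x; rewrite mxE. Qed.

Lemma translation_finite_add F F' : translation_finite F -> translation_finite F' ->
  translation_finite (fun M => F M + F' M).
Proof.
move=> [I [s [r H]]] [I' [s' [r' H']]].
exists (I + I')%type, (fun i => match i with inl i => s i | inr i => s' i end),
  (fun i => match i with inl i => r i | inr i => r' i end) => a x.
by rewrite H H' big_sumType.
Qed.

Lemma translation_finite_mul F F' : translation_finite F -> translation_finite F' ->
  translation_finite (fun M => F M * F' M).
Proof.
move=> [I [s [r H]]] [I' [s' [r' H']]].
exists (I * I')%type, (fun i a => s i.1 a * s' i.2 a), (fun i x => r i.1 x * r' i.2 x).
move=> a x; rewrite H H' big_distrlr /= pair_big /=.
by apply: eq_bigr => -[i i'] _ /=; rewrite mulrACA.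
Qed.

Lemma translation_finite_sum (J : Type) (t : seq J) (P : pred J) (F : J -> 'M[k]_N -> k) :
  (forall j, translation_finite (F j)) ->
  translation_finite (fun M => \sum_(j <- t | P j) F j M).
Proof.
move=> HF; elim: t => [|j t IHt].
  by apply: translation_finite_ext (translation_finite_cst 0) => M; rewrite big_nil.
case: (boolP (P j)) => Pj.
  by apply: translation_finite_ext (translation_finite_add (HF j) IHt) => M; rewrite big_cons Pj.
by apply: translation_finite_ext IHt => M; rewrite big_cons (negPf Pj).
Qed.

Lemma translation_finite_prod (J : Type) (t : seq J) (P : pred J) (F : J -> 'M[k]_N -> k) :
  (forall j, translation_finite (F j)) ->
  translation_finite (fun M => \prod_(j <- t | P j) F j M).
Proof.
move=> HF; elim: t => [|j t IHt].
  by apply: translation_finite_ext (translation_finite_cst 1) => M; rewrite big_nil.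
case: (boolP (P j)) => Pj.
  by apply: translation_finite_ext (translation_finite_mul (HF j) IHt) => M; rewrite big_cons Pj.
by apply: translation_finite_ext IHt => M; rewrite big_cons (negPf Pj).
Qed.

Lemma translation_finite_det n (f : 'M[k]_N -> 'M[k]_n) :
  (forall i j, translation_finite (fun M => f M i j)) ->
  translation_finite (fun M => \det (f M)).
Proof.
move=> Hf; rewrite /determinant; apply: translation_finite_sum => s.
apply: translation_finite_mul; first exact: translation_finite_cst.
exact: translation_finite_prod.
Qed.

Lemma translation_finite_poly p : translation_finite (fun M => mx_eval (idfun : k -> k) M p).
Proof.
apply: (@translation_finite_ext
  (fun M => \sum_(m <- msupp p) p@_m * \prod_i (mxvec M 0 i) ^+ m i)) => // .
apply: translation_finite_sum => m.
apply: translation_finite_mul; first exact: translation_finite_cst.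
apply: translation_finite_prod => i; have [i' j'] := mxvec_indexP i.
apply: (@translation_finite_ext (fun M => \prod_(l < m (mxvec_index i' j')) M i' j')).
  by move=> M; rewrite prodr_const card_ord mxvecE.
by apply: translation_finite_prod => _; apply: translation_finite_coord.
Qed.

Lemma translation_finite_mulmx F a b : translation_finite F ->
  translation_finite (fun M => F (a *m M *m b)).
Proof.
move=> [I [s [r H]]]; exists I, (fun i c => s i (a *m c)), (fun i x => r i (x *m b)).
by move=> c x; rewrite !mulmxA -H !mulmxA.
Qed.

End SeparatedFunctions.

(** * Semi-invariants of the identity component of the kernel *)

Section SemiInvariant.
Variables (k : numClosedFieldType) (N : nat) (A C : set 'M[k]_N).
Hypotheses (gA : mx_group A) (gC : mx_group C) (CA : C `<=` A) (cC : uclosed C).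

Notation ev := (mx_eval (idfun : k -> k)).

(* A basis of the evaluations at points of C on the translates of an equation q
   of C gives a determinant on which C acts by a character kappa. *)
Lemma semi_invariant b0 : A b0 -> ~ C b0 -> exists (Psi kappa : 'M[k]_N -> k),
  [/\ [/\ translation_finite Psi, Psi 1%:M = 0 & Psi b0 != 0],
      forall f : 'M[k]_N -> 'M_N, regular_mx f -> regular (fun M => Psi (f M)),
      forall f : 'M[k]_N -> 'M_N, regular_mx f -> regular (fun M => kappa (f M)) &
      forall a b, A a -> C b -> Psi (a *m b) = Psi a * kappa b].
Proof.
move=> Ab0 nCb0; have [Au A1 AM AV] := gA; have [Cu C1 CM CV] := gC.
have ub0 := Au _ Ab0.
have [q qC qb0] : exists2 q, forall x, C x -> ev x q = 0 & ev b0 q != 0.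
  have [S SE] := cC; have : ~ forall p, S p -> ev b0 p = 0.
    by move=> H; apply: nCb0; rewrite SE.
  move=> /existsNP[q /not_implyP[Sq /eqP qb0]]; exists q => // x.
  by rewrite SE => -[_]; apply.
have [I [s [r qE]]] := translation_finite_poly q.
(* On [C], every function x -> q(a x) with a in [A] is determined by its values at the points
   [b j]. *)
have [w [a [b [Aa Cb]]]] := @max_minor k _ A C (fun a x => ev (a *m x) q) I s r
  (fun a x _ _ => qE a x).
set tau := \matrix_(i, j) _ => utau Kexp.
pose Th (al : 'I_w -> 'M[k]_N) x := \matrix_(i, j) ev (al i *m x *m b j) q.
(* For y in [C], [c y] is right translation by y written on the evaluations at the [b j]; its
   determinant is [kappa y]. *)
pose c x := invmx tau *m Th a x.
have ThM al x y : (forall i, A (al i)) -> A x -> C y ->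
    Th al (x *m y) = Th al x *m c y.
  move=> Aal Ax Cy; apply/matrixP => i j; rewrite /c mulmxA !mxE.
  have := Kexp (al i *m x) (y *m b j) (AM _ _ (Aal i) Ax) (CM _ _ Cy (Cb j)).
  rewrite !mulmxA mxE => ->; apply: eq_bigr => l _; rewrite !mxE !mulmxA; congr (_ * _).
  by apply: eq_bigr => l' _; rewrite !mxE.
pose v : 'rV_w := \row_j ev (b0 *m b j) q.
have v0 : v != 0.
  apply: contraNneq qb0 => v0.
  have := Kexp b0 1%:M Ab0 C1; rewrite mulmx1 => ->.
  by rewrite -/v v0 !mul0mx mxE.
have [i0 Hi0] := det_replace_row utau v0.
(* Row [i0] of [Th al x] consists of the q(x b_j): it vanishes at x = 1, because [q] vanishes on
   [C], and equals [v] at x = [b0], where the other rows are those of [tau]. *)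
pose al i := if i == i0 then 1%:M else a i *m invmx b0.
have Aal i : A (al i).
  by rewrite /al; case: eqP => // _; apply: (AM) => //; apply: AV.
exists (fun x => \det (Th al x)), (fun x => \det (c x)).
have rTh al' (f : 'M[k]_N -> 'M_N) : regular_mx f -> regular_mx (fun M => Th al' (f M)).
  move=> rf i j.
  have H : regular (fun M => ev (al' i *m f M *m b j) q).
    apply: (regular_comp_poly q (f := fun M => al' i *m f M *m b j)).
    by do 2?apply: regular_mulmx => //; apply: regular_mx_cst.
  by apply: regular_ext H => M _; rewrite mxE.
split.
- split.
  + apply: translation_finite_det => i j.
    apply: translation_finite_ext (translation_finite_mulmx (al i) (b j)
      (translation_finite_poly q)) => M.
    by rewrite mxE.
  + rewrite (expand_det_row _ i0) big1 // => j _.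
    by rewrite mxE /al eqxx !mul1mx qC ?mul0r.
  + suff -> : Th al b0 = \matrix_(i, j) if i == i0 then v 0 j else tau i j by [].
    apply/matrixP => i j; rewrite !mxE /al.
    by case: eqP => _; rewrite ?mul1mx // mulmxKV.
- by move=> f rf; apply: regular_det; apply: rTh.
- move=> f rf; apply: regular_det; apply: regular_mulmx; last exact: rTh.
  exact: regular_mx_cst.
- by move=> x y Ax Cy; rewrite ThM // det_mulmx.
Qed.

Hypothesis connA : zariski_connected A.
Hypothesis commC : forall a y, A a -> A y -> C (invmx a *m invmx y *m a *m y).

(** [A] acts by [rho] on coordinates of the translates of [Psi], commutatively and with [C] acting
    by scalars. Ratios of eigencharacters are therefore trivial on [C]. Two of them differ at [b0],
    because [rho b0] is not scalar although its e-th power is. *)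
Lemma separating_character b0 e : A b0 -> ~ C b0 -> (0 < e)%N -> C (mxpow b0 e) ->
  exists f, [/\ regular f, forall x y, A x -> A y -> f (x *m y) = f x * f y,
    forall x, A x -> f x != 0, forall x, C x -> f x = 1 & f b0 != 1].
Proof.
move=> Ab0 nCb0 e_gt0 Ce; have [Au A1 AM AV] := gA; have [Cu C1 CM CV] := gC.
have [Psi [kappa [[tfPsi Psi1 Psib0] rPsi rkappa PsiM]]] := semi_invariant Ab0 nCb0.
have [I [s [r PsiE]]] := tfPsi.
have [w [h [x [Ah Ax]]]] := @max_minor k _ A A (fun a x => Psi (a *m x)) I s r
  (fun a x _ _ => PsiE a x).
set tau := \matrix_(i, j) _ => utau Kexp.
pose t y : 'cV_w := \col_i Psi (h i *m y).
pose L y : 'M_w := \matrix_(i, j) Psi (h i *m y *m x j).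
pose rho y := L y *m invmx tau.
have rho_t a y : A a -> A y -> t (a *m y) = rho a *m t y.
  move=> Aa Ay; apply/colP => i; rewrite !mxE mulmxA.
  rewrite (Kexp _ _ (AM _ _ (Ah i) Aa) Ay) mxE; apply: eq_bigr => j _.
  rewrite !mxE; congr (_ * _).
  by apply: eq_bigr => l _; rewrite !mxE.
have LM a y : A a -> A y -> L (a *m y) = rho a *m L y.
  move=> Aa Ay; apply/matrixP => i j.
  have := congr1 (fun v : 'cV_w => v i 0) (rho_t a (y *m x j) Aa (AM _ _ Ay (Ax j))).
  rewrite !mxE !mulmxA => ->; apply: eq_bigr => l _.
  by rewrite !mxE !mulmxA.
have L1 : L 1%:M = tau.
  by apply/matrixP => i j; rewrite !mxE mulmx1.
have rho1 : rho 1%:M = 1%:M by rewrite /rho L1 mulmxV.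
have rhoM a y : A a -> A y -> rho (a *m y) = rho a *m rho y.
  by move=> Aa Ay; rewrite {1}/rho LM // -mulmxA.
have urho a : A a -> rho a \in unitmx.
  move=> Aa; have /mulmx1_unit[] // : rho a *m rho (invmx a) = 1%:M.
  by rewrite -rhoM ?mulmxV ?rho1 //; [apply: Au|apply: AV].
have tC y b : A y -> C b -> t (y *m b) = kappa b *: t y.
  move=> Ay Cb; apply/colP => i; rewrite !mxE mulmxA PsiM // 1?mulrC //.
  exact: AM.
pose l := (\row_j Psi (1%:M *m x j)) *m invmx tau.
have Psil y : A y -> Psi y = (l *m t y) 0 0.
  by move=> Ay; rewrite -[y in LHS]mul1mx Kexp.
have t0 y : A y -> t y != 0.
  move=> Ay; apply: contraNneq Psib0 => ty0.
  have uy := Au _ Ay.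
  rewrite Psil // -[b0](mulmxKV uy) rho_t //; last by apply: (AM) => //; apply: AV.
  by rewrite ty0 !mulmx0 mxE.
have w_gt0 : (0 < w)%N.
  case: posnP => // w0; have := t0 _ A1; case/eqP; apply/colP => i.
  by exfalso; case: i => i; rewrite w0.
have kappa1 : kappa 1%:M = 1.
  have := PsiM b0 _ Ab0 C1; rewrite mulmx1 => /eqP.
  by rewrite -{1}[Psi b0]mulr1 (inj_eq (mulfI Psib0)) => /eqP.
(* [t y] is an eigenvector of [rho b] with eigenvalue kappa(y^-1 b y), which is constant in y on the
   connected group [A]. The vectors t(x_j) are the columns of the invertible [tau]. *)
have rhoC b : C b -> rho b = (kappa b)%:M.
  move=> Cb; have Ab := CA Cb.
  have [rs rsE] := closed_field_poly_normal (char_poly (rho b)^T).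
  have rho_ty y : A y -> rho b *m t y = kappa (invmx y *m b *m y) *: t y.
    move=> Ay; have uy := Au _ Ay.
    have CbJ : C (invmx y *m b *m y).
      have := CM _ _ Cb (commC Ab Ay); rewrite !mulmxA mulmxV ?mul1mx //.
      exact: Cu.
    by rewrite -rho_t // -tC // !mulmxA mulmxV // mul1mx.
  have cst y : A y -> kappa (invmx y *m b *m y) = kappa b.
    move=> Ay; rewrite -[in RHS](mulmx1 b) -[in RHS](mul1mx (b *m _)) -{1}invmx1 mulmxA.
    apply: (@connected_cst _ _ A (fun y => kappa (invmx y *m b *m y)) rs) => //.
      apply: rkappa; apply: regular_mulmx; last exact: regular_mx_id.
      by apply: regular_mulmx; [exact: regular_invmx|exact: regular_mx_cst].
    move=> z Az; have : root (char_poly (rho b)^T) (kappa (invmx z *m b *m z)).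
      rewrite -eigenvalue_root_char; apply/eigenvalueP; exists (t z)^T.
        by rewrite -trmx_mul rho_ty // linearZ.
      by rewrite trmx_eq0 t0.
    rewrite rsE rootZ ?root_prod_XsubC // lead_coef_eq0 monic_neq0 //.
    exact: char_poly_monic.
  have : rho b *m tau = (kappa b)%:M *m tau.
    apply/matrixP => i j.
    have := congr1 (fun v : 'cV_w => v i 0) (rho_ty _ (Ax j)).
    rewrite cst // mul_scalar_mx !mxE => <-.
    by apply: eq_bigr => l' _; rewrite !mxE.
  by move/(congr1 (mulmx^~ (invmx tau))); rewrite !mulmxK.
(* The commutator of [a] and z lies in [C], so it acts by a scalar. Taking determinants makes this
   scalar a w-th root of unity; by connectedness it has the same value as at z = 1. *)
have rho_comm a y : A a -> A y -> rho a *m rho y = rho y *m rho a.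
  move=> Aa Ay.
  have key z : A z -> rho a *m rho z =
      kappa (invmx a *m invmx z *m a *m z) *: (rho z *m rho a).
    move=> Az; have Cc := commC Aa Az.
    have ua := Au _ Aa; have uz := Au _ Az.
    rewrite -!rhoM // -mul_mx_scalar -rhoC // -rhoM; [|exact: AM|exact: CA].
    by congr (rho _); rewrite !mulmxA mulmxK // mulmxV // mul1mx.
  suff -> : rho a *m rho y = kappa (invmx a *m invmx 1%:M *m a *m 1%:M) *: (rho y *m rho a).
    by rewrite invmx1 !mulmx1 mulVmx ?kappa1 ?scale1r //; apply: Au.
  rewrite key //; congr (_ *: _).
  have [rs rsE] := closed_field_poly_normal ('X^w - 1 : {poly k}).
  apply: (@connected_cst _ _ A (fun z => kappa (invmx a *m invmx z *m a *m z)) rs) => //.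
    apply: rkappa; apply: regular_mulmx; last exact: regular_mx_id.
    apply: regular_mulmx; last exact: regular_mx_cst.
    by apply: regular_mulmx; [exact: regular_mx_cst|exact: regular_invmx].
  move=> z Az; have /(congr1 (fun M => \det M)) := key z Az.
  rewrite detZ (det_mulmx (rho a)) (det_mulmx (rho z)) (mulrC (\det (rho z))) => /eqP.
  have d0 : \det (rho a) * \det (rho z) != 0.
    by rewrite mulf_neq0 // -unitfE -unitmxE urho.
  rewrite -{1}[_ * _]mul1r (inj_eq (mulIf d0)) eq_sym => /eqP kw.
  have : root ('X^w - 1 : {poly k}) (kappa (invmx a *m invmx z *m a *m z)).
    by rewrite rootE !hornerE kw subrr.
  rewrite rsE rootZ ?root_prod_XsubC //.
  by rewrite lead_coef_eq0 -size_poly_gt0 size_XnsubC.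
pose S : set 'M_w := [set rho y | y in A].
have Scomm X Y : S X -> S Y -> X *m Y = Y *m X.
  by move=> [a Aa <-] [y Ay <-]; apply: rho_comm.
have charv (v : 'rV_w) : v != 0 -> (forall X, S X -> exists c, v *m X = c *: v) ->
  exists2 chi, forall y, A y -> v *m rho y = chi y *: v &
    forall f : 'M[k]_N -> 'M_N, regular_mx f -> regular (fun M => chi (f M)).
  move=> v0 Hv; have [i vi0] : exists i, v 0 i != 0.
    apply: contrapT => /forallNP vi; case/eqP: v0; apply/rowP => i; rewrite mxE.
    by apply/eqP/negPn/negP/vi.
  exists (fun y => (v *m rho y) 0 i / v 0 i) => [y Ay|f rf].
    have [c vc] := Hv _ (ex_intro2 _ _ y Ay erefl).
    by rewrite vc mxE mulfK.
  apply: regular_mul; last exact: regular_cst.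
  apply: (regular_mulmx (f := fun=> v)); first exact: regular_mx_cst.
  apply: regular_mulmx; last exact: regular_mx_cst.
  move=> i' j'.
  have H : regular (fun M => Psi (h i' *m f M *m x j')).
    apply: (rPsi (fun M => h i' *m f M *m x j')).
    by do 2?apply: regular_mulmx => //; apply: regular_mx_cst.
  by apply: regular_ext H => M _; rewrite mxE.
have [||v1 [v10 _ Hv1]] := common_eigenvector_in (W := 1%:M) Scomm.
- by rewrite -mxrank_eq0 mxrank1 -lt0n.
- by move=> X _; rewrite submx1.
have [chi1 chi1P rchi1] := charv v1 v10 Hv1.
(* [W] is nonzero: a scalar [rho b0] would make [Psi b0] a multiple of Psi(1) = 0. Its row space is
   stable because [rho] is commutative. *)
pose la := chi1 b0; pose W := rho b0 - la%:M.
have [||v2 [v20 v2W Hv2]] := common_eigenvector_in (W := W) Scomm.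
- rewrite subr_eq0; apply: contraNneq Psib0 => rhob0.
  rewrite Psil // -[b0]mulmx1 rho_t // rhob0 mul_scalar_mx -scalemxAr mxE.
  by rewrite -Psil // Psi1 mulr0.
- move=> X SX; have -> : W *m X = X *m W.
    rewrite mulmxBl mulmxBr scalar_mxC; congr (_ - _).
    by apply: Scomm => //; exists b0.
  exact: submxMl.
have [chi2 chi2P rchi2] := charv v2 v20 Hv2.
have chiM (v : 'rV[k]_w) chi : v != 0 -> (forall y, A y -> v *m rho y = chi y *: v) ->
    forall y z, A y -> A z -> chi (y *m z) = chi y * chi z.
  move=> v0 Hv y z Ay Az; apply/eqP; rewrite -subr_eq0.
  have : (chi (y *m z) - chi y * chi z) *: v == 0.
    rewrite scalerBl -(Hv _ (AM _ _ Ay Az)) rhoM //.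
    by rewrite mulmxA Hv // -scalemxAl Hv // scalerA subrr.
  by rewrite scaler_eq0 (negPf v0) orbF.
have chi1' (v : 'rV[k]_w) chi : v != 0 -> (forall y, A y -> v *m rho y = chi y *: v) ->
    forall b, C b -> chi b = kappa b.
  move=> v0 Hv b Cb; apply/eqP; rewrite -subr_eq0.
  have : (chi b - kappa b) *: v == 0.
    by rewrite scalerBl -(Hv _ (CA Cb)) rhoC // mul_mx_scalar subrr.
  by rewrite scaler_eq0 (negPf v0) orbF.
have chiV (v : 'rV[k]_w) chi : v != 0 -> (forall y, A y -> v *m rho y = chi y *: v) ->
    forall y, A y -> chi y * chi (invmx y) = 1.
  move=> v0 Hv y Ay; rewrite -(chiM v) //; last exact: AV.
  by rewrite mulmxV ?(chi1' v chi v0 Hv _ C1) //; apply: Au.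
have la0 : la != 0.
  apply/eqP => la0; have /eqP := chiV _ _ v10 chi1P _ Ab0.
  by rewrite -/la la0 mul0r eq_sym oner_eq0.
(* Otherwise [rho b0] has a Jordan block on [u] and [v2], whose e-th power has the off-diagonal
   entry e la^(e-1), nonzero in characteristic 0; but b0^e lies in [C] and acts by a scalar. *)
have chi2b0 : chi2 b0 != la.
  apply/eqP => chi2b0.
  have [u uE] := submxP v2W.
  have Apow j : A (mxpow b0 j) by apply: mx_group_pow.
  have v2pow j : v2 *m rho (mxpow b0 j) = la ^+ j *: v2.
    elim: j => [|j IHj]; first by rewrite rho1 mulmx1 scale1r.
    rewrite mxpowS rhoM // mulmxA chi2P // chi2b0.
    by rewrite -scalemxAl IHj scalerA exprS.
  have upow j : u *m rho (mxpow b0 j) = la ^+ j *: u + (j%:R * la ^+ j.-1) *: v2.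
    elim: j => [|j IHj]; first by rewrite rho1 mulmx1 scale1r mul0r scale0r addr0.
    rewrite mxpowS rhoM // mulmxA.
    have -> : u *m rho b0 = la *: u + v2.
      by rewrite uE /W mulmxBr mul_mx_scalar addrC subrK.
    rewrite mulmxDl -scalemxAl IHj v2pow scalerDr !scalerA -exprS -addrA -scalerDl.
    congr (_ + _ *: _); rewrite -natr1 mulrDl mul1r; congr (_ + _).
    by case: (j) => [|j']; rewrite ?mul0r ?mulr0 // mulrCA -exprS.
  have kla : kappa (mxpow b0 e) = la ^+ e.
    apply/eqP; rewrite -subr_eq0.
    have : (kappa (mxpow b0 e) - la ^+ e) *: v2 == 0.
      by rewrite scalerBl -v2pow rhoC // mul_mx_scalar subrr.
    by rewrite scaler_eq0 (negPf v20) orbF.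
  have /eqP := upow e; rewrite rhoC // mul_mx_scalar kla -subr_eq0 opprD addrA subrr.
  rewrite sub0r oppr_eq0 scaler_eq0 (negPf v20) orbF mulf_eq0 expf_eq0 (negPf la0).
  by rewrite andbF orbF pnatr_eq0 eqn0Ngt e_gt0.
have fM1 y : A y -> chi1 y * chi2 (invmx y) != 0.
  move=> Ay; rewrite mulf_neq0 //; apply/eqP => H0.
    by have /eqP := chiV _ _ v10 chi1P _ Ay; rewrite H0 mul0r eq_sym oner_eq0.
  by have /eqP := chiV _ _ v20 chi2P _ Ay; rewrite H0 mulr0 eq_sym oner_eq0.
exists (fun y => chi1 y * chi2 (invmx y)); split=> // [|y z Ay Az|b Cb|].
- apply: regular_mul; first by apply: (rchi1 id); apply: regular_mx_id.
  by apply: rchi2; apply: regular_invmx.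
- rewrite invmxM; [|exact: Au|exact: Au].
  rewrite (chiM _ _ v10 chi1P) // (chiM _ _ v20 chi2P); [|exact: AV|exact: AV].
  by rewrite [chi2 _ * chi2 _]mulrC mulrACA.
- rewrite (chi1' _ _ v10 chi1P) // -(chi1' _ _ v20 chi2P) //.
  by apply: (chiV _ _ v20 chi2P); apply: CA.
- apply: contraNneq chi2b0 => H; rewrite -/la in H.
  by rewrite -[chi2 b0]mul1r -H -mulrA [chi2 _ * _]mulrC (chiV _ _ v20 chi2P) // mulr1.
Qed.

End SemiInvariant.

(** * Multiplicative dependence of characters *)

(** Comparing the relation at [op y x] with [chi i0 y] times the relation at [x] kills the
    coefficient of [i0], and induction on the support applies. *)
Lemma dedekind_independence (k : fieldType) (T : Type) (A : set T) (op : T -> T -> T) (e : T)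
    (I : finType) (chi : I -> T -> k) (c : I -> k) :
  A e -> (forall i, chi i e = 1) -> (forall x y, A x -> A y -> A (op x y)) ->
  (forall i x y, A x -> A y -> chi i (op x y) = chi i x * chi i y) ->
  (forall i j, i != j -> exists2 x, A x & chi i x != chi j x) ->
  (forall x, A x -> \sum_i c i * chi i x = 0) -> forall i, c i = 0.
Proof.
move=> Ae chi1 AM chiM chi_neq.
have [d] := ubnP #|[pred i | c i != 0]|.
elim: d c => // d IHd c sup_c Hc i0; apply/eqP; apply: contraT => ci0.
have c_only i : i != i0 -> c i = 0.
  move=> ii0; have [y Ay chiy] := chi_neq _ _ ii0.
  pose c' i := c i * (chi i y - chi i0 y).
  have /eqP : c' i = 0.
    apply: IHd => [|x Ax].
      rewrite -ltnS (leq_trans _ sup_c) // ltnS; apply: proper_card.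
      apply/properP; split; last by exists i0; rewrite !inE ?ci0 // /c' subrr mulr0 eqxx.
      by apply/fintype.subsetP => j; rewrite !inE; apply: contraNneq => cj; rewrite /c' cj mul0r.
    suff -> : \sum_j c' j * chi j x =
        \sum_j c j * chi j (op y x) - chi i0 y * \sum_j c j * chi j x.
      by rewrite (Hc _ (AM _ _ Ay Ax)) (Hc _ Ax) mulr0 subrr.
    rewrite mulr_sumr -sumrB; apply: eq_bigr => j _.
    by rewrite /c' chiM //; ring.
  by rewrite /c' mulf_eq0 subr_eq0 (negPf chiy) orbF => /eqP.
have := Hc _ Ae; rewrite (bigD1 i0) //= big1 ?addr0 => [|i ii0].
  by rewrite chi1 mulr1 => /eqP; rewrite (negPf ci0).
by rewrite c_only // mul0r.
Qed.

Lemma mmap_map_mpoly (R S U : comNzRingType) n (g : {rmorphism R -> S})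
    (h : {rmorphism S -> U}) (hg : {rmorphism R -> U}) (y : 'I_n -> U) p :
  (forall a, h (g a) = hg a) -> mmap h y (map_mpoly g p) = mmap hg y p.
Proof.
move=> hgE; elim/mpolyind: p => [|c m p _ _ IHp]; first by rewrite !rmorph0.
by rewrite !rmorphD /= IHp map_mpolyZ map_mpolyX !mmapZ !mmapX hgE.
Qed.

Lemma mmap_id (R : comNzRingType) n (p : {mpoly R[n]}) :
  mmap (@mpolyC n R) (fun i => 'X_i) p = p.
Proof.
elim/mpolyind: p => [|c m p _ _ IHp]; first by rewrite rmorph0.
by rewrite rmorphD /= IHp mmapZ mmapX mul_mpolyC /mmap1 -mpolyXE_id.
Qed.

Section GLcoordinates.
Variables (k : fieldType) (N : nat).
Notation R := {mpoly k[(N * N).+1]}.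

(* GL_N as a closed subset of the affine space of dimension N^2 + 1. *)
Definition GLpoint (M : 'M[k]_N) : 'I_(N * N).+1 -> k :=
  extend_point (fun i => mxvec M 0 i) (\det M)^-1.

(** This represents p / det^D: the last variable stands for the inverse of the determinant. *)
Definition GLlift (p : {mpoly k[N * N]}) D : R := mpoly_of_poly (p *: 'X^D).

Lemma GLliftE M p D :
  mmap (idfun : k -> k) (GLpoint M) (GLlift p D) =
  mx_eval (idfun : k -> k) M p * (\det M)^-1 ^+ D.
Proof.
rewrite mmap_mpoly_of_poly /GLpoint extend_point_max extend_point_widen.
by rewrite map_polyZ map_polyXn hornerZ hornerXn.
Qed.

Lemma regular_GLlift F : regular F -> exists P : R, forall M : 'M[k]_N, M \in unitmx ->
  mmap (idfun : k -> k) (GLpoint M) P = F M.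
Proof.
move=> [p [D H]]; exists (GLlift p D) => M uM.
rewrite GLliftE H // exprVn mulfK // expf_neq0 //.
by rewrite -unitfE -unitmxE.
Qed.

Lemma GLpoint_surj (y : 'I_(N * N).+1 -> k) :
  mmap (idfun : k -> k) y (GLlift (\det (generic_mx k N)) 1 - 1) = 0 ->
  exists2 M, M \in unitmx & y = GLpoint M.
Proof.
pose M : 'M[k]_N := vec_mx (\row_i y (widen_ord (leqnSn _) i)).
have yM : y \o widen_ord (leqnSn _) = fun i => mxvec M 0 i.
  by apply/funext => i /=; rewrite vec_mxK mxE.
rewrite rmorphB rmorph1 /= /GLlift mmap_mpoly_of_poly yM map_polyZ map_polyXn hornerZ.
rewrite hornerXn expr1 /= => /eqP.
rewrite (_ : mmap _ _ _ = \det M); last exact: (mx_eval_det idfun M).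
rewrite subr_eq0 => /eqP dM.
have d0 : \det M != 0 by apply: contra_eq_neq dM => ->; rewrite mul0r eq_sym oner_neq0.
have uM : M \in unitmx by rewrite unitmxE unitfE.
exists M => //; apply/funext => i; rewrite /GLpoint /extend_point.
case: unliftP => [j ->|->].
  rewrite vec_mxK mxE; congr y; apply: val_inj; rewrite /= /bump leqNgt ltn_ord //.
by rewrite -[RHS]mulr1 -dM mulKf.
Qed.

End GLcoordinates.

Section PowerRelation.
Variables (k : numClosedFieldType) (N : nat) (A : set 'M[k]_N) (nu f : 'M[k]_N -> k).
Hypotheses (cA : uclosed A) (gA : mx_group A) (rnu : regular nu) (rf : regular f).
Hypothesis nuM : forall x y, A x -> A y -> nu (x *m y) = nu x * nu y.
Hypothesis fM : forall x y, A x -> A y -> f (x *m y) = f x * f y.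
Hypothesis f0 : forall x, A x -> f x != 0.
Hypothesis nu_surj : forall c : k, c != 0 -> exists2 x, A x & nu x = c.
Hypothesis f_nu : forall x y, A x -> A y -> nu x = nu y -> f x = f y.

Notation R := {mpoly k[(N * N).+1]}.
Notation E M := (mmap (idfun : k -> k) (GLpoint M)).

(* If f and nu were multiplicatively independent on A, all monomials in them
   would be distinct, hence linearly independent, characters; then f and nu are
   algebraically independent on A and take an arbitrary generic pair of values
   on it, although the value of nu determines that of f. *)
Lemma power_relation : exists a b c, (0 < a)%N /\
  forall x, A x -> f x ^+ a * nu x ^+ b = nu x ^+ c.
Proof.
have [Au A1 AM AV] := gA.
have nu0 x : A x -> nu x != 0.
  move=> Ax; have [y Ay nuy] := nu_surj (oner_neq0 k).
  have : nu (x *m (invmx x *m y)) = 1 by rewrite mulKVmx // Au.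
  rewrite nuM //; last by apply: (AM) => //; apply: AV.
  by move=> H; apply: contra_eq_neq H => ->; rewrite mul0r eq_sym oner_neq0.
have nu1 : nu 1%:M = 1.
  by have := nuM A1 A1; rewrite mulmx1 => /esym/(canRL (mulfK (nu0 _ A1))); rewrite divff ?nu0.
have f1 : f 1%:M = 1.
  by have := fM A1 A1; rewrite mulmx1 => /esym/(canRL (mulfK (f0 A1))); rewrite divff ?f0.
apply: contrapT => norel.
have mono_neq i j i' j' : (i, j) != (i', j') ->
    exists2 x, A x & f x ^+ i * nu x ^+ j != f x ^+ i' * nu x ^+ j'.
  wlog le_ii' : i j i' j' / (i' <= i)%N => [gen|neq].
    case/orP: (leq_total i' i) => [/gen|lei neq]; first exact.
    have [|x Ax xneq] := gen i' j' i j lei; first by rewrite eq_sym.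
    by exists x; rewrite // eq_sym.
  apply: contrapT => noneq; apply: norel.
  have eqx x : A x -> f x ^+ i * nu x ^+ j = f x ^+ i' * nu x ^+ j'.
    by move=> Ax; apply/eqP; apply: contrapT => /negP xneq; apply: noneq; exists x.
  have [ii'|neq_i] := eqVneq i i'.
    (* With equal exponents of [f], a point where [nu] is 2 separates the monomials, powers of 2
       being distinct in characteristic 0. *)
    have [|x Ax nux] := nu_surj (c := 2); first by rewrite pnatr_eq0.
    have := eqx x Ax; rewrite -ii' nux => /(mulfI (expf_neq0 _ (f0 Ax))).
    have inj2 : injective (fun j => 2 ^+ j : k).
      move=> d d' /eqP; rewrite -!natrX eqr_nat => /eqP/expnI-> //.
    by move/inj2 => jj'; move: neq; rewrite ii' jj' eqxx.
  exists (i - i')%N, j, j'; split; first by rewrite subn_gt0 ltn_neqAle eq_sym neq_i.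
  move=> x Ax; apply: (mulfI (expf_neq0 i' (f0 Ax))).
  by rewrite mulrA -exprD subnKC // eqx.
have [nuT nuTE] := regular_GLlift rnu; have [fT fTE] := regular_GLlift rf.
(* The outer variable goes to [f], the inner one to [nu]. *)
pose psi : {rmorphism {poly {poly k}} -> R} :=
  horner_eval fT \o map_poly (horner_eval nuT \o map_poly (@mpolyC (N * N).+1 k)).
have psiX : psi 'X = fT by rewrite /psi /= map_polyX horner_evalE hornerX.
have psiCX : psi 'X%:P = nuT.
  by rewrite /psi /= map_polyC horner_evalE hornerC /= map_polyX horner_evalE hornerX.
have psiE M (Q : {poly {poly k}}) : M \in unitmx -> E M (psi Q) =
    \sum_(i < size Q) (\sum_(j < size (Q`_i)%R) Q`_i`_j * nu M ^+ j) * f M ^+ i.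
  move=> uM; rewrite /psi /= horner_evalE horner_poly rmorph_sum.
  apply: eq_bigr => i _; rewrite rmorphM rmorphXn /= fTE //; congr (_ * _).
  rewrite horner_evalE horner_poly rmorph_sum.
  by apply: eq_bigr => j _; rewrite rmorphM rmorphXn /= nuTE // mmapC.
pose I : set R := [set P | forall M, A M -> E M P = 0].
have Iid : is_ideal I.
  split=> [M AM'|P Q IP IQ M AM'|a P IP M AM']; first by rewrite rmorph0.
    by rewrite rmorphD /= IP // IQ // addr0.
  by rewrite rmorphM /= IP // mulr0.
have psiI (Q : {poly {poly k}}) : I (psi Q) -> Q = 0.
  move=> IQ; pose d := (\max_(i < size Q) size (Q`_i)%R)%N.
  pose J := ('I_(size Q) * 'I_d)%type.
  pose chi (ij : J) x := f x ^+ ij.1 * nu x ^+ ij.2.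
  have coefs0 : forall ij : J, Q`_ij.1`_ij.2 = 0.
    apply: (@dedekind_independence k _ A mulmx 1%:M J chi (fun ij => Q`_ij.1`_ij.2)) => //.
    - by move=> ij; rewrite /chi f1 nu1 !expr1n mul1r.
    - by move=> ij x y Ax Ay; rewrite /chi fM // nuM // !exprMn mulrACA.
    - move=> [i j] [i' j'] neq; apply: mono_neq.
      by apply: contra_neq neq => -[/val_inj-> /val_inj->].
    move=> x Ax; transitivity (E x (psi Q)); last exact: IQ.
    rewrite psiE ?Au //.
    transitivity (\sum_(i < size Q) \sum_(j < d) Q`_i`_j * chi (i, j) x).
      by rewrite pair_bigA; apply: eq_bigr => -[].
    apply: eq_bigr => i _; rewrite mulr_suml.
    have sd : (size (Q`_i)%R <= d)%N by apply: (@leq_bigmax _ (fun i : 'I_(size Q) => size (Q`_i)%R)).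
    rewrite (big_ord_widen _ (fun j => Q`_i`_j * nu x ^+ j * f x ^+ i) sd) [RHS]big_mkcond /=.
    apply: eq_bigr => j _; case: ltnP => [_|sj].
      by rewrite /chi /= [f x ^+ _ * _]mulrC mulrA.
    by rewrite nth_default // mul0r.
  apply/polyP => i; rewrite coef0; have [sQ|iQ] := leqP (size Q) i.
    by rewrite nth_default.
  apply/polyP => j; rewrite coef0; have [sj|jQ] := leqP (size (Q`_i)%R) j.
    by rewrite nth_default.
  have jd : (j < d)%N.
    by apply: (leq_trans jQ); apply: (@leq_bigmax _ (fun i : 'I_(size Q) => size (Q`_i)%R) (Ordinal iQ)).
  exact: (coefs0 (Ordinal iQ, Ordinal jd)).
(* By the independence just shown, [S] misses the ideal [I] of [A]. A prime containing [I] and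
   missing [S] cuts out a locus on which [f] and [nu] stay algebraically independent. *)
pose S : set R := [set P | exists2 Q, Q != 0 & P = psi Q].
have [|||||P [Pprime IP PS]] := @prime_avoiding R I S.
- exact/mpoly_noetherian/field_noetherian.
- exact: Iid.
- by exists 1; rewrite ?oner_neq0 ?rmorph1.
- move=> _ _ [Q Q0 ->] [Q' Q'0 ->]; exists (Q * Q'); rewrite ?mulf_neq0 //.
  by rewrite rmorphM.
- by move=> P IP [Q Q0 QE]; move: IP; rewrite QE => /psiI Q00; rewrite Q00 eqxx in Q0.
pose theta : {rmorphism {mpoly {poly {poly k}}[(N * N).+1]} -> R} :=
  mmap psi (fun i => 'X_i).
have P'prime := prime_preimage theta Pprime.
have [|u nPu Hu] := extend_place P'prime (V := 1).
  by rewrite /preimage /= rmorph1; case: Pprime.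
have thetaC a : theta a%:MP = psi a by rewrite /theta /= mmapC.
have u0 : u != 0.
  by apply: contra_notN nPu => /eqP->; rewrite /preimage /= thetaC rmorph0; case: Pprime => -[].
(* The pair (n0, f0') is chosen off the zeros of [u], with n0 the value of [nu] at some [a0] and f0'
   different from [f a0]. A point of [A] over this pair contradicts [f_nu]. *)
have [n0 Hn0] : exists n0, ~~ root (lead_coef u * 'X) n0.
  by apply/closed_nonrootP; rewrite mulf_neq0 ?polyX_eq0 // lead_coef_eq0.
have {Hn0}[un0 n0_neq0] : (lead_coef u).[n0] != 0 /\ n0 != 0.
  by move: Hn0; rewrite rootE hornerM hornerX mulf_eq0 negb_or => /andP.
have [a0 Aa0 nua0] := nu_surj n0_neq0.
pose un : {poly k} := map_poly (horner_eval n0) u.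
have un_neq0 : un != 0 by rewrite -lead_coef_eq0 lead_coef_map_eq.
have [f0' Hf0] : exists f0', ~~ root (un * ('X - (f a0)%:P)) f0'.
  by apply/closed_nonrootP; rewrite mulf_neq0 ?polyXsubC_eq0.
have {Hf0}[unf0 f0_neq] : un.[f0'] != 0 /\ f0' != f a0.
  by move: Hf0; rewrite rootE hornerM mulf_eq0 negb_or hornerXsubC subr_eq0 => /andP.
pose h : {rmorphism {poly {poly k}} -> k} := horner_eval f0' \o map_poly (horner_eval n0).
have [||y [yP _]] := Hu k h.
- move=> a; rewrite /preimage /= thetaC => Pa.
  have [->|a_neq0] := eqVneq a 0; first exact: (rmorph0 h).
  by case: (PS _ Pa); exists a.
- by [].
pose cst : {rmorphism k -> {poly {poly k}}} := polyC \o polyC.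
have hcst a : h (cst a) = idfun a.
  by rewrite /h /cst /= map_polyC horner_evalE hornerC /= horner_evalE hornerC.
have psicst a : psi (cst a) = a%:MP.
  by rewrite /psi /cst /= map_polyC horner_evalE hornerC /= map_polyC horner_evalE hornerC.
have theta_cst p : theta (map_mpoly cst p) = p.
  by rewrite /theta /= (mmap_map_mpoly _ _ psicst) mmap_id.
have yI p : P p -> mmap (idfun : k -> k) y p = 0.
  move=> Pp; rewrite -(mmap_map_mpoly _ _ hcst); apply: yP.
  by rewrite /preimage /= theta_cst.
have [M0 uM0 yE] : exists2 M, M \in unitmx & y = GLpoint M.
  apply: GLpoint_surj; apply/yI/IP => M AM'.
  rewrite rmorphB rmorph1 /= GLliftE mx_eval_det expr1 mulfV ?subrr //.
  by rewrite -unitfE -unitmxE Au.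
have AM0 : A M0.
  have [S0 AE] := cA; rewrite AE; split=> // p Sp.
  have := yI (GLlift p 0); rewrite yE GLliftE mulr1; apply.
  apply: IP => M AM'; rewrite GLliftE mulr1; move: AM'; rewrite AE => -[_]; exact.
have val_y (p : R) a : psi a = p -> mmap (idfun : k -> k) y p = h a.
  move=> pE; apply/eqP; rewrite -subr_eq0 -(mmap_map_mpoly _ _ hcst) -[h a](mmapC y h).
  rewrite -rmorphB /=; apply/eqP/yP; rewrite /preimage /= rmorphB /= theta_cst.
  by rewrite thetaC pE subrr; case: Pprime => -[].
have nuM0 : nu M0 = n0.
  rewrite -nuTE // -yE (val_y _ _ psiCX) /h /= map_polyC horner_evalE hornerC.
  by rewrite /= horner_evalE hornerX.
have fM0 : f M0 = f0'.
  by rewrite -fTE // -yE (val_y _ _ psiX) /h /= map_polyX horner_evalE hornerX.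
by case/eqP: f0_neq; rewrite -fM0; apply: f_nu => //; rewrite nuM0.
Qed.

End PowerRelation.

(** * The kernel of a character *)

Section KernelOfCharacter.
Variables (k : numClosedFieldType) (N : nat) (G : set 'M[k]_N) (nu : 'M[k]_N -> k).
Hypotheses (cG : uclosed G) (gG : mx_group G) (rnu : regular nu).
Hypothesis nuM : forall x y, G x -> G y -> nu (x *m y) = nu x * nu y.
Hypothesis nu_surj : forall c : k, c != 0 -> exists2 x, G x & nu x = c.

Notation A := (id_component G).

Let AG : A `<=` G. Proof. exact: idc_sub. Qed.
Let gA : mx_group A. Proof. exact: idc_group. Qed.
Let cA : uclosed A.
Proof. by have [_ G1 _ _] := gG; have [] := idc_clopen cG G1. Qed.
Let Gu x : G x -> x \in unitmx. Proof. by have [Gu _ _ _] := gG; apply: Gu. Qed.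
Let Au x : A x -> x \in unitmx. Proof. by move/AG/Gu. Qed.

Lemma character_neq0 x : G x -> nu x != 0.
Proof.
have [_ G1 GM GV] := gG; move=> Gx; have [y Gy nuy] := nu_surj (oner_neq0 k).
have : nu (x *m (invmx x *m y)) = 1 by rewrite mulKVmx // Gu.
rewrite nuM //; last by apply: (GM) => //; apply: GV.
by move=> H; apply: contra_eq_neq H => ->; rewrite mul0r eq_sym oner_neq0.
Qed.

Lemma character1 : nu 1%:M = 1.
Proof.
have [_ G1 _ _] := gG; have := nuM G1 G1; rewrite mulmx1.
by move/esym/(canRL (mulfK (character_neq0 G1))); rewrite divff ?character_neq0.
Qed.

Lemma characterV x : G x -> nu (invmx x) = (nu x)^-1.
Proof.
have [_ _ _ GV] := gG; move=> Gx; apply: (mulfI (character_neq0 Gx)).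
by rewrite -nuM ?mulmxV ?character1 ?mulfV ?character_neq0 // ?Gu //; apply: GV.
Qed.

(** Powers by an exponent of the component group land in the identity component, and c has a root of
    that order. *)
Lemma character_idc_surj (c : k) : c != 0 -> exists2 x, A x & nu x = c.
Proof.
move=> c0; have [e e_gt0 Ge] := idc_exponent cG gG.
have [d de] : exists d, d ^+ e = c.
  have /closed_rootP[d] : size ('X^e - c%:P) != 1%N by rewrite size_XnsubC // eqSS -lt0n.
  by rewrite rootE !hornerE subr_eq0 => /eqP de; exists d.
have d0 : d != 0 by apply: contraNneq c0 => d0; rewrite -de d0 expr0n eqn0Ngt e_gt0.
have [x Gx nux] := nu_surj d0; exists (mxpow x e); first exact: Ge.
rewrite -de -nux; elim: (e) => [|j IHj]; first exact: character1.
by rewrite mxpowS nuM ?IHj ?exprS //; apply: mx_group_pow.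
Qed.

(* If the kernel of nu on A is not connected, nu factors through a nontrivial
   connected covering of the multiplicative group. *)
Lemma kernel_dichotomy :
  (forall x, A x -> nu x = 1 ->
     id_component [set y | G y /\ nu y = 1] x) \/
  exists f p u v, [/\ regular f, prime p, p %| u, coprime p v &
    forall x, A x -> f x ^+ u = nu x ^+ v]%N.
Proof.
have [[b0 [Ab0 nub0 nCb0]]|noc] := pselect (exists x, [/\ A x, nu x = 1 &
    ~ id_component [set y | G y /\ nu y = 1] x]); last first.
  by left=> x Ax nux; apply: contrapT => nCx; apply: noc; exists x.
right; have [_ A1 AM AV] := gA.
have connA : zariski_connected A := @idc_connected _ _ G.
have nu0 x : A x -> nu x != 0 by move/AG; apply: character_neq0.
have nuMA x y : A x -> A y -> nu (x *m y) = nu x * nu y.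
  by move=> /AG Gx /AG Gy; apply: nuM.
have nuVA x : A x -> nu (invmx x) = (nu x)^-1 by move/AG; apply: characterV.
pose B := [set y | A y /\ nu y = 1].
have gB : mx_group B.
  split=> [x [/Au]//||x y [Ax nux] [Ay nuy]|x [Ax nux]].
  - by split=> //; apply: character1.
  - by split; [apply: AM|rewrite nuMA // nux nuy mulr1].
  - by split; [apply: AV|rewrite nuVA // nux invr1].
have cB : uclosed B.
  have -> : B = A `&` [set M | M \in unitmx /\ nu M - 1 = 0].
    apply/seteqP; split=> M [AM' H]; split=> //.
      by split; [apply: Au|rewrite H subrr].
    by case: H => _ /eqP; rewrite subr_eq0 => /eqP.
  by apply: uclosedI => //; apply: uclosed_zero; apply: regular_sub => //; apply: regular_cst.
have [_ B1 _ _] := gB.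
have [cC _] := idc_clopen cB B1.
have gC := idc_group gB.
have CA : id_component B `<=` A by move=> x /idc_sub[].
(* For fixed [a], the commutators with elements of the connected [A] form a connected subset of [B]
   containing 1. *)
have commC a y : A a -> A y -> id_component B (invmx a *m invmx y *m a *m y).
  move=> Aa Ay; have ua := Au Aa.
  have : [set invmx a *m invmx z *m a *m z | z in A] `<=` id_component B.
    apply: idc_max.
    - move=> _ [z Az <-]; have AVa := AV _ Aa; have AVz := AV _ Az.
      have A2 := AM _ _ AVa AVz; have A3 := AM _ _ A2 Aa.
      split; first exact: AM.
      by rewrite !nuMA // !nuVA // mulrAC mulfVK ?nu0 // mulVf ?nu0.
    - apply: (connected_image (f := fun z => invmx a *m invmx z *m a *m z)) => //.
      + apply: regular_mulmx; last exact: regular_mx_id.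
        apply: regular_mulmx; last exact: regular_mx_cst.
        by apply: regular_mulmx; [exact: regular_mx_cst|exact: regular_invmx].
      + by move=> M uM; rewrite !unitmx_mul !unitmx_inv ua uM.
    - by exists 1%:M => //; rewrite invmx1 !mulmx1 mulVmx.
  by apply; exists y.
have nC'b0 : ~ id_component B b0.
  by move=> Cb0; apply: nCb0; apply: idc_mono Cb0 => x [/AG].
have [e e_gt0 Be] := idc_exponent cB gB.
have [f [rf fM f0 fC fb0]] := separating_character gA gC CA cC connA commC Ab0 nC'b0
  e_gt0 (Be _ (conj Ab0 nub0)).
have f1 : f 1%:M = 1 by apply/fC/idc1.
have fV x : A x -> f (invmx x) = (f x)^-1.
  move=> Ax; apply: (mulfI (f0 _ Ax)).
  by rewrite -fM ?mulmxV ?f1 ?mulfV ?f0 ?Au //; apply: AV.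
have fpow x j : A x -> f (mxpow x j) = f x ^+ j.
  move=> Ax; elim: j => [|j IHj]; first exact: f1.
  by rewrite mxpowS fM ?IHj ?exprS //; apply: mx_group_pow.
(* x^-1 y lies in [B], so its e-th power lies in the identity component of [B], where [f] is 1. *)
have fe_nu x y : A x -> A y -> nu x = nu y -> f x ^+ e = f y ^+ e.
  move=> Ax Ay nuxy; have AVxy : A (invmx x *m y) by apply: (AM) => //; apply: AV.
  have /fC : id_component B (mxpow (invmx x *m y) e).
    by apply: Be; split=> //; rewrite nuMA ?nuVA ?nuxy ?mulVf ?nu0 //; apply: AV.
  rewrite fpow // fM ?fV //; last exact: AV.
  rewrite exprMn exprVn => H; apply: (mulfI (_ : (f x ^+ e)^-1 != 0)).
    by rewrite invr_eq0 expf_neq0 ?f0.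
  by rewrite H mulVf // expf_neq0 ?f0.
have [a [b [c [a_gt0 rel]]]] := @power_relation k N A nu (fun x => f x ^+ e) cA gA rnu
  (regular_exp e rf) nuMA
  (fun x y Ax Ay => etrans (congr1 (fun z => z ^+ e) (fM x y Ax Ay)) (exprMn _ _ _))
  (fun x Ax => expf_neq0 e (f0 x Ax)) character_idc_surj fe_nu.
(* The relation reads f^(e a) nu^b = nu^c; if c < b, [f] is replaced by its inverse to keep the
   exponent of [nu] a natural number. *)
have [g [rg _ g0 gb0]] : exists g, [/\ regular g,
    forall x, A x -> g x != 0, g b0 != 1 /\ g 1%:M = 1 &
    exists d v, (0 < d)%N /\ forall x, A x -> g x ^+ d = nu x ^+ v].
  have ea_gt0 : (0 < e * a)%N by rewrite muln_gt0 e_gt0.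
  have [le_bc|lt_cb] := leqP b c.
    exists f; split=> //; exists (e * a)%N, (c - b)%N; split=> // x Ax.
    apply: (mulIf (expf_neq0 b (nu0 _ Ax))).
    by rewrite -exprD subnK // -rel // exprM.
  exists (fun x => f (invmx x)); split=> [|x Ax||].
  - exact: (regular_invmx_comp rf).
  - by rewrite fV // invr_eq0 f0.
  - by rewrite fV // invmx1 f1 invr_eq1.
  exists (e * a)%N, (b - c)%N; split=> // x Ax; rewrite fV // exprVn.
  apply: (mulIf (expf_neq0 c (nu0 _ Ax))).
  rewrite -exprD subnK ?(ltnW lt_cb) // -rel // exprM mulKf //.
  by rewrite !expf_neq0 ?f0.
move: g0 gb0 => [gb0 g1] [d [v [d_gt0 gnu]]].
pose h := gcdn d v; have h_gt0 : (0 < h)%N by rewrite gcdn_gt0 d_gt0.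
pose u := (d %/ h)%N; pose w := (v %/ h)%N.
(* Division by the gcd [h]: the quotient of the two sides is regular with values in the h-th roots
   of unity, hence constant on [A]. *)
have gnu' x : A x -> g x ^+ u = nu x ^+ w.
  move=> Ax; pose q y := g y ^+ u * (nu (invmx y)) ^+ w.
  have qh y : A y -> q y ^+ h = 1.
    move=> Ay; rewrite /q exprMn -!exprM !divnK ?dvdn_gcdl ?dvdn_gcdr // gnu //.
    by rewrite nuVA // exprVn mulfV // expf_neq0 ?nu0.
  have q1 : q 1%:M = 1 by rewrite /q invmx1 g1 character1 !expr1n mulr1.
  have [rs rsE] := closed_field_poly_normal ('X^h - 1 : {poly k}).
  have : q x = 1.
    rewrite -q1; apply: (@connected_cst _ _ A q rs) => //.
    - apply: regular_mul; first exact: regular_exp.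
      by apply: regular_exp; apply: regular_invmx_comp.
    move=> z Az; have : root ('X^h - 1 : {poly k}) (q z).
      by rewrite rootE !hornerE qh // subrr.
    rewrite rsE rootZ ?root_prod_XsubC //.
    by rewrite lead_coef_eq0 -size_poly_gt0 size_XnsubC.
  rewrite /q nuVA // exprVn => H; apply: (mulIf (_ : (nu x ^+ w)^-1 != 0)).
    by rewrite invr_eq0 expf_neq0 ?nu0.
  by rewrite H mulfV // expf_neq0 ?nu0.
have u_gt0 : (0 < u)%N by rewrite divn_gt0 // dvdn_leq // dvdn_gcdl.
(* u = 1 would make [g] a power of [nu], hence 1 at [b0]. *)
have u_gt1 : (1 < u)%N.
  rewrite ltn_neqAle eq_sym u_gt0 andbT; apply: contraNneq gb0 => u1.
  by have := gnu' _ Ab0; rewrite u1 expr1 nub0 expr1n => ->.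
exists g, (pdiv u), u, w; split=> //; [exact: pdiv_prime|exact: pdiv_dvd|].
apply: coprime_dvdl (pdiv_dvd u) _.
by rewrite /coprime /u /w -(eqn_pmul2r h_gt0) muln_gcdl !divnK ?dvdn_gcdl ?dvdn_gcdr // mul1n eqxx.
Qed.

(** As [nu] is onto on the identity component, every coset has a representative x' with nu x' = 1,
    and y -> f(x'^-1 y) carries the relation to that coset. The second entry of each pair is a power
    of det clearing denominators. *)
Lemma power_on_cosets f u v : regular f -> (forall x, A x -> f x ^+ u = nu x ^+ v) ->
  exists s : seq ({mpoly k[N * N]} * nat), forall y, G y -> exists2 pD, pD \in s &
    mx_eval (idfun : k -> k) y pD.1 ^+ u = nu y ^+ v * (\det y ^+ pD.2) ^+ u.
Proof.
move=> rf fnu; have [_ G1 GM GV] := gG; have [_ A1 AM AV] := gA.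
have [s [Gs Hs]] := idc_finite_index cG gG.
have /choice[x' Hx'] x : exists x', G x -> [/\ G x', nu x' = 1 & A (invmx x' *m x)].
  have [Gx|nGx] := pselect (G x); last by exists x.
  have [a Aa nua] : exists2 a, A a & nu a = (nu x)^-1.
    by apply: character_idc_surj; rewrite invr_eq0 character_neq0.
  exists (x *m a) => _; have Ga := AG Aa; split; first exact: GM.
    by rewrite nuM // nua mulfV // character_neq0.
  by rewrite invmxM ?Gu // mulmxKV ?Gu //; apply: AV.
have /choice[pD HpD] x : exists pD : {mpoly k[N * N]} * nat, G x ->
    forall M, M \in unitmx ->
    mx_eval (idfun : k -> k) M pD.1 = f (invmx (x' x) *m M) * \det M ^+ pD.2.
  have [Gx|nGx] := pselect (G x); last by exists (0, 0%N).
  have [/Gu ux' _ _] := Hx' x Gx.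
  have : regular (fun M => f (invmx (x' x) *m M *m 1%:M)).
    apply: (regular_comp (f := fun M => invmx (x' x) *m M *m 1%:M) rf).
    - exact: regular_mx_mul.
    - apply: (regular_mx_ext (f := fun M => 1%:M *m invmx M *m x' x)) => [M uM|].
        by rewrite mulmx1 mul1mx invmxM ?unitmx_inv // invmxK.
      apply: regular_mulmx; last exact: regular_mx_cst.
      by apply: regular_mulmx; [exact: regular_mx_cst|exact: regular_invmx].
    - by move=> M uM; rewrite mulmx1 unitmx_mul unitmx_inv ux'.
  move=> [p [D H]]; exists (p, D) => _ M uM.
  by rewrite H // mulmx1.
exists [seq pD x | x <- s] => y Gy.
have [x xs Axy] := Hs y Gy; have Gx := Gs x xs.
exists (pD x); first exact: map_f.
have [Gx' nux' Ax'] := Hx' x Gx.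
have Ax'y : A (invmx (x' x) *m y).
  by have := AM _ _ Ax' Axy; rewrite !mulmxA mulmxK ?Gu.
rewrite HpD // ?Gu // exprMn fnu // nuM // ?characterV // ?nux' ?invr1 ?mul1r //.
exact: GV.
Qed.

End KernelOfCharacter.

(** * l-adic fields *)

Lemma bezout_prime (p : nat) (n : int) : prime p -> ~~ (p %| n)%Z ->
  exists u v : int, u * p + v * n = 1.
Proof.
move=> pr_p ndvd; have /coprimezP[[u v] /= uv] : coprimez p n.
  by rewrite coprimezE absz_nat prime_coprime // -dvdzE.
by exists u, v.
Qed.

Section Padic.
Variables (R : realType) (l : primeN) (Ql : padic_field R l).
Notation L := (val l).
Notation abs := (@Ql_abs R l Ql).
Implicit Types (x y : Ql) (n : int).

Let Lprime : prime L. Proof. exact: (valP l). Qed.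
Let L_gt0 : (0 < L%:R :> R). Proof. by rewrite ltr0n prime_gt0. Qed.
Let LV_gt0 : (0 < L%:R^-1 :> R). Proof. by rewrite invr_gt0. Qed.
Let LV_lt1 : (L%:R^-1 < 1 :> R). Proof. by rewrite invf_lt1 // ltr1n prime_gt1. Qed.

Lemma padic_abs_ge0 x : 0 <= abs x. Proof. by have [H _ _ _] := Ql_nonarch Ql. Qed.
Lemma padic_abs_eq0 x : (abs x == 0) = (x == 0). Proof. by have [_ H _ _] := Ql_nonarch Ql. Qed.
Lemma padic_absM x y : abs (x * y) = abs x * abs y. Proof. by have [_ _ H _] := Ql_nonarch Ql. Qed.
Lemma padic_abs1 : abs 1 = 1.
Proof.
have a0 : abs 1 != 0 by rewrite padic_abs_eq0 oner_neq0.
by apply: (mulfI a0); rewrite -padic_absM !mulr1.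
Qed.
Lemma padic_absX x j : abs (x ^+ j) = abs x ^+ j.
Proof. by elim: j => [|j IHj]; rewrite ?padic_abs1 // !exprS padic_absM IHj. Qed.
Lemma padic_absN x : abs (- x) = abs x.
Proof.
apply/eqP; rewrite -(eqrXn2 (n := 2)) ?padic_abs_ge0 //.
by rewrite -!padic_absX sqrrN.
Qed.
Lemma padic_abs_addl x y e : abs x <= e -> abs y <= e -> abs (x + y) <= e.
Proof.
move=> xe ye; have [_ _ _ H] := Ql_nonarch Ql.
by rewrite (le_trans (H x y)) // ge_max xe.
Qed.
Lemma padic_abs_subl x y e : abs x <= e -> abs y <= e -> abs (x - y) <= e.
Proof. by move=> xe ye; apply: padic_abs_addl; rewrite ?padic_absN. Qed.
Lemma padic_abs_subt x y e : abs x < e -> abs y < e -> abs (x - y) < e.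
Proof.
move=> xe ye; have [_ _ _ H] := Ql_nonarch Ql.
by rewrite (le_lt_trans (H x (- y))) // gt_max xe padic_absN.
Qed.

Lemma padic_abs_int n : abs n%:~R <= 1.
Proof.
have nat_le1 j : abs j%:R <= 1.
  elim: j => [|j IHj]; last by rewrite -natr1 padic_abs_addl // padic_abs1.
  by have /eqP -> : abs 0 == 0 by rewrite padic_abs_eq0.
by case: n => j; rewrite ?NegzE ?rmorphN /= ?padic_absN; apply: nat_le1.
Qed.

Lemma padic_abs_dvd n k : ((L ^ k)%N %| n)%Z -> abs n%:~R <= L%:R^-1 ^+ k.
Proof.
move=> /dvdzP[q ->]; rewrite rmorphM padic_absM /= -[X in _ <= X]mul1r.
rewrite ler_pM ?padic_abs_ge0 ?padic_abs_int //.
by rewrite -pmulrn natrX padic_absX Ql_abs_l.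
Qed.

(** Otherwise a relation u l + v n = 1 would write 1 as a sum of two terms of absolute value below
    1. *)
Lemma padic_abs_lt1 n : abs n%:~R < 1 -> (L %| n)%Z.
Proof.
move=> n_lt1; apply: contraLR (n_lt1) => ndvd; rewrite -leNgt.
have [u [v uv]] := bezout_prime Lprime ndvd.
have LE : abs (L : int)%:~R = L%:R^-1 by rewrite -pmulrn Ql_abs_l.
have : abs (u%:~R * (L : int)%:~R + v%:~R * n%:~R) = 1.
  by rewrite -!rmorphM -rmorphD /= uv padic_abs1.
move=> uv1; rewrite -uv1 leNgt; apply/negP => ltn.
have /ltW := n_lt1.
have: abs (u%:~R * (L : int)%:~R + v%:~R * n%:~R) < 1.
  rewrite -[v%:~R * _]opprK; apply: padic_abs_subt; rewrite ?padic_absN padic_absM.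
    rewrite (le_lt_trans (ler_piMl (padic_abs_ge0 _) (padic_abs_int _))) //.
    by rewrite LE.
  by rewrite (le_lt_trans (ler_piMl (padic_abs_ge0 _) (padic_abs_int _))).
by rewrite uv1 ltxx.
Qed.

Lemma padic_abs_unit n : ~~ (L %| n)%Z -> abs n%:~R = 1.
Proof.
by move=> nd; apply/eqP; rewrite eq_le padic_abs_int leNgt; apply: contra nd => /padic_abs_lt1.
Qed.

(** A close rational has denominator prime to l; the residue is its numerator times an inverse of
    the denominator modulo l. *)
Lemma padic_approx_nat x : abs x <= 1 -> exists a : nat, abs (x - a%:R) <= L%:R^-1.
Proof.
move=> x1; have [q xq] := Ql_dense x LV_gt0.
have q1 : abs (Ql_Q Ql q) <= 1.
  by rewrite -[Ql_Q Ql q](subKr x); apply: padic_abs_subl => //; rewrite ltW // (lt_trans xq).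
have d0 : (denq q)%:~R != 0 :> Ql.
  by rewrite -(rmorph_int (Ql_Q Ql)) fmorph_eq0 intr_eq0 denq_eq0.
have qE : Ql_Q Ql q * (denq q)%:~R = (numq q)%:~R.
  by rewrite -!(rmorph_int (Ql_Q Ql)) -rmorphM /= numqE.
have nd : ~~ (L %| denq q)%Z.
  apply/negP => Ld.
  have Ln : (L %| numq q)%Z.
    apply: padic_abs_lt1; rewrite -qE padic_absM.
    rewrite (le_lt_trans (ler_piMl (padic_abs_ge0 _) q1)) //.
    by rewrite (le_lt_trans (padic_abs_dvd (k := 1) _)) // expr1.
  have := coprime_num_den q; rewrite /coprime => /eqP cop.
  have : (L %| 1)%N by rewrite -cop dvdn_gcd; apply/andP; split; [exact: Ln|exact: Ld].
  by rewrite dvdn1 => /eqP L1; move: Lprime; rewrite L1.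
have [u [v uv]] := bezout_prime Lprime nd.
have [a aE] : exists a : nat, (L %| numq q * v - a%:Z)%Z.
  have L0 : (L : int) != 0 by rewrite eqz_nat -lt0n prime_gt0.
  exists `|(numq q * v %% L)%Z|%N.
  by rewrite gez0_abs ?modz_ge0 // -eqz_mod_dvd modz_mod.
exists a; have -> : x - a%:R = (x - Ql_Q Ql q) + (Ql_Q Ql q - a%:R) by rewrite addrA subrK.
apply: padic_abs_addl; first exact: ltW.
have -> : abs (Ql_Q Ql q - a%:R) = abs (numq q - a%:Z * denq q)%:~R.
  rewrite rmorphB rmorphM /= -qE -mulrBl padic_absM (padic_abs_unit nd) mulr1.
  by rewrite -pmulrn.
rewrite -[X in _ <= X]expr1; apply: padic_abs_dvd; rewrite expn1.
have -> : numq q - a%:Z * denq q =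
    (numq q * v - a%:Z) * denq q + (numq q * u) * L.
  by rewrite -[numq q in LHS]mulr1 -uv; ring.
by apply: rpredD; [apply: dvdz_mulr|apply: dvdz_mull].
Qed.

Lemma padic_abs_small e : 0 < e -> exists k, L%:R^-1 ^+ k < e :> R.
Proof.
move=> e0.
have [k Hk] : exists k : nat, e^-1 < k%:R.
  by exists (Num.bound e^-1); rewrite archi_boundP // invr_ge0 ltW.
exists k; rewrite exprVn -[e]invrK ltf_pV2 ?posrE ?exprn_gt0 ?invr_gt0 //.
rewrite (lt_trans Hk) // -natrX ltr_nat; exact: ltn_expl (prime_gt1 Lprime).
Qed.

End Padic.

Lemma horner_taylor2 (R : comNzRingType) (F : {poly R}) a b :
  exists c, F.[a + b] = F.[a] + b * F^`().[a] + b ^+ 2 * c.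
Proof.
elim/poly_ind: F => [|G d [c IH]].
  by exists 0; rewrite deriv0 !horner0; ring.
exists (G^`().[a] + c * (a + b)).
rewrite derivD derivM derivX derivC !hornerE IH; ring.
Qed.

(** * Hensel's lemma *)

Section Hensel.
Variables (R : realType) (l : primeN) (Ql : padic_field R l).
Notation L := (val l).
Notation abs := (@Ql_abs R l Ql).

Lemma padic_horner_int (F : {poly int}) x y : abs x <= 1 -> abs y <= 1 ->
  abs (map_poly (intr : int -> Ql) F).[x] <= 1 /\
  abs ((map_poly intr F).[x] - (map_poly intr F).[y]) <= abs (x - y).
Proof.
move=> x1 y1; elim/poly_ind: F => [|G d IH].
  by rewrite !rmorph0 !horner0 subrr (eqP (_ : abs 0 == 0)) ?padic_abs_eq0 // ler01 padic_abs_ge0.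
have [IH1 IH2] := IH.
rewrite rmorphD rmorphM /= map_polyX map_polyC /= !hornerE; split.
  apply: padic_abs_addl; last exact: padic_abs_int.
  by rewrite padic_absM mulr_ile1 ?padic_abs_ge0.
set u := _.[x] in IH1 IH2 *; set v := _.[y] in IH2 *.
have -> : u * x + d%:~R - (v * y + d%:~R) = (u - v) * y + u * (x - y) by ring.
apply: padic_abs_addl; rewrite padic_absM.
  by rewrite (le_trans _ IH2) // ler_piMr ?padic_abs_ge0.
by rewrite ler_piMl ?padic_abs_ge0.
Qed.

Lemma hensel_int (F : {poly int}) (a0 : int) :
  (L %| F.[a0])%Z -> ~~ (L %| F^`().[a0])%Z ->
  exists z : Ql, root (map_poly intr F) z.
Proof.
move=> Fa0 F'a0; have Lprime : prime L := valP l.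
pose good k (a : int) := ((L ^ k.+1)%N %| F.[a])%Z /\ ~~ (L %| F^`().[a])%Z.
have dvd_pow k : (L %| ((L ^ k.+1)%N : int))%Z by rewrite expnS PoszM dvdz_mulr.
have /choice[g Hg] : forall ka : nat * int, exists a',
    good ka.1 ka.2 -> good ka.1.+1 a' /\ ((L ^ ka.1.+1)%N %| a' - ka.2)%Z.
  move=> [k a] /=; have [[/dvdzP[s Fa] F'a]|ng] := pselect (good k a); last by exists a.
  have [u [v uv]] := bezout_prime Lprime F'a.
  (* Newton's correction: F(a) = s l^(k+1), and [v] inverts F'(a) modulo l. *)
  pose b : int := - (s * v) * (L ^ k.+1)%N.
  exists (a + b) => _; split; last first.
    by rewrite addrC addKr dvdz_mull.
  have [c cE] := horner_taylor2 F a b; split.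
    rewrite cE Fa.
    have -> : s * (L ^ k.+1)%N + b * F^`().[a] + b ^+ 2 * c =
        s * u * (L * (L ^ k.+1)%N)%N + (s * v) ^+ 2 * c * (L ^ k.+1)%N * (L ^ k.+1)%N.
      rewrite /b PoszM; set q := Posz (L ^ k.+1); apply: subr0_eq.
      transitivity (s * q * (1 - (u * L + v * F^`().[a]))); first by ring.
      by rewrite uv subrr mulr0.
    apply: rpredD; first by rewrite -expnS dvdz_mull.
    rewrite -mulrA; apply: dvdz_mull.
    have -> : Posz (L ^ k.+2) = Posz L * Posz (L ^ k.+1) by rewrite expnS PoszM.
    by apply: dvdz_mul => //; apply: dvd_pow.
  have [c' c'E] := horner_taylor2 F^`() a b.
  rewrite c'E; apply: contra F'a => H.
  have -> : F^`().[a] = F^`().[a] + b * F^`()^`().[a] + b ^+ 2 * c'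
      - b * (F^`()^`().[a] + b * c') by ring.
  apply: rpredB => //; apply: dvdz_mulr; apply: dvdz_mull; exact: dvd_pow.
pose s := fix s k := if k is k'.+1 then g (k', s k') else a0.
have s_good k : good k (s k).
  elim: k => [|k IHk]; first by rewrite /good expn1.
  by have [] := Hg (k, s k) IHk.
have s_step k : ((L ^ k.+1)%N %| s k.+1 - s k)%Z.
  by have [] := Hg (k, s k) (s_good k).
have s_le i j : (i <= j)%N -> ((L ^ i.+1)%N %| s j - s i)%Z.
  move=> /subnK <-; elim: (j - i)%N => [|d IHd]; first by rewrite subrr dvdz0.
  have -> : s (d.+1 + i)%N - s i = (s (d + i)%N.+1 - s (d + i)%N) + (s (d + i)%N - s i).
    by rewrite addrA subrK.
  apply: rpredD => //; apply: dvdz_trans (s_step _).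
  by rewrite dvdzE /= dvdn_exp2l // ltnS leq_addl.
have cauchy e : 0 < e -> exists M : nat, forall i j, (M <= i)%N -> (M <= j)%N ->
    abs ((s i)%:~R - (s j)%:~R) < e.
  move=> e0; have [k Hk] := padic_abs_small l e0; exists k => i j ki kj.
  have sk i' : (k <= i')%N -> abs ((s i')%:~R - (s k)%:~R) < e.
    move=> ki'; apply: le_lt_trans Hk; rewrite -rmorphB /=; apply: padic_abs_dvd.
    apply: dvdz_trans (s_le _ _ ki').
    by rewrite dvdzE /= dvdn_exp2l.
  have -> : (s i)%:~R - (s j)%:~R = ((s i)%:~R - (s k)%:~R) - ((s j)%:~R - (s k)%:~R) :> Ql.
    by rewrite opprB addrA subrK.
  by apply: padic_abs_subt; apply: sk.
have [z Hz] := Ql_complete (u := fun i => (s i)%:~R) cauchy.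
exists z; rewrite rootE -padic_abs_eq0 eq_le padic_abs_ge0 andbT.
apply/ler_addgt0Pl => e e0; rewrite addr0.
have [k Hk] := padic_abs_small l e0; have [M HM] := Hz e e0.
pose j := maxn k M.
have zj : abs ((s j)%:~R - z) < e by apply: HM; rewrite leq_maxr.
have z1 : abs z <= 1.
  have [M1 HM1] := Hz 1 ltr01.
  rewrite -[z](subKr (s M1)%:~R); apply: padic_abs_subl; first exact: padic_abs_int.
  exact/ltW/HM1.
have [_ Hlip] := padic_horner_int F z1 (padic_abs_int Ql (s j)).
rewrite -[_.[z]](subrK (map_poly intr F).[(s j)%:~R]).
apply: padic_abs_addl.
  by rewrite (le_trans Hlip) // -padic_absN opprB ltW.
have -> : (map_poly intr F).[(s j)%:~R] = (F.[s j])%:~R :> Ql by rewrite horner_map.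
rewrite (le_trans _ (ltW Hk)) //; apply: padic_abs_dvd.
have [sj _] := s_good j; apply: dvdz_trans sj.
by rewrite dvdzE /= dvdn_exp2l // ltnW // ltnS leq_maxl.
Qed.

End Hensel.

(** * Primes with a root of a rational polynomial *)

(** Irreducibility: with d = gcd(p, q), x is a root of p / d or of d. If [p] does not divide q, it
    does not divide d either, so it divides p / d and d is constant. *)
Lemma minpoly_coprime (x : algC) : exists p : {poly rat}, [/\ p \is monic,
  forall q, root (map_poly ratr q) x = (p %| q) &
  forall q, ~~ (p %| q) -> coprimep p q].
Proof.
have [p [_ mon_p rootE]] := minCpolyP x; exists p; split=> // q npq.
have p0 := monic_neq0 mon_p.
have dp := dvdp_gcdl p q; set d := gcdp p q in dp.
have npd : ~~ (p %| d).
  by apply: contra npq => pd; apply: dvdp_trans pd (dvdp_gcdr p q).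
have : root (map_poly ratr (p %/ d * d)) x by rewrite divpK // rootE.
rewrite rmorphM rootM /= !rootE (negPf npd) orbF => pdiv.
have pd0 : p %/ d != 0 by rewrite dvdp_div_eq0.
have d0 : d != 0 by rewrite gcdp_eq0 (negPf p0).
have := dvdp_leq pd0 pdiv; rewrite size_divp // => szp.
rewrite /coprimep -/d eqn_leq size_poly_gt0 d0 andbT.
move: szp; have : (0 < size p)%N by rewrite size_poly_gt0.
by move: (size d) (size p) => [|[|sd]] [|sp] //; rewrite /= subSS => _; rewrite ltnNge leq_subr.
Qed.

Lemma dvdz_horner_sub (F : {poly int}) (a b : int) : (b %| F.[a + b] - F.[a])%Z.
Proof.
have [c ->] := horner_taylor2 F a b.
have -> : F.[a] + b * F^`().[a] + b ^+ 2 * c - F.[a] = b * (F^`().[a] + b * c) by ring.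
exact: dvdz_mulr.
Qed.

Lemma poly_int_nonroot (G : {poly int}) (M a : int) : G != 0 -> M != 0 ->
  exists x, G.[a + M * x] != 0.
Proof.
move=> G0 M0; apply: contrapT => /forallNP H.
pose rs := [seq a + M * x%:Z | x <- iota 0 (size G)].
have : (size rs < size G)%N.
  apply: max_poly_roots => //.
    apply/allP => _ /mapP[x _ ->]; rewrite rootE; exact/negPn/negP/H.
  rewrite map_inj_in_uniq ?iota_uniq // => x y _ _ /addrI /(mulfI M0) [//].
by rewrite size_map size_iota ltnn.
Qed.

(* Schur's argument: F takes at a + M x the value F(a) (1 + d B! y). *)
Lemma prime_divisors_of_values (F U V : {poly int}) (d : int) : (1 < size F)%N ->
  U * F + V * F^`() = d%:P -> d != 0 ->
  forall B : nat, exists l a, [/\ prime l, (B < l)%N, (l %| F.[a])%Z &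
    ~~ (l %| F^`().[a])%Z].
Proof.
move=> szF UV d0 B.
have F0 : F != 0 by rewrite -size_poly_gt0 (ltn_trans _ szF).
have [x0] := poly_int_nonroot 0 F0 (oner_neq0 _); rewrite add0r mul1r => c0.
set c := F.[x0] in c0.
have FcN e : F - e%:P != 0.
  apply: contraTneq szF => /eqP; rewrite subr_eq0 => /eqP->.
  by rewrite size_polyC; case: (e != 0).
pose D : int := d * (B`!)%N.
have D0 : D != 0 by rewrite mulf_neq0 // eqz_nat -lt0n fact_gt0.
have cD0 : c * D != 0 by rewrite mulf_neq0.
(* Avoiding the roots of F, F - c and F + c makes F(a) = c w with w none of 0, 1, -1. *)
have [x] := poly_int_nonroot x0 (mulf_neq0 F0 (mulf_neq0 (FcN c) (FcN (- c)))) cD0.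
set a := x0 + _; rewrite !hornerM !hornerD !hornerN !hornerC !mulf_eq0 !negb_or.
case/and3P => Fa0 Fac FaNc.
have /dvdzP[y yE] : (c * D %| F.[a] - c)%Z.
  by apply: dvdz_trans (dvdz_horner_sub F x0 (c * D * x)); apply: dvdz_mulr.
pose w := 1 + y * D.
have FaE : F.[a] = c * w by rewrite -[F.[a]](subrK c) yE /w; ring.
have w1 : (1 < `|w|)%N.
  have w0 : w != 0 by apply: contraNneq Fa0 => w0; rewrite FaE w0 mulr0.
  rewrite ltn_neqAle absz_gt0 w0 andbT eq_sym.
  apply/eqP => wE; have /orP[/eqP w_1|/eqP w_1] : (w == 1) || (w == -1).
    by move: wE; case: (w) => [[|[|j]]|[|j]].
    by move: Fac; rewrite FaE w_1 mulr1 subrr.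
  by move: FaNc; rewrite FaE w_1 mulrN1 opprK addrC subrr.
pose l := pdiv `|w|%N.
have pr_l : prime l by apply: pdiv_prime.
have lw : (l %| w)%Z by rewrite dvdzE /= pdiv_dvd.
(* w is 1 modulo d B!. That l does not divide B! gives l > B; that it does not divide d keeps it
   from dividing F'(a). *)
have nlD : ~~ (l %| D)%Z.
  apply/negP => lD; have : (l %| 1)%Z.
    have -> : 1 = w - y * D :> int by rewrite /w addrK.
    by apply: rpredB => //; apply: dvdz_mull.
  by rewrite dvdzE /= dvdn1 => /eqP l1; rewrite l1 in pr_l.
exists l, a; split=> //.
- rewrite ltnNge; apply: contra nlD => lB; apply: dvdz_mull.
  by rewrite dvdzE /= dvdn_fact // prime_gt0.
- by rewrite FaE dvdz_mull.
apply: contra nlD => lF'; apply: dvdz_mulr.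
have -> : d = U.[a] * F.[a] + V.[a] * F^`().[a] by rewrite -!hornerM -hornerD UV hornerC.
by apply: rpredD; apply: dvdz_mull => //; rewrite FaE dvdz_mull.
Qed.

(** Clearing denominators in [p] and in a Bezout relation with its derivative gives integral data
    with constant a b c. The primes found from it have a simple root modulo l, which lifts to
    Q_l. *)
Lemma split_primes (p : {poly rat}) : (1 < size p)%N -> coprimep p p^`() ->
  forall B : nat, exists l : primeN, (B < val l)%N /\
  forall (R : realType) (Ql : padic_field R l),
    exists z : Ql, root (map_poly (Ql_Q Ql) p) z.
Proof.
move=> szp cop B.
have [F [a a0 pE]] := rat_poly_scale p.
have /Bezout_eq1_coprimepP[[u v] /= uv] := cop.
have [U [b b0 uE]] := rat_poly_scale u.
have [V [c c0 vE]] := rat_poly_scale v.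
have aQ : (a%:~R : rat) != 0 by rewrite intr_eq0.
have bQ : (b%:~R : rat) != 0 by rewrite intr_eq0.
have cQ : (c%:~R : rat) != 0 by rewrite intr_eq0.
have szF : (1 < size F)%N.
  by move: szp; rewrite pE size_scale ?invr_eq0 // size_map_inj_poly //; apply: intr_inj.
have UV : (c%:P * U) * F + (b%:P * V) * F^`() = (a * b * c)%:P.
  apply: (map_inj_poly (f := intr : int -> rat)); [exact: intr_inj|by []|].
  rewrite !(rmorphD, rmorphM) /= !map_polyC /= -deriv_map /= ?rmorphM /=.
  rewrite -[RHS]mulr1 -uv pE uE vE derivZ -!mul_polyC.
  set F' := map_poly _ F; set U' := map_poly _ U; set V' := map_poly _ V.
  have aV : (a%:~R : rat)%:P * (a%:~R^-1)%:P = 1 by rewrite -polyCM mulfV.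
  have bV : (b%:~R : rat)%:P * (b%:~R^-1)%:P = 1 by rewrite -polyCM mulfV.
  have cV : (c%:~R : rat)%:P * (c%:~R^-1)%:P = 1 by rewrite -polyCM mulfV.
  transitivity ((a%:~R)%:P * (a%:~R^-1)%:P * ((b%:~R)%:P * (b%:~R^-1)%:P) *
      ((c%:~R)%:P * U' * F') + (a%:~R)%:P * (a%:~R^-1)%:P *
      ((c%:~R)%:P * (c%:~R^-1)%:P) * ((b%:~R)%:P * V' * F'^`())).
    by rewrite aV bV cV !mul1r.
  by ring.
have abc0 : a * b * c != 0 by rewrite !mulf_neq0.
have [l [x [pr_l Bl Fx F'x]]] := prime_divisors_of_values szF UV abc0 B.
exists (exist _ l pr_l); split=> // R Ql.
have [z zF] := @hensel_int R (exist _ l pr_l) Ql F x Fx F'x.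
exists z; rewrite pE map_polyZ rootZ; last first.
  by rewrite fmorphV invr_eq0 fmorph_eq0.
rewrite -map_poly_comp (eq_map_poly (g := intr)) // => i /=.
by rewrite rmorph_int.
Qed.

(** * Specialization to Q_l-points *)

(** If [p] does not divide q, a Bezout relation evaluated at [z] forces q(z) to be nonzero. For [p]
    a minimal polynomial, its number field thus embeds into [Q]. *)
Lemma horner_minpoly_eq0 (p : {poly rat}) (Q : fieldType) (g : {rmorphism rat -> Q}) (z : Q) :
  (forall q, ~~ (p %| q) -> coprimep p q) -> root (map_poly g p) z ->
  forall q, ((map_poly g q).[z] == 0) = (p %| q).
Proof.
move=> pcop /rootP pz q; have [/divpK <-|npq] := boolP (p %| q).
  by rewrite rmorphM hornerM /= pz mulr0 eqxx.
have /Bezout_eq1_coprimepP[[a b] /= ab] := pcop q npq.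
apply: contraTF isT => /eqP qz; have /eqP := congr1 (fun r => (map_poly g r).[z]) ab.
rewrite rmorphD !rmorphM rmorph1 /= hornerD !hornerM pz qz !mulr0 addr0 hornerC.
by rewrite eq_sym oner_eq0.
Qed.

(** A [Q]-point of [X] at which every alternative in [s] fails would specialize to an algC-point
    with the same defect. The number [x] is a primitive element for the coefficients in [s] together
    with [extra]. *)
Lemma transfer_power N (X : closed_sub rat N) (j0 : 'I_N) (u v : nat)
    (s : seq ({mpoly algC[N * N]} * nat)) (extra : seq algC) :
  (forall y, qpts X y -> exists2 pD, pD \in s &
     mx_eval (idfun : algC -> algC) y pD.1 ^+ u =
     (y j0 j0) ^+ v * (\det y ^+ pD.2) ^+ u) ->
  exists x : algC,
    (forall c, c \in extra -> exists q, (map_poly ratr q).[x] = c) /\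
    forall (Q : fieldType) (g : {rmorphism rat -> Q}) (p : {poly rat}) (z : Q),
      (forall q, root (map_poly ratr q) x = (p %| q)) ->
      (forall q, ~~ (p %| q) -> coprimep p q) -> root (map_poly g p) z ->
      forall M, pts X g M -> exists t, t ^+ u = (M j0 j0) ^+ v.
Proof.
move=> Hs.
pose coefs := flatten [seq [seq pD.1@_m | m <- msupp pD.1] | pD <- s].
have [x _ [ps psE]] := algC_PET (coefs ++ extra); exists x.
have inx c : c \in coefs ++ extra -> exists q, (map_poly ratr q).[x] = c.
  by rewrite psE => /mapP[q _ ->]; exists q.
split=> [c cin|Q g p z rootE pcop pz M XM].
  by apply: inx; rewrite mem_cat cin orbT.
pose h : {rmorphism {poly rat} -> algC} := horner_eval x \o map_poly ratr.
pose e : {rmorphism {poly rat} -> Q} := horner_eval z \o map_poly g.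
have he a : (e a == 0) = (h a == 0).
  by rewrite /e /h /= !horner_evalE (horner_minpoly_eq0 pcop pz) -rootE.
have /choice[lift Hlift] pD : exists P : {mpoly {poly rat}[N * N]},
    pD \in s -> map_mpoly h P = pD.1.
  have [pDs|npDs] := boolP (pD \in s); last by exists 0.
  have /choice[l Hl] m : exists q, m \in msupp pD.1 -> h q = pD.1@_m.
    have [ms|] := boolP (m \in msupp pD.1); last by exists 0.
    have [|q qE] := inx pD.1@_m.
      rewrite mem_cat; apply/orP; left; apply/flattenP.
      by exists [seq pD.1@_m | m <- msupp pD.1]; [apply: map_f|apply: map_f].
    by exists q => _; rewrite -qE.
  exists (\sum_(m <- msupp pD.1) l m *: 'X_[m]) => _.
  rewrite raddf_sum /= [RHS]mpolyE big_seq [RHS]big_seq; apply: eq_bigr => m ms.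
  by rewrite map_mpolyZ map_mpolyX Hl.
apply: contrapT => /forallNP nt.
pose eM : {rmorphism {mpoly {poly rat}[N * N]} -> Q} := mmap e (fun i => mxvec M 0 i).
pose det0 := \det (generic_mx {poly rat} N).
pose term (pD : {mpoly algC[N * N]} * nat) := lift pD ^+ u -
  'X_(mxvec_index j0 j0) ^+ v * (det0 ^+ pD.2) ^+ u.
(* A point where [V] does not vanish is an invertible matrix at which every alternative fails. *)
pose V := det0 * \prod_(pD <- s) term pD.
have [uM XM0] := XM.
have dM : \det M != 0 by rewrite -unitfE -unitmxE.
have eMdet : eM det0 = \det M by exact: mmap_det_generic.
have nV : ~ [set q | eM q = 0] V.
  apply/eqP; rewrite rmorphM /= [mmap _ _ det0]eMdet mulf_neq0 //.
  rewrite rmorph_prod prodf_seq_neq0; apply/allP => pD _ /=.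
  apply/eqP => H; apply: (nt (eM (lift pD) / (\det M) ^+ pD.2)).
  have {}H : eM (term pD) = 0 by [].
  rewrite expr_div_n; apply: (canLR (mulfK _)); first by rewrite !expf_neq0.
  move: H; rewrite rmorphB rmorphM !rmorphXn eMdet => /eqP; rewrite subr_eq0 => /eqP ->.
  by congr (_ ^+ _ * _); rewrite /eM /= mmapX mmap1U mxvecE.
(* The kernel of evaluation at [M] meets the constants in the kernel of [e], which is that of [h];
   so [h] extends to an algC-point where [V] is nonzero. *)
have [a nea Ha] := extend_place (prime_kernel eM) nV.
have eMC b : eM b%:MP = e b by rewrite /eM /= mmapC.
have [||y [yP yV]] := Ha algC h.
- by move=> b; rewrite /= eMC => /eqP; rewrite he => /eqP.
- by rewrite -he -eMC; apply/eqP.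
pose Y : 'M[algC]_N := vec_mx (\row_i y i).
have Yy : (fun i => mxvec Y 0 i) = y by apply/funext => i; rewrite vec_mxK mxE.
have ydet : mmap h y det0 = \det Y by rewrite -Yy; exact: mmap_det_generic.
move: yV; rewrite rmorphM /= ydet mulf_eq0 negb_or => /andP[dY].
rewrite rmorph_prod prodf_seq_neq0 => /allP /= Yterm.
have XY : qpts X Y.
  split; first by rewrite unitmxE unitfE.
  move=> q Xq.
  have ce b : e (polyC b) = g b by rewrite /e /= map_polyC horner_evalE hornerC.
  have ch b : h (polyC b) = ratr b by rewrite /h /= map_polyC horner_evalE hornerC.
  have := yP (map_mpoly polyC q); rewrite /= (mmap_map_mpoly _ _ ce) => /(_ (XM0 _ Xq)).
  by rewrite (mmap_map_mpoly _ _ ch) /mx_eval Yy.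
have [pD pDs] := Hs Y XY; apply/eqP; rewrite -subr_eq0.
have := Yterm pD pDs; congr (_ != 0).
rewrite rmorphB rmorphM !rmorphXn /= ydet mmapX mmap1U -Yy mxvecE.
congr (_ ^+ _ - _); rewrite -(Hlift _ pDs) /mx_eval.
by rewrite (mmap_map_mpoly (h := idfun) _ _ (fun=> erefl)).
Qed.

(** * Power residues and cyclotomic characters *)

Lemma Fp_int_eq0 (p : nat) (n : int) : prime p -> (n%:~R == 0 :> 'F_p) = (p %| n)%Z.
Proof.
move=> pr_p; have nat_case j : (j%:R == 0 :> 'F_p) = (p %| j)%N.
  by rewrite (dvdn_pcharf (pchar_Fp pr_p)).
by case: n => j; rewrite dvdzE /= -nat_case ?NegzE ?rmorphN /= ?oppr_eq0.
Qed.

Section PadicPowers.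
Variables (R : realType) (l : primeN) (Ql : padic_field R l).
Notation L := (val l).
Notation abs := (@Ql_abs R l Ql).

Let Lprime : prime L. Proof. exact: (valP l). Qed.
Let LV_lt1 : (L%:R^-1 < 1 :> R).
Proof. by rewrite invf_lt1 ?ltr1n ?prime_gt1 // ltr0n prime_gt0. Qed.

Lemma padic_abs_pow_le1 (x : Ql) j : (0 < j)%N -> abs (x ^+ j) <= 1 -> abs x <= 1.
Proof. by move=> j0; rewrite padic_absX expr_le1 // padic_abs_ge0. Qed.

Lemma padic_pow_sub (x y : Ql) j : abs x <= 1 -> abs y <= 1 ->
  abs (x ^+ j - y ^+ j) <= abs (x - y).
Proof.
move=> x1 y1; have [_] := padic_horner_int 'X^j x1 y1.
by rewrite map_polyXn !hornerXn.
Qed.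

(** If all elements of F_l were p-th powers, the p-th power map would be injective and z would be 1
    modulo l; then 0 = 1 + z + ... + z^(p-1) would be p modulo l. *)
Lemma nonpower_exists (p : nat) (z : Ql) : prime p -> L != p -> z ^+ p = 1 -> z != 1 ->
  exists b : 'F_L, forall c : 'F_L, c ^+ p != b.
Proof.
move=> pr_p Lp zp z1; have p_gt0 := prime_gt0 pr_p.
apply: contrapT => /forallNP nonp.
have surj (b : 'F_L) : exists c : 'F_L, c ^+ p == b.
  by have /existsNP[c /negP/negPn cb] := nonp b; exists c.
have inj : injective (fun c : 'F_L => c ^+ p).
  have [g gK] : exists g : 'F_L -> 'F_L, cancel g (fun c => c ^+ p).
    have /choice[g Hg] := surj; exists g => b; exact/eqP.
  have [g' _ g'K] : bijective g by apply: injF_bij; apply: can_inj gK.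
  move=> c c' cc'; rewrite -[c]g'K -[c']g'K -[g' c]gK -[g' c']gK !g'K.
  by rewrite cc'.
have abs_z : abs z <= 1 by apply: (padic_abs_pow_le1 p_gt0); rewrite zp padic_abs1.
have [a za] := padic_approx_nat abs_z.
have {}za : abs (z - a%:R) < 1 by apply: le_lt_trans za LV_lt1.
have a1 : abs a%:R <= 1 by rewrite pmulrn padic_abs_int.
have Lap : (L %| a%:Z ^+ p - 1)%Z.
  apply: (@padic_abs_lt1 R l Ql); rewrite rmorphB rmorphXn rmorph1 /= -pmulrn -[X in _ - X]zp.
  rewrite -padic_absN opprB.
  by rewrite (le_lt_trans (padic_pow_sub _ abs_z a1)).
have La : (L %| a%:Z - 1)%Z.
  rewrite -Fp_int_eq0 // rmorphB rmorph1 subr_eq0; apply/eqP/inj.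
  apply/eqP; rewrite expr1n -subr_eq0.
  by move: Lap; rewrite -Fp_int_eq0 // rmorphB rmorphXn rmorph1.
have z1_lt1 : abs (z - 1) < 1.
  have -> : z - 1 = (z - a%:R) - (1 - a%:R) by rewrite opprB addrA subrK.
  apply: padic_abs_subt => //; rewrite -padic_absN opprB.
  have := @padic_abs_dvd R l Ql _ 1 _; rewrite expn1 => /(_ _ La).
  by rewrite rmorphB rmorph1 /= -pmulrn expr1 => /le_lt_trans; apply.
pose G : {poly int} := \sum_(i < p) 'X^i.
have GE (x : Ql) : (map_poly intr G).[x] = \sum_(i < p) x ^+ i.
  rewrite rmorph_sum horner_sum; apply: eq_bigr => i _.
  by rewrite /= map_polyXn hornerXn.
have G0 : \sum_(i < p) z ^+ i = 0.
  have /eqP := subrX1 z p; rewrite zp subrr eq_sym mulf_eq0 subr_eq0.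
  by rewrite (negPf z1) => /eqP.
have G1 : \sum_(i < p) (1 : Ql) ^+ i = p%:R.
  by rewrite (eq_bigr (fun=> 1)) => [|i _]; rewrite ?expr1n // sumr_const card_ord.
have abs_1 : abs 1 <= 1 by rewrite padic_abs1.
have [_] := padic_horner_int G abs_z abs_1; rewrite !GE G0 G1 sub0r padic_absN.
move=> /le_lt_trans/(_ z1_lt1); rewrite pmulrn => /padic_abs_lt1.
by rewrite dvdzE /= dvdn_prime2 // (negPf Lp).
Qed.

(** Reducing [t] modulo l to a natural number c makes c^p an approximation of [chi g], precise
    enough for the l-th roots of unity. *)
Lemma galois_power (K : fieldExtType rat) (iota : {rmorphism K -> algC})
    (chi : (algC -> algC) -> Ql) g (p : nat) (t : Ql) :
  is_cyclotomic iota chi -> GK iota g -> (0 < p)%N -> chi g = t ^+ p ->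
  exists c : nat, forall zeta, zeta ^+ L = 1 -> g zeta = zeta ^+ (c ^ p).
Proof.
move=> cyc Gg p_gt0 chiE; have [chi1 Hchi] := cyc g Gg.
have t1 : abs t <= 1 by apply: (padic_abs_pow_le1 p_gt0); rewrite -chiE.
have [c tc] := padic_approx_nat t1; exists c => zeta zL.
apply: (Hchi 1%N); last by rewrite expn1.
rewrite expr1 chiE natrX (le_trans _ tc) // padic_pow_sub //.
by rewrite pmulrn padic_abs_int.
Qed.

Lemma cyclotomic_neq0 (K : fieldExtType rat) (iota : {rmorphism K -> algC})
    (chi : (algC -> algC) -> Ql) g :
  is_cyclotomic iota chi -> GK iota g -> chi g != 0.
Proof.
move=> cyc Gg; have [_ Hchi] := cyc g Gg; apply/eqP => chi0.
have [z zprim] := C_prim_root_exists (prime_gt0 Lprime).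
have [_ _ /bij_inj g_inj _] := Gg.
have gM : monoid_morphism g by case: Gg.
have zL : z ^+ (L ^ 1)%N = 1 by rewrite expn1 prim_expr_order.
have gz : g z = z ^+ 0.
  apply: (Hchi 1%N) => //; rewrite chi0 subrr.
  by rewrite (eqP (_ : abs 0 == 0)) ?padic_abs_eq0 // invr_ge0 ler0n.
have : z = 1 by apply: g_inj; rewrite gz gM.1.
move=> z1; have := prime_gt1 Lprime; rewrite -[L](_ : 1%N = _) //.
by apply/esym/eqP; rewrite -dvdn1 (prim_order_dvd zprim) z1 expr1n.
Qed.

End PadicPowers.

(** An automorphism is determined on K by the images of a basis, each among the finitely many roots
    of a minimal polynomial; [D] counts the possible choices. *)
Lemma finite_embeddings (K : fieldExtType rat) (iota : {rmorphism K -> algC}) :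
  exists D : nat, forall tau : 'I_D.+1 -> {rmorphism algC -> algC},
    exists i j, i != j /\ forall a, tau i (iota a) = tau j (iota a).
Proof.
pose b := vbasis {:K}.
have /choice[rs Hrs] : forall i : 'I_(\dim {:K}), exists s : seq algC,
    forall tau : {rmorphism algC -> algC}, tau (iota b`_i) \in s.
  move=> i; have [p [_ mon_p] pE] := minCpolyP (iota b`_i).
  have [s sE] := closed_field_poly_normal (map_poly ratr p : {poly algC}).
  exists s => tau; rewrite -root_prod_XsubC.
  have : root (map_poly ratr p) (tau (iota b`_i)).
    have -> : map_poly ratr p = map_poly tau (map_poly ratr p).
      by rewrite -map_poly_comp; apply: eq_map_poly => q /=; rewrite fmorph_rat.
    by rewrite fmorph_root pE dvdpp.
  by rewrite sE (monicP (_ : map_poly ratr p \is monic)) ?scale1r // map_monic.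
pose M := \max_i size (rs i).
pose T : finType := {ffun 'I_(\dim {:K}) -> 'I_M.+1}.
exists #|T| => tau.
pose f i : T := [ffun j : 'I_(\dim {:K}) => inord (index (tau i (iota b`_j)) (rs j))].
have /injectivePn[i [j ij fij]] : ~~ injectiveb f.
  by apply/injectiveP => /leq_card; rewrite card_ord ltnn.
exists i, j; split=> // a.
have tau_b (k : 'I_(\dim {:K})) : tau i (iota b`_k) = tau j (iota b`_k).
  have := congr1 (fun F : T => val (F k)) fij; rewrite !ffunE /=.
  have sM : (size (rs k) < M.+1)%N by rewrite ltnS; apply: leq_bigmax.
  have small m' : (index (tau m' (iota (b`_k)%R)) (rs k) < M.+1)%N.
    by rewrite (leq_trans _ sM) // ltnS index_size.
  rewrite !inordK // => idx.
  by rewrite -(nth_index 0 (Hrs k (tau i))) idx nth_index.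
rewrite (coord_vbasis (memvf a)) !rmorph_sum; apply: eq_bigr => k _.
by rewrite rmorphZ_num (rmorphM (tau i)) (rmorphM (tau j)) tau_b !fmorph_rat.
Qed.

(** For D + 1 of the primes, tau_i acts on mu_{l_i} by an exponent that is no p-th power residue and
    trivially on the other mu_{l_j}. Two of them agree on K; then tau_i^-1 tau_j fixes K but acts on
    mu_{l_j} by a non-residue. *)
Lemma no_power_cyclotomic (K : fieldExtType rat) (iota : {rmorphism K -> algC}) (p : nat) :
  (0 < p)%N ->
  (forall B : nat, exists l : primeN, [/\ (B < val l)%N,
    exists b : 'F_(val l), forall c : 'F_(val l), c ^+ p != b &
    forall g, GK iota g -> exists c : nat, forall zeta, zeta ^+ (val l) = 1 ->
      g zeta = zeta ^+ (c ^ p)]) -> False.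
Proof.
move=> p_gt0 /choice[next Hnext].
have [D HD] := finite_embeddings iota.
pose ls := fix ls n := if n is n'.+1 then next (val (ls n')) else next 0%N.
have ls_lt i j : (i < j)%N -> (val (ls i) < val (ls j))%N.
  elim: j => // j IHj; rewrite ltnS leq_eqVlt => /predU1P[->|/IHj].
    by have [] := Hnext (val (ls j)).
  by move/ltn_trans; apply; have [] := Hnext (val (ls j)).
have ls_pr i : prime (val (ls i)) := valP (ls i).
have ls_neq i j : i != j -> coprime (val (ls i)) (val (ls j)).
  move=> ij; rewrite prime_coprime // dvdn_prime2 //.
  by case: (ltngtP i j) ij => // /ls_lt; [move/ltn_eqF->|move/gtn_eqF->].
have lsP i : (exists b : 'F_(val (ls i)), forall c : 'F_(val (ls i)), c ^+ p != b) /\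
    forall g, GK iota g -> exists c : nat, forall zeta, zeta ^+ (val (ls i)) = 1 ->
      g zeta = zeta ^+ (c ^ p).
  by case: i => [|i] /=; [have [] := Hnext 0%N|have [] := Hnext (val (ls i))].
pose rest (i : 'I_D.+1) := (\prod_(j < D.+1 | j != i) val (ls j))%N.
have cop_rest (i : 'I_D.+1) : coprime (val (ls i)) (rest i).
  rewrite /rest; elim/big_ind: _ => [|a b|j ji]; first exact: coprimen1.
    by rewrite coprimeMr => -> ->.
  by apply: ls_neq; rewrite eq_sym.
have /choice[tau Htau] : forall i : 'I_D.+1, exists tau : {rmorphism algC -> algC},
    (forall j : 'I_D.+1, j != i -> forall z, z ^+ val (ls j) = 1 -> tau z = z) /\
    exists2 b : nat, (forall c : nat, c ^ p != b %[mod val (ls i)])%N &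
      forall z, z ^+ val (ls i) = 1 -> tau z = z ^+ b.
  move=> i; have [[b Hb] _] := lsP i.
  have pr := ls_pr i.
  have b0 : b != 0 by apply: contraNneq (Hb 0) => ->; rewrite expr0n eqn0Ngt p_gt0.
  (* 0 is a p-th power, so [b] is a unit and [k] is prime to the product of the primes, as an
     automorphism of the roots of unity requires. *)
  pose k := chinese (val (ls i)) (rest i) b 1.
  have kb : k = b %[mod val (ls i)] by apply: chinese_modl.
  have k1 : k = 1 %[mod rest i] by apply: chinese_modr.
  have bE : (b : nat)%:R = b by rewrite natr_Zp.
  have cop_k : coprime k (val (ls i) * rest i).
    rewrite coprimeMr -coprime_modl kb coprime_modl -[coprime k (rest i)]coprime_modl k1.
    rewrite coprime_modl coprime1n andbT coprime_sym prime_coprime //.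
    by rewrite (dvdn_pcharf (pchar_Fp pr)) bE.
  have [tau tauE] := Qn_aut_exists cop_k.
  exists tau; split=> [j ji z zj|].
    have jrest : (val (ls j) %| rest i)%N by rewrite /rest (bigD1 j) //= dvdn_mulr.
    rewrite tauE; last first.
      by have /dvdnP[q ->] := jrest; rewrite mulnA mulnC exprM zj expr1n.
    have k1j : k = 1 %[mod val (ls j)].
      by rewrite -(modn_dvdm k jrest) k1 modn_dvdm.
    by rewrite -(expr_mod k zj) k1j (expr_mod 1 zj) expr1.
  exists b => [c|z zi].
    apply: contraNN (Hb c%:R) => /eqP cb; rewrite -natrX -bE.
    by rewrite -(Fp_nat_mod pr (c ^ p)) cb Fp_nat_mod.
  rewrite tauE; last by rewrite exprM zi expr1n.
  by rewrite -(expr_mod k zi) kb (expr_mod b zi).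
have [i [j [ij tau_ij]]] := HD tau.
have [tau_i _] := Htau i; have [_ [b Hb tau_j]] := Htau j.
pose g := algC_invaut (tau i) \o tau j.
have Gg : GK iota g.
  split.
  - by move=> x y; rewrite /g /= !rmorphB.
  - by split=> [|x y]; rewrite /g /= ?rmorph1 ?rmorphM.
  - exists (algC_invaut (tau j) \o tau i) => x; rewrite /g /=.
      by rewrite algC_invautK algC_autK.
    by rewrite algC_invautK algC_autK.
  - by move=> a; rewrite /g /= -tau_ij algC_autK.
have [_ /(_ g Gg)[c Hc]] := lsP j.
have [z zprim] := C_prim_root_exists (prime_gt0 (ls_pr j)).
have zj := prim_expr_order zprim.
have := Hc z zj; rewrite /g /= tau_j // rmorphXn /=.
have -> : algC_invaut (tau i) z = z.
  by rewrite -{1}(tau_i j _ z zj) ?algC_autK // eq_sym.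
move/eqP; rewrite (eq_prim_root_expr zprim) => /eqP H.
by have := Hb c; rewrite -H eqxx.
Qed.

(** * Component groups *)

Section Components.
Variables (N : nat) (X Y : closed_sub rat N).
Hypotheses (gX : mx_group (qpts X)) (gY : mx_group (qpts Y)).
Hypothesis XY : qpts X `<=` qpts Y.
Implicit Types (x y : 'M[algC]_N) (Z : closed_sub rat N).
Notation coset x Z := (mulset [set x] (id_component (qpts Z))).

Lemma mem_coset x Z y : x \in unitmx ->
  coset x Z y <-> id_component (qpts Z) (invmx x *m y).
Proof.
move=> ux; split=> [[_ [z [-> Cz ->]]]|Cy]; first by rewrite mulKmx.
by exists x, (invmx x *m y); split; rewrite ?mulKVmx.
Qed.

Lemma coset_eq x x' Z : mx_group (qpts Z) -> qpts Z x -> qpts Z x' ->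
  id_component (qpts Z) (invmx x *m x') <-> coset x Z = coset x' Z.
Proof.
move=> gZ Zx Zx'; have [Zu Z1 ZM ZV] := gZ; have [Cu C1 CM CV] := idc_group gZ.
have ux := Zu _ Zx; have ux' := Zu _ Zx'; split=> [Cxx'|E]; last first.
  by apply/mem_coset => //; rewrite E; apply/mem_coset => //; rewrite mulVmx.
have Cx'x : id_component (qpts Z) (invmx x' *m x).
  by have := CV _ Cxx'; rewrite invmxM ?unitmx_inv // invmxK.
apply/seteqP; split=> y /mem_coset Cy; apply/mem_coset => //.
  by have := CM _ _ Cx'x (Cy ux); rewrite mulmxA mulmxK.
by have := CM _ _ Cxx' (Cy ux'); rewrite mulmxA mulmxK.
Qed.

Lemma pi0_incl_coset x : pi0_incl Y (coset x X) = coset x Y.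
Proof.
have [_ X1 _ _] := gX; have [_ C1 CM _] := idc_group gY.
apply/seteqP; split=> [_ [_ [c [[_ [d [-> Cd ->]]] Cc ->]]]|_ [_ [c [-> Cc ->]]]].
  exists x, (d *m c); split; rewrite ?mulmxA //.
  by apply: (CM) => //; apply: idc_mono Cd.
exists x, c; split=> //; exists x, 1%:M; split; rewrite ?mulmx1 //.
exact: idc1.
Qed.

Lemma mulset_coset x x' Z : mx_group (qpts Z) -> qpts Z x -> qpts Z x' ->
  mulset (coset x Z) (coset x' Z) = coset (x *m x') Z.
Proof.
move=> gZ Zx Zx'; have [Zu Z1 ZM ZV] := gZ; have [Cu C1 CM CV] := idc_group gZ.
have ux := Zu _ Zx; have ux' := Zu _ Zx'.
apply/seteqP; split.
  move=> _ [_ [_ [[_ [c [-> Cc ->]]] [_ [c' [-> Cc' ->]]] ->]]].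
  exists (x *m x'), (invmx x' *m c *m x' *m c'); split=> //.
    apply: (CM) => //; rewrite -[x' in _ *m x']invmxK; apply: idc_conj => //.
    exact: ZV.
  by rewrite !mulmxA mulmxK.
move=> _ [_ [c [-> Cc ->]]]; exists x, (x' *m c); split; last by rewrite mulmxA.
  by exists x, 1%:M; rewrite mulmx1.
by exists x', c.
Qed.

Lemma mx_eval_map_mx (k : fieldType) (A B : comUnitRingType) (f : {rmorphism k -> A})
    (g : {rmorphism A -> B}) (h : {rmorphism k -> B}) (M : 'M[A]_N) p :
  (forall c, g (f c) = h c) -> mx_eval h (map_mx g M) p = g (mx_eval f M p).
Proof.
move=> ghE; rewrite /mx_eval; elim/mpolyind: p => [|c e p _ _ IHp]; first by rewrite !rmorph0.
rewrite !rmorphD /= IHp !mmapZ !mmapX rmorphM /= ghE; congr (_ * _ + _).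
rewrite /mmap1 rmorph_prod; apply: eq_bigr => i _.
by rewrite rmorphXn -map_mxvec mxE.
Qed.

Lemma qpts_galois (tau : {rmorphism algC -> algC}) Z M :
  qpts Z M -> qpts Z (map_mx tau M).
Proof.
move=> [uM ZM]; split; first by rewrite map_unitmx.
move=> p Zp; have := ZM p Zp.
rewrite (mx_eval_map_mx (f := ratr) (h := ratr) (g := tau)) => [->|c].
  by rewrite rmorph0.
by rewrite /= fmorph_rat.
Qed.

(** The preimage under [tau] of a closed set is closed: the inverse automorphism is applied to the
    coefficients of its equations. *)
Lemma connected_galois (tau : {rmorphism algC -> algC}) (T : set 'M[algC]_N) :
  zariski_connected T -> zariski_connected [set map_mx tau M | M in T].
Proof.
move=> Tc Z1 Z2 [S1 ->] [S2 ->] TZ TZ0.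
pose tauV := algC_invaut tau.
pose Z (S : set {mpoly algC[N * N]}) :=
  [set M | forall p, S p -> mx_eval (idfun : algC -> algC) M p = 0].
have ZE S M : Z S (map_mx tau M) <-> Z [set map_mpoly tauV p | p in S] M.
  have evE p : mx_eval (idfun : algC -> algC) (map_mx tau M) p =
      tau (mx_eval (idfun : algC -> algC) M (map_mpoly tauV p)).
    rewrite -(mx_eval_map_mx (f := idfun) (g := tau) (h := tau)) // /mx_eval.
    rewrite (mmap_map_mpoly (h := tau) (g := tauV) (hg := idfun)) // => c.
    exact: algC_invautK.
  split=> [ZM _ [p Sp <-]|ZM p Sp].
    by apply: (fmorph_inj tau); rewrite rmorph0 -evE ZM.
  by rewrite evE (ZM (map_mpoly tauV p)) ?rmorph0 //; exists p.
have [||||H|H] := Tc (Z [set map_mpoly tauV p | p in S1]) (Z [set map_mpoly tauV p | p in S2]).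
- by exists [set map_mpoly tauV p | p in S1].
- by exists [set map_mpoly tauV p | p in S2].
- move=> M TM; case: (TZ (map_mx tau M)) => [|H|H]; first by exists M.
    by left; apply/ZE.
  by right; apply/ZE.
- apply/seteqP; split=> // M [TM [/ZE H1 /ZE H2]].
  have : ([set map_mx tau M | M in T] `&` (Z S1 `&` Z S2)) (map_mx tau M).
    by split=> //; exists M.
  by rewrite TZ0.
- by left=> _ [M TM <-]; apply/ZE/H.
- by right=> _ [M TM <-]; apply/ZE/H.
Qed.

Lemma idc_galois (tau : {rmorphism algC -> algC}) Z x : qpts Z 1%:M ->
  id_component (qpts Z) x -> id_component (qpts Z) (map_mx tau x).
Proof.
move=> Z1 Cx.
have : [set map_mx tau M | M in id_component (qpts Z)] `<=` id_component (qpts Z).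
  apply: idc_max; first by move=> _ [M /idc_sub ZM <-]; apply: qpts_galois.
    exact/connected_galois/idc_connected.
  by exists 1%:M; [apply: idc1|rewrite map_mx1].
by apply; exists x.
Qed.

Lemma pi0_gal_coset (tau : {rmorphism algC -> algC}) x Z : qpts Z 1%:M ->
  pi0_gal tau (coset x Z) = coset (map_mx tau x) Z.
Proof.
move=> Z1; apply/seteqP; split=> [_ [_ [_ [c [-> Cc ->]]] <-]|_ [_ [c [-> Cc ->]]]].
  by exists (map_mx tau x), (map_mx tau c); split=> //; [apply: idc_galois|rewrite map_mxM].
exists (x *m map_mx (algC_invaut tau) c).
  by exists x, (map_mx (algC_invaut tau) c); split=> //; apply: idc_galois.
rewrite map_mxM; congr (_ *m _).
by apply/matrixP => i j; rewrite !mxE algC_invautK.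
Qed.

(** The two premises are injectivity and surjectivity on cosets; compatibility with products and
    with Galois follows from the description of components as cosets. *)
Lemma pi0_incl_isoP :
  (forall x, qpts X x -> id_component (qpts Y) x -> id_component (qpts X) x) ->
  (forall y, qpts Y y -> exists2 x, qpts X x & id_component (qpts Y) (invmx y *m x)) ->
  pi0_incl_is_iso X Y.
Proof.
move=> inj surj; have [Xu X1 XM XV] := gX; have [Yu Y1 YM YV] := gY; split.
- split.
  + by move=> _ [x Xx ->]; exists x; [apply: XY|rewrite pi0_incl_coset].
  + move=> C C'; rewrite !inE => -[x Xx ->] [x' Xx' ->].
    rewrite !pi0_incl_coset => /(coset_eq gY (XY Xx) (XY Xx')) Cxx'.
    by apply/coset_eq => //; apply: inj => //; apply: (XM) => //; apply: XV.
  + move=> _ [y Yy ->]; have [x Xx Cyx] := surj y Yy.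
    exists (coset x X); first by exists x.
    by rewrite pi0_incl_coset; apply/esym/coset_eq => //; apply: XY.
- move=> _ _ [x Xx ->] [x' Xx' ->].
  rewrite mulset_coset // !pi0_incl_coset mulset_coset //; exact: XY.
- move=> tau _ _ [x Xx ->].
  by rewrite pi0_gal_coset // !pi0_incl_coset pi0_gal_coset.
Qed.

End Components.

(** * The similitude character *)

Lemma GK_inverse (K : fieldExtType rat) (iota : {rmorphism K -> algC}) g :
  GK iota g -> exists2 h, GK iota h & g \o h = idfun.
Proof.
move=> [gB gM [h gK hK] giota]; exists h; last by apply/funext => x; apply: hK.
split.
- by move=> x y; apply: (can_inj gK); rewrite gB !hK.
- by split=> [|x y]; apply: (can_inj gK); rewrite ?gM.1 ?gM.2 !hK ?gM.1.
- by exists g.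
- by move=> a; rewrite -{1}giota gK.
Qed.

Section MainArgument.
Variables (R : realType) (K : fieldExtType rat) (iota : {rmorphism K -> algC}) (m : nat).
Variables (Ql : forall l : primeN, padic_field R l) (chi : forall l, (algC -> algC) -> Ql l).
Variable rho : forall l, (algC -> algC) -> 'M[Ql l]_m.
Hypothesis Hchi : forall l, is_cyclotomic iota (chi l).
Hypothesis rho_rep : forall l, continuous_rep iota (rho l).
Variables (G : closed_sub rat m) (X : closed_sub rat (m + 1)).
Hypotheses (X_group : is_group_scheme X) (XG : sub_times_Gm G X).
Hypothesis X_epi : projections_epi G X.
Hypothesis X_galois : forall l,
  subscheme (Gl_alg iota (rho_tilde (rho l) (chi l)) (base_ext iota))
            (base_scheme (Ql_Q (Ql l)) X).

Notation r0 := (rshift m ord0 : 'I_(m + 1)).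
Let nu (M : 'M[algC]_(m + 1)) : algC := M r0 r0.

Let nuE M : pr_Gm M = nu M.
Proof. by rewrite /pr_Gm !mxE. Qed.

Lemma qpts_group : mx_group (qpts X).
Proof.
have [X1 XM XV] := X_group (ratr : {rmorphism rat -> algC}).
by split=> // M [].
Qed.

Lemma qpts_uclosed : uclosed (qpts X).
Proof.
have evE (M : 'M[algC]_(m + 1)) p :
    mx_eval (idfun : algC -> algC) M (map_mpoly ratr p) = mx_eval ratr M p.
  exact: (mmap_map_mpoly (g := ratr) (h := idfun) (hg := ratr)).
exists [set map_mpoly ratr p | p in X]; apply/seteqP; split=> M [uM XM]; split=> //.
  by move=> _ [p Xp <-]; rewrite evE; apply: XM.
by move=> p Xp; rewrite -evE; apply: XM; exists p.
Qed.

Lemma similitude_mul x y : qpts X x -> qpts X y -> nu (x *m y) = nu x * nu y.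
Proof.
move=> Xx Xy; have [_ _ xE] := XG (f := ratr) Xx; have [_ _ yE] := XG (f := ratr) Xy.
rewrite -!nuE {1}xE {1}yE /on_W mulmx_block /pr_Gm block_mxKdr.
by rewrite mul0mx add0r -scalar_mxM mxE.
Qed.

Lemma similitude_surj (c : algC) : c != 0 -> exists2 x, qpts X x & nu x = c.
Proof.
have [_ H] := X_epi; move=> /H[x Xx xc]; exists x => //.
by rewrite -nuE.
Qed.

Lemma qpts_ker_N : qpts (ker_N X) = [set y | qpts X y /\ nu y = 1].
Proof.
have evE (M : 'M[algC]_(m + 1)) :
    mx_eval ratr M ('X_(mxvec_index r0 r0) - 1) = nu M - 1.
  by rewrite rmorphB rmorph1 /= /mx_eval mmapX mmap1U mxvecE.
apply/seteqP; split=> M.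
  move=> [uM KM]; split; first by split=> // p Xp; apply: KM; left.
  have := KM _ (or_intror erefl); rewrite evE => /eqP.
  by rewrite subr_eq0 => /eqP.
move=> [[uM XM] nuM]; split=> // p [/XM//|->].
by rewrite evE nuM subrr.
Qed.

(** The image of Galois lies in its Zariski closure, hence in [X]; invertibility comes from an
    inverse of [g] and from the nonvanishing of [chi]. *)
Lemma galois_point l g : GK iota g ->
  pts X (Ql_Q (Ql l)) (rho_tilde (rho l) (chi l) g).
Proof.
move=> Gg; set M := rho_tilde _ _ g.
have [rho1 rhoM _] := rho_rep l.
have [h Gh gh] := GK_inverse Gg.
have /mulmx1_unit[urho _] : rho l g *m rho l h = 1%:M by rewrite -rhoM // gh.
have uM : M \in unitmx.
  rewrite unitmxE /M /rho_tilde /on_W det_ublock det_scalar1 unitrM -unitmxE urho.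
  by rewrite unitfE (cyclotomic_neq0 (Hchi l)).
have [|_ XM] := X_galois (f := idfun) (t := M).
  split=> // p; apply; exists g => //; split=> //.
  by move=> _ [a _ <-]; case: Gg.
split=> // p Xp.
have <- : mx_eval (idfun : Ql l -> Ql l) M (map_mpoly (Ql_Q (Ql l)) p) =
    mx_eval (Ql_Q (Ql l)) M p.
  exact: (mmap_map_mpoly (h := idfun)).
by apply: XM; exists p.
Qed.

Lemma galois_similitude l g : (rho_tilde (rho l) (chi l) g) r0 r0 = chi l g.
Proof. by rewrite /rho_tilde /on_W block_mxEdr mxE eqxx. Qed.

(* If nu^v = f^u on the identity component, with a prime p dividing u and prime
   to v, then for infinitely many primes l all the values of the cyclotomic
   character chi_l are p-th powers in Q_l, which is absurd. *)
Lemma similitude_not_power f p u v : regular f -> prime p -> (p %| u)%N ->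
  coprime p v -> ~ (forall x, id_component (qpts X) x -> f x ^+ u = nu x ^+ v).
Proof.
move=> rf pr_p pu cop fnu; have p_gt0 := prime_gt0 pr_p.
have [s Hs] := power_on_cosets qpts_uclosed qpts_group similitude_mul similitude_surj rf fnu.
have [zeta zprim] := C_prim_root_exists p_gt0.
(* Adding [zeta] to the coefficients puts a nontrivial p-th root of unity into Q_l for every prime l
   used below. *)
have [x [Hx transfer]] := transfer_power [:: zeta] Hs.
have [q0 q0E] := Hx zeta (mem_head _ _).
have [P [monP rootP Pcop]] := minpoly_coprime x.
have szP : (1 < size P)%N.
  have /root_size_gt1 : root (map_poly ratr P) x by rewrite rootP.
  by rewrite map_poly_eq0 monic_neq0 // size_map_poly; apply.
have P'0 : P^`() != 0.
  have lc : P`_(size P).-1 = 1 by rewrite -lead_coefE (monicP monP).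
  apply: contraTneq szP => P'0; move: lc.
  have := congr1 (fun Q : {poly rat} => Q`_(size P).-2) P'0.
  rewrite coef_deriv coef0 => /eqP; rewrite mulrn_eq0 /=.
  by case: (size P) => [|[|n]] //= /eqP -> /eqP; rewrite eq_sym oner_eq0.
have copP : coprimep P P^`().
  apply: Pcop; apply/negP => /(dvdp_leq P'0); rewrite leqNgt lt_size_deriv //.
  exact: monic_neq0.
apply: (@no_power_cyclotomic K iota p p_gt0) => B.
(* The bound p makes l different from p, which [nonpower_exists] requires. *)
have [l [Bl splitl]] := split_primes szP copP (maxn B p).
have [z Pz] := splitl R (Ql l).
have evz := horner_minpoly_eq0 Pcop Pz.
exists l; split.
- by apply: leq_ltn_trans Bl; apply: leq_maxl.
- apply: (@nonpower_exists R l (Ql l) p (map_poly (Ql_Q (Ql l)) q0).[z]) => //.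
  + by rewrite gtn_eqF // (leq_ltn_trans _ Bl) // leq_maxr.
  + apply/eqP; rewrite -subr_eq0.
    have -> : (map_poly (Ql_Q (Ql l)) q0).[z] ^+ p - 1 =
        (map_poly (Ql_Q (Ql l)) (q0 ^+ p - 1)).[z].
      by rewrite rmorphB rmorphXn rmorph1 /= hornerD hornerN horner_exp hornerC.
    rewrite evz -rootP rootE rmorphB rmorphXn rmorph1 /= hornerD hornerN horner_exp.
    by rewrite hornerC q0E (prim_expr_order zprim) subrr.
  + rewrite -subr_eq0.
    have -> : (map_poly (Ql_Q (Ql l)) q0).[z] - 1 =
        (map_poly (Ql_Q (Ql l)) (q0 - 1)).[z].
      by rewrite rmorphB rmorph1 /= hornerD hornerN hornerC.
    rewrite evz -rootP rootE rmorphB rmorph1 /= hornerD hornerN hornerC q0E.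
    rewrite subr_eq0; apply: contraTneq (prime_gt1 pr_p) => zeta1.
    rewrite -leqNgt; have := prim_order_dvd zprim 1.
    by rewrite expr1 zeta1 eqxx dvdn1 => /eqP->.
move=> g Gg; have [t tu] := transfer _ _ _ _ rootP Pcop Pz _ (galois_point l Gg).
rewrite galois_similitude in tu.
have chi0 := cyclotomic_neq0 (Hchi l) Gg.
(* With u = u' p and v a = 1 + p b, the equality chi^v = t^u becomes chi = (t^(u' a) / chi^b)^p. *)
have [a [b ab]] : exists a b, (v * a = 1 + p * b)%N.
  have v_gt0 : (0 < v)%N.
    by rewrite lt0n; apply: contraTneq cop => ->; rewrite /coprime gcdn0 gtn_eqF ?prime_gt1.
  case: (egcdnP p v_gt0) => a b; rewrite gcdnC (eqP cop) => ab _.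
  by exists a, b; rewrite mulnC ab mulnC addnC.
have /dvdnP[u' u'E] := pu.
apply: (galois_power (Hchi l) Gg p_gt0 (t := t ^+ (u' * a) / chi l g ^+ b)).
rewrite expr_div_n -!exprM mulnAC -u'E exprM tu -exprM ab mulnC.
by rewrite exprD expr1 mulfK // expf_neq0.
Qed.

Lemma similitude_pi0_iso : pi0_incl_is_iso (ker_N X) X.
Proof.
have gX := qpts_group; have [Xu X1 XM XV] := gX.
have nu1 := character1 gX similitude_mul similitude_surj.
have nuV := characterV gX similitude_mul similitude_surj.
apply: pi0_incl_isoP; rewrite ?qpts_ker_N //.
- split=> [x [/Xu]//||x y [Xx nux] [Xy nuy]|x [Xx nux]]; split=> //.
  + exact: XM.
  + by rewrite similitude_mul // nux nuy mulr1.
  + exact: XV.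
  + by rewrite nuV // nux invr1.
- by move=> x [].
- have [ker_idc|[f [p [u [v [rf pr_p pu cop fnu]]]]]] :=
    kernel_dichotomy qpts_uclosed gX (regular_coord algC r0 r0) similitude_mul similitude_surj.
    by move=> x [_ nux] Cx; apply: ker_idc.
  by case: (similitude_not_power rf pr_p pu cop).
- move=> y Xy.
  (* Surjectivity: y is moved into the kernel within its component, by an element of the identity
     component on which [nu] is (nu y)^-1. *)
  have [|a Ca nua] := character_idc_surj qpts_uclosed gX similitude_mul similitude_surj
    (c := (nu y)^-1).
    by rewrite invr_eq0 (character_neq0 gX similitude_mul similitude_surj).
  have Xa := idc_sub Ca.
  exists (y *m a); last by rewrite mulKmx // Xu.
  split; first exact: XM.
  by rewrite similitude_mul // nua mulfV // (character_neq0 gX similitude_mul similitude_surj).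
Qed.

End MainArgument.

Theorem theorem8p13
  (R : realType)
  (* the number field K, inside its algebraic closure *)
  (K : fieldExtType rat) (iota : {rmorphism K -> algC})
  (* the polarized Hodge structure (V, psi) of weight n *)
  (n m : nat) (psi : 'M[rat]_m) (H : 'I_n.+1 -> {vspace 'cV[R[i]]_m})
  (HV : polarized_hodge psi H)
  (* (D1), (D2) *)
  (D : set 'M[rat]_m) (D_ring : is_subring_mx D)
  (D1 : forall b p, D b -> mx_stable (map_mx ratr b) (H p))
  (rhoe : (algC -> algC) -> 'M[rat]_m -> 'M[rat]_m)
  (D2 : discrete_action iota D rhoe)
  (* de Rham data, (DR1), (DR2) *)
  (psiDR : 'M[K]_m) (F : nat -> {vspace 'cV[K]_m})
  (comp : {rmorphism K -> R[i]} -> 'M[R[i]]_m)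
  (VDR : de_rham_comparison psi H psiDR F comp)
  (delta : 'M[rat]_m -> 'M[algC]_m)
  (DR12 : de_rham_action iota H comp D delta)
  (* l-adic fields and cyclotomic characters *)
  (Ql : forall l : primeN, padic_field R l)
  (Cl : forall (l : primeN) (lambda : prime_over iota l),
          Cl_field (Ql l) lambda)
  (chi : forall l, (algC -> algC) -> Ql l)
  (Hchi : forall l, is_cyclotomic iota (chi l))
  (* the representations rho_l, with psi_l : V_l x V_l -> Q_l(-n) equivariant *)
  (rho : forall l, (algC -> algC) -> 'M[Ql l]_m)
  (rho_rep : forall l, continuous_rep iota (rho l))
  (rho_psi : forall l g, GK iota g -> forall v w,
     let psil := map_mx (Ql_Q (Ql l)) psi in
     gram psil (rho l g *m v) (rho l g *m w) = chi l g ^- n * gram psil v w)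
  (* (R1) - (R4) *)
  (R1_compatible : strictly_compatible iota rho)
  (R1_HT : forall l (lambda : prime_over iota l),
     hodge_tate_type (Cl l lambda) (chi l) (rho l))
  (R2 : frobenius_weights iota n rho)
  (phi : forall (l : primeN) (lambda : prime_over iota l),
     'I_n.+1 -> 'M[Cl l lambda]_m)
  (R3 : forall l (lambda : prime_over iota l),
     hodge_tate_decomp (chi l) (rho l) F (phi l lambda))
  (R4_equivariant : forall l g b, GK iota g -> D b ->
     let toQl := map_mx (Ql_Q (Ql l)) in
     rho l g *m toQl b = toQl (rhoe g b) *m rho l g)
  (R4_HT : forall l (lambda : prime_over iota l),
     decomp_compat F D delta (phi l lambda))
  (* (T) and (T tilde) *)
  (G : set algC -> closed_sub rat m)
  (HT : hyp_T iota psi rho G)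
  (Gt : set algC -> closed_sub rat (m + 1))
  (HTt : hyp_Tt iota rho chi G Gt) :
  pi0_incl_is_iso (ker_N (Gt (base_ext iota))) (Gt (base_ext iota)).
Proof.
have base_fin : is_finite_ext iota (base_ext iota).
  split=> [a|_ _ [a _ <-] [b _ <-]|_ _ [a _ <-] [b _ <-]|_ [a _ <-]|].
  - by exists a.
  - by exists (a - b); rewrite ?rmorphB.
  - by exists (a * b); rewrite ?rmorphM.
  - by exists a^-1; rewrite ?fmorphV.
  exists [:: 1] => _ [a _ <-]; exists (fun=> a).
  by rewrite big_ord1 mulr1.
have [[X_group _] XG X_epi X_galois] := HTt.1 _ base_fin.
exact: (similitude_pi0_iso Hchi rho_rep X_group XG X_epi X_galois).
Qed.
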